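(* Let $s>2$ be an integer. The ergodic $\mathfrak{S}^{\mathbb{N}}$-invariant Borel probability measures on the set of graphs with vertex set $\mathbb{N}$ that are concentrated on the set of universal $K_s$-free homogeneous countable graphs are exactly the measures $\mu_{\{X,m,E\}}$, where $(X,m,E)$ ranges over the $K_s$-free universal measurable graphs.
   Context: Graphs are undirected, without loops or multiple edges. Graphs with vertex set $\mathbb{N}$ are identified with their adjacency matrices, i.e. infinite symmetric $\{0,1\}$-matrices with zero diagonal, with the weak (product) topology and its Borel $\sigma$-field. $\mathfrak{S}^{\mathbb{N}}$ is the group of all permutations of $\mathbb{N}$, acting by simultaneous permutation of rows and columns. $K_s$ is the complete graph on $s$ vertices; a graph is $K_s$-free if it contains no $K_s$. A countable $K_s$-free graph $\Gamma$ is universal $K_s$-free (homogeneous) if every finite $K_s$-free graph embeds in $\Gamma$ as an induced subgraph and every isomorphism between two finite induced subgraphs of $\Gamma$ extends to an automorphism of $\Gamma$. A measurable graph is a triple $(X,m,E)$ where $(X,m)$ is a standard Lebesgue space with continuous (atomless) probability measure $m$ and $E\subset X\times X$ is a symmetric measurable set of positive $(m\times m)$-measure (considered up to null sets). Put $E_x=\{y:(x,y)\in E\}$. It is pure if the map $x\mapsto E_x \pmod 0$ from $X$ to the algebra of mod $0$ classes of measurable sets is injective mod $0$, i.e. injective on a set of full measure. A pure measurable graph is $K_s$-free universal if for $m^{\infty}$-almost all sequences $(x_k)_{k\ge1}\in X^{\infty}$ the graph induced by $E$ on the vertices $x_1,x_2,\dots$ is a universal $K_s$-free countable graph. $\mu_{\{X,m,E\}}$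 denotes the image of the Bernoulli measure $m^{\infty}$ on $X^{\infty}$ under the map $(x_i)_i\mapsto (e_{i,j})_{i,j\in\mathbb{N}}$, $e_{i,j}=\chi_E(x_i,x_j)$ for $i\neq j$, $e_{i,i}=0$, where $\chi_E$ is the characteristic function of $E$. *)

(* Defs.v *)
From HB Require Import structures.
From mathcomp Require Import all_boot all_order all_algebra.
From mathcomp Require Import all_classical all_reals all_analysis.

Set Implicit Arguments.
Unset Strict Implicit.
Unset Printing Implicit Defensive.
Import Order.TTheory GRing.Theory Num.Theory.

Local Open Scope classical_set_scope.
Local Open Scope ring_scope.

Section abstract_graphs.

Definition contains_K (V : Type) (e : V -> V -> bool) (s : nat) : Prop :=
  exists f : 'I_s -> V,
    injective f /\ forall i j : 'I_s, i != j -> e (f i) (f j).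

Definition K_free (V : Type) (e : V -> V -> bool) (s : nat) : Prop :=
  ~ contains_K e s.

Definition induced_embedding (V W : Type) (h : V -> V -> bool)
    (e : W -> W -> bool) (f : V -> W) : Prop :=
  injective f /\ forall x y, e (f x) (f y) = h x y.

Definition automorphism (V : Type) (e : V -> V -> bool) (f : V -> V) : Prop :=
  bijective f /\ forall x y, e (f x) (f y) = e x y.

Definition induced_iso (V : Type) (e : V -> V -> bool) (A B : set V)
    (f : V -> V) : Prop :=
  set_bij A B f /\ forall x y, A x -> A y -> e (f x) (f y) = e x y.

Definition homogeneous (V : Type) (e : V -> V -> bool) : Prop :=
  forall (A B : set V) (f : V -> V),
    finite_set A -> finite_set B -> induced_iso e A B f ->
    exists g, automorphism e g /\ {in A, g =1 f}.

Definition universal_K_free (V : Type) (e : V -> V -> bool) (s : nat) : Prop :=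
  [/\ K_free e s,
      forall (W : finType) (h : rel W), symmetric h -> irreflexive h ->
        K_free h s -> exists f : W -> V, induced_embedding h e f
    & homogeneous e].

End abstract_graphs.

Definition adjacency : set {ptws (nat * nat)%type -> bool} :=
  [set e | (forall i j, e (i, j) = e (j, i)) /\ (forall i, e (i, i) = false)].

Definition graphN : Type := set_type adjacency.
HB.instance Definition _ := Topological.copy graphN (set_type adjacency).

Definition edge (g : graphN) (i j : nat) : bool := set_val g (i, j).

Lemma edge_sym (g : graphN) i j : edge g i j = edge g j i.
Proof. by have [+ _] := set_valP g; apply. Qed.

Lemma edge_irr (g : graphN) i : edge g i i = false.
Proof. by have [_ +] := set_valP g; apply. Qed.

Lemma adjacencyP (e : rel nat) (esym : symmetric e) (eirr : irreflexive e) :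
  (fun p : nat * nat => e p.1 p.2) \in adjacency.
Proof. by rewrite inE; split=> [i j|i] /=; [exact: esym|exact: eirr]. Qed.

Definition mk_graphN (e : rel nat) (esym : symmetric e)
    (eirr : irreflexive e) : graphN :=
  SigSub (adjacencyP esym eirr).

Definition empty_graphN : graphN :=
  @mk_graphN (fun _ _ => false) (fun _ _ => erefl) (fun _ => erefl).
HB.instance Definition _ := isPointed.Build graphN empty_graphN.

Definition graph_space : measurableType _ :=
  g_sigma_algebraType (@open graphN).

Definition relabel (f : nat -> nat) (g : graph_space) : graph_space :=
  @mk_graphN (fun i j => edge g (f i) (f j))
    (fun i j => edge_sym g (f i) (f j)) (fun i => edge_irr g (f i)).

Section measures_on_graphs.
Context {R : realType}.
Local Open Scope ereal_scope.

Definition perm_invariant (mu : probability graph_space R) : Prop :=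
  forall f : nat -> nat, bijective f ->
  forall A : set graph_space, measurable A -> mu (relabel f @^-1` A) = mu A.

(* Sets are required to be invariant only mod 0: as the group of all
   permutations is uncountable, quantifying over strictly invariant sets
   would give a weaker notion (the isomorphism class of the Rado graph is a
   single orbit, yet it carries the distinct invariant measures G(N, p),
   0 < p < 1, and all their mixtures). *)
Definition perm_ergodic (mu : probability graph_space R) : Prop :=
  forall A : set graph_space, measurable A ->
    (forall f : nat -> nat, bijective f ->
       mu (relabel f @^-1` A `+` A) = 0) ->
    mu A = 0 \/ mu A = 1.

End measures_on_graphs.

Definition cylinder_base d (X : measurableType d) : set (set (nat -> X)) :=
  \bigcup_(i in [set: nat])
    preimage_set_system setT (fun x : nat -> X => x i) measurable.

Definition sequence_space d (X : measurableType d) : measurableType _ :=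
  g_sigma_algebraType (@cylinder_base d X).

(* M is the infinite product measure m^oo; it exists for every probability
   measure m, and is unique since the sets below form a pi-system generating
   the sigma-algebra. *)
Definition bernoulli_measure (R : realType) d (X : measurableType d)
    (m : probability X R) (M : probability (sequence_space X) R) : Prop :=
  forall (n : nat) (A : nat -> set X), (forall i, measurable (A i)) ->
    M [set x | forall i, (i < n)%N -> A i (x i)] = (\prod_(i < n) m (A i))%E.

(* Rokhlin's notion: m is complete and isomorphic mod 0 to the unit interval
   with the (completed) Lebesgue measure, by a bijection f between subsets
   X0 and I0 of full measure. In particular m has no atoms. *)
Definition continuous_lebesgue_space (R : realType) d (X : measurableType d)
    (m : probability X R) : Prop :=
  measure_is_complete m /\
  exists (X0 : set X) (I0 : set R) (f : X -> R),
    [/\ m.-negligible (~` X0),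
        I0 `<=` `[0, 1] /\ completed_lebesgue_measure.-negligible (`[0, 1] `\` I0),
        set_bij X0 I0 f,
        forall A, A `<=` X0 -> measurable A <->
          ((wlength idfun)^*)%mu.-cara.-measurable (f @` A)
      & forall A, A `<=` X0 -> measurable A ->
          m A = completed_lebesgue_measure (f @` A)].

Record measurable_graph (R : realType) := MeasurableGraph {
  mg_display : measure_display;
  mg_carrier : measurableType mg_display;
  mg_measure : probability mg_carrier R;
  mg_lebesgue : continuous_lebesgue_space mg_measure;
  mg_edges : set (mg_carrier * mg_carrier);
  mg_edges_measurable : measurable mg_edges;
  mg_edges_sym : forall x y, mg_edges (x, y) -> mg_edges (y, x);
  mg_edges_pos : (0 < (mg_measure \x mg_measure) mg_edges)%E }.
Arguments mg_edges {R} _ _.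

Section measurable_graphs.
Context {R : realType}.
Local Open Scope ereal_scope.
Variable G : measurable_graph R.

Local Notation X := (mg_carrier G).
Local Notation m := (mg_measure G).
Local Notation E := (mg_edges G).

Definition pure : Prop :=
  exists X0 : set X, [/\ measurable X0, m X0 = 1 &
    forall x y, X0 x -> X0 y ->
      m (xsection E x `+` xsection E y) = 0 -> x = y].

Definition sample_edge (x : sequence_space X) : rel nat :=
  fun i j => (i != j) && ((x i, x j) \in E).

Lemma sample_edge_sym x : symmetric (sample_edge x).
Proof.
move=> i j; rewrite /sample_edge eq_sym; congr (_ && _).
by apply/idP/idP; rewrite !inE; exact: mg_edges_sym.
Qed.

Lemma sample_edge_irr x : irreflexive (sample_edge x).
Proof. by move=> i; rewrite /sample_edge eqxx. Qed.

Definition sample_graph (x : sequence_space X) : graph_space :=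
  mk_graphN (sample_edge_sym x) (sample_edge_irr x).

Definition K_free_universal (s : nat) : Prop :=
  pure /\ exists2 M, bernoulli_measure m M &
    {ae M, forall x, universal_K_free (edge (sample_graph x)) s}.

(* Measures are functions on all sets in the library, so equality of Borel
   measures is equality on measurable sets. *)
Definition is_graph_measure (mu : probability graph_space R) : Prop :=
  exists2 M, bernoulli_measure m M &
    forall A, measurable A -> mu A = pushforward M sample_graph A.

End measurable_graphs.

(* Main.v *)
Require Import Defs.
From HB Require Import structures.
From mathcomp Require Import all_boot all_order all_algebra.
From mathcomp Require Import all_classical all_reals all_analysis.
From mathcomp Require Import measurable_realfun zify ring lra.

(** From sampling to ergodicity. Being universal is a Borel condition, because a
    countable graph is homogeneous iff finite partial isomorphisms extend by one
    point. Exchangeability and ergodicity of the sampled graph follow from the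
    uniqueness of the Bernoulli measure and from the independence of its
    coordinates (Hewitt-Savage).

    From ergodicity to a measurable graph. Since mu is invariant under all
    injections of nat, the restriction of a random graph to any infinite vertex set
    is again universal a.s.; as two vertices of a universal K_s-free graph are
    non-adjacent iff a K_(s-2) is joined to both, adjacency of two vertices can be
    read off a.s. from their adjacencies to any infinite set of other vertices.
    Condition on the graph g of even vertices, and call type of an odd vertex the
    sequence of its adjacencies to the even ones. The types are conditionally
    independent, with law nu_g given by limits of empirical frequencies, and by the
    remark above the adjacency of two odd vertices is a function of their types, so
    that no further randomness occurs. Realizing nu_g on [0, 1] by splitting
    intervals yields a measurable graph. Ergodicity makes disjoint vertex sets
    independent; a second moment computation then shows that for almost every g the
    graph sampled from nu_g has law mu. The measure nu_g has no atoms because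
    distinct vertices are separated by the even ones, and the graph is pure because
    the type of a vertex can be read off from its adjacencies to sampled points. *)

Set Implicit Arguments.
Unset Strict Implicit.
Unset Printing Implicit Defensive.
Import Order.TTheory GRing.Theory Num.Theory.
Import numFieldNormedType.Exports.

Local Open Scope classical_set_scope.

(** * Universal graphs *)

(** In a general exchangeable graph an edge may need a coin of its own even when the types of its
    two ends are known, and then no set E can represent the law. Universality removes this coin only
    because the K_(s-2) deciding an edge can be found inside a prescribed infinite vertex set away
    from both ends. Hence the split into even and odd vertices: infinitely many vertices are left to
    decide edges, and infinitely many to be sampled.

    Conditioning on the even vertices is done through moments. The frequency of each finite word
    among the types is a limit of averages over 2^k vertices, whose almost sure convergence needs
    only constant pair correlations; the integrals of products of these limits over window events
    then play the role of a disintegration of mu.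

    An edge between odd vertices depends on infinitely many even ones, so it is not a window event
    of the data it is computed from. Laws are therefore compared first without these edges, on
    finite patterns, and the edges are restored by one measurable map.

    Every property required of g holds almost surely, so a single g satisfying all of them yields
    the measurable graph. Without ergodicity the sampled law would vary with g, and mu would only be
    a mixture. *)

Section partial_isomorphisms.
Variable e : nat -> nat -> bool.
Implicit Types s : seq (nat * nat).

(** A list of pairs stands for a finite partial map; comparing the two equality tests makes it
    single-valued and injective at once. *)
Definition partial_iso s : bool :=
  all (fun p => all (fun q =>
    ((p.1 == q.1) == (p.2 == q.2)) && (e p.1 q.1 == e p.2 q.2)) s) s.

Definition one_point_extension :=
  forall s, partial_iso s -> forall c, exists d, partial_iso ((c, d) :: s).

Lemma partial_isoP s : reflect (forall p q, p \in s -> q \in s ->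
  (p.1 == q.1) = (p.2 == q.2) /\ e p.1 q.1 = e p.2 q.2) (partial_iso s).
Proof.
apply: (iffP allP) => [h p q ps qs|h p ps].
  by have /allP/(_ q qs)/andP[/eqP -> /eqP ->] := h p ps.
by apply/allP => q qs; have [-> ->] := h p q ps qs; rewrite !eqxx.
Qed.

Lemma partial_iso_graph s f : injective f -> (forall x y, e (f x) (f y) = e x y) ->
  {in s, forall p, p.2 = f p.1} -> partial_iso s.
Proof.
move=> injf fe sf; apply/partial_isoP => p q ps qs.
by rewrite !sf// fe (inj_eq injf).
Qed.

Lemma partial_iso_swap s :
  partial_iso s -> partial_iso [seq (p.2, p.1) | p <- s].
Proof.
move=> /partial_isoP h; apply/partial_isoP => p q.
move=> /mapP[p' p's ->] /mapP[q' q's ->] /=.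
by have [-> ->] := h _ _ p's q's.
Qed.

(** The map listed in [s], made total by index lookup, extends to an automorphism [g] by
    homogeneity, and [g c] is the point sought. *)
Lemma homogeneous_one_point_extension : homogeneous e -> one_point_extension.
Proof.
move=> hom s /partial_isoP siso c.
pose f x := nth 0%N (map snd s) (index x (map fst s)).
have fE p : p \in s -> f p.1 = p.2.
  move=> ps; have h : p.1 \in map fst s by exact: map_f.
  have hi : (index p.1 (map fst s) < size s)%N by rewrite -(size_map fst) index_mem.
  rewrite /f (nth_map (0%N, 0%N))//.
  set q := nth _ _ _; have qs : q \in s by exact: mem_nth.
  have [+ _] := siso _ _ qs ps.
  have -> : q.1 = p.1 by rewrite /q -(nth_map _ 0%N fst)// nth_index.
  by rewrite eqxx => /esym/eqP.
have [||| g [[gbij ge] gf]] := hom [set` map fst s] [set` map snd s] f.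
- exact: finite_seq.
- exact: finite_seq.
- split; first split.
  + by move=> x /= /mapP[p ps ->]; rewrite fE//; exact: map_f.
  + move=> x y; rewrite !inE /= => /mapP[p ps ->] /mapP[q qs ->].
    by rewrite !fE// => /eqP; have [<- _] := siso _ _ ps qs => /eqP.
  + by move=> y /= /mapP[p ps ->]; exists p.1; [exact: map_f|rewrite fE].
  + move=> x y /= /mapP[p ps ->] /mapP[q qs ->]; rewrite !fE//.
    by have [_ ->] := siso _ _ ps qs.
exists (g c); apply: (partial_iso_graph (bij_inj gbij) ge) => p.
rewrite inE => /predU1P[->//|ps].
by rewrite gf ?fE// inE /=; exact: map_f.
Qed.

(** Back and forth: step n puts n into the domain and, after swapping coordinates, into the range.
    The union of the increasing chain is an automorphism. *)
Lemma one_point_extension_homogeneous : one_point_extension -> homogeneous e.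
Proof.
move=> ext A B f finA finB [[fAB finj _] fe].
have [a aA] := (finite_seqP A).1 finA; subst A.
pose s0 := [seq (x, f x) | x <- a].
have s0iso : partial_iso s0.
  apply/partial_isoP => p q /mapP[x xa ->] /mapP[y ya ->] /=.
  rewrite fe//; split=> //; apply/eqP/eqP => [->//|].
  by apply: finj; rewrite inE.
have step n (s : {s | partial_iso s}) : exists s' : {s | partial_iso s},
   {subset sval s <= sval s'} /\
   (exists d, (n, d) \in sval s') /\ (exists c, (c, n) \in sval s').
  case: s => s siso /=; have [d h1] := ext s siso n.
  have [c /partial_iso_swap] := ext _ (partial_iso_swap h1) n.
  rewrite /= -map_comp (eq_map (g := id)); last by case.
  rewrite map_id => h2.
  exists (exist (fun s => partial_iso s) _ h2) => /=.
  split=> [p ps|]; first by rewrite !inE ps !orbT.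
  by split; [exists d|exists c]; rewrite !inE eqxx ?orbT.
pose next n (s : {s | partial_iso s}) := sval (cid (step n s)).
pose S := fix S n := if n is n'.+1 then next n' (S n') else exist (fun s => partial_iso s) s0 s0iso.
have Sle m n : (m <= n)%N -> {subset sval (S m) <= sval (S n)}.
  elim: n => [|n IH]; first by rewrite leqn0 => /eqP ->.
  rewrite leq_eqVlt => /predU1P[->//|/IH{}IH] p /IH ps.
  by rewrite /= /next; set h := cid _; have [+ _] := svalP h; exact.
have Scons p q m n : p \in sval (S m) -> q \in sval (S n) ->
    (p.1 == q.1) = (p.2 == q.2) /\ e p.1 q.1 = e p.2 q.2.
  move=> pm qn; have /partial_isoP h := svalP (S (maxn m n)); apply: h.
    by apply: Sle pm; exact: leq_maxl.
  by apply: Sle qn; exact: leq_maxr.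
have Sdom n : exists d, (n, d) \in sval (S n.+1).
  by rewrite /= /next; set h := cid _; have [_ []] := svalP h.
have Scod n : exists c, (c, n) \in sval (S n.+1).
  by rewrite /= /next; set h := cid _; have [_ []] := svalP h.
pose g x := sval (cid (Sdom x)); pose g' y := sval (cid (Scod y)).
have gP x : (x, g x) \in sval (S x.+1) by exact: (svalP (cid (Sdom x))).
have g'P x : (g' x, x) \in sval (S x.+1) by exact: (svalP (cid (Scod x))).
exists g; split.
  split.
    exists g' => x.
      by have [/= + _] := Scons _ _ _ _ (g'P (g x)) (gP x); rewrite eqxx => /eqP.
    by have [/= + _] := Scons _ _ _ _ (gP (g' x)) (g'P x); rewrite eqxx => /esym/eqP.
  by move=> x y; have [_] := Scons _ _ _ _ (gP x) (gP y).
move=> x /set_mem/= xa.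
have : (x, f x) \in sval (S 0%N) by exact: map_f.
by move=> /(Scons _ _ _ _ (gP x))[/=]; rewrite eqxx => /esym/eqP.
Qed.

End partial_isomorphisms.

Section universal_graphs.
Variables (e : nat -> nat -> bool) (s : nat).
Hypotheses (esym : symmetric e) (eirr : irreflexive e).

Definition common_clique (J : set nat) (k u v : nat) : Prop :=
  exists c : 'I_k -> nat, [/\ forall i, J (c i),
    forall i j, i != j -> e (c i) (c j) & forall i, e u (c i) && e v (c i)].

Hypotheses (s_gt2 : (2 < s)%N) (eU : universal_K_free e s).

(** A copy of [h] exists somewhere; sending the images of [a] and [b] to [u] and [v] is a partial
    isomorphism with two points, and the automorphism extending it carries the whole copy along. *)
Lemma universal_move (W : finType) (h : rel W) (a b : W) u v :
  symmetric h -> irreflexive h -> K_free h s -> a != b -> u != v ->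
  e u v = h a b ->
  exists f : W -> nat, [/\ induced_embedding h e f, f a = u & f b = v].
Proof.
move=> hsym hirr hfree ab uv euv; have [_ emb hom] := eU.
have [f [finj fe]] := emb W h hsym hirr hfree.
pose t x := if x == f a then u else v.
have fab : f a != f b by apply: contra_neq ab; exact: finj.
have ta : t (f a) = u by rewrite /t eqxx.
have tb : t (f b) = v by rewrite /t eq_sym (negPf fab).
have [|||g [[gbij ge] gt]] := hom [set f a; f b] [set u; v] t.
- exact: finite_set2.
- exact: finite_set2.
- split; first split.
  + by move=> x [->|->]; rewrite ?ta ?tb; [left|right].
  + move=> x y; rewrite !inE => -[]-> []->; rewrite ?ta ?tb// => /eqP.
      by rewrite (negPf uv).
    by rewrite eq_sym (negPf uv).
  + by move=> y [->|->]; [exists (f a); [left|]|exists (f b); [right|]].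
  + by move=> x y [->|->] [->|->]; rewrite ?ta ?tb ?eirr ?fe ?euv// esym euv hsym.
exists (g \o f); split.
- split; first exact: inj_comp (bij_inj gbij) finj.
  by move=> x y /=; rewrite ge fe.
- by rewrite /= gt ?ta// inE; left.
- by rewrite /= gt ?tb// inE; right.
Qed.

(** A K_s among at most s vertices uses all of them, hence every pair; one missing edge excludes
    it. *)
Lemma K_free_edge_or (n : nat) (h : rel 'I_n) (a b : 'I_n) :
  (n <= s)%N -> a != b -> h a b = false -> K_free h s.
Proof.
move=> ns ab hab [f [finj fh]].
have : (#|'I_n| <= #|'I_s|)%N by rewrite !card_ord.
move=> /(inj_card_onto finj) fsurj.
have /codomP[x ax] := fsurj a; have /codomP[y bx] := fsurj b.
have xy : x != y by apply: contra_neq ab => xy; rewrite ax bx xy.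
by move: (fh x y xy); rewrite -ax -bx hab.
Qed.

(** K_s without the edge ab is K_s-free. Once a and b are moved onto [u] and [v], the remaining s -
    2 vertices form the clique. *)
Lemma universal_common_clique u v : u != v -> e u v = false ->
  common_clique [set x | x != u /\ x != v] (s - 2) u v.
Proof.
move=> uv euv.
have s0 : (0 < s)%N by apply: leq_trans s_gt2.
have s1 : (1 < s)%N by apply: leq_trans s_gt2.
pose a := Ordinal s0; pose b := Ordinal s1.
pose h : rel 'I_s := fun i j => (i != j) &&
  ~~ (((i == a) && (j == b)) || ((i == b) && (j == a))).
have [|||||f [[finj fe] fa fb]] := @universal_move _ h a b u v _ _ _ _ uv.
- by move=> i j; rewrite /h eq_sym orbC; congr (_ && ~~ (_ || _)); rewrite andbC.
- by move=> i; rewrite /h eqxx.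
- by apply: (@K_free_edge_or _ h a b) => //; rewrite /h !eqxx andbF.
- by [].
- by rewrite euv.
have P (i : 'I_(s - 2)) : (i.+2 < s)%N by have := ltn_ord i; rewrite ltn_subRL.
pose c i := Ordinal (P i).
have cE i : val (c i) = i.+2 by [].
have ca i : c i != a by rewrite -val_eqE.
have cb i : c i != b by rewrite -val_eqE.
have hE i j : h i j = (i != j) &&
  ~~ (((i == a) && (j == b)) || ((i == b) && (j == a))) by [].
clearbody a b c h; exists (f \o c); split.
- by move=> i /=; rewrite -fa -fb !(inj_eq finj).
- move=> i j ij; rewrite /= fe hE (negPf (ca i)) (negPf (cb i)) andbT.
  by apply: contra_neq ij => /(congr1 val); rewrite !cE => -[] ij; exact/val_inj.
- move=> i /=; rewrite -{1}fa -{1}fb !fe !hE (negPf (ca i)) (negPf (cb i)).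
  by rewrite !andbF /= !andbT eq_sym ca eq_sym cb.
Qed.

(** The graph on a, b, c where c is joined to a only, and ab copies uv, lacks the edge bc; having
    three vertices, it is K_s-free for s > 2. *)
Lemma universal_separated u v : u != v ->
  exists w, [/\ w != u, w != v & e u w != e v w].
Proof.
move=> uv.
pose a : 'I_3 := inord 0; pose b : 'I_3 := inord 1; pose c : 'I_3 := inord 2.
have ab : a != b by rewrite -val_eqE /= !inordK.
have ac : a != c by rewrite -val_eqE /= !inordK.
have bc : b != c by rewrite -val_eqE /= !inordK.
pose h : rel 'I_3 := fun i j => ((i == a) && (j == c)) || ((i == c) && (j == a)) ||
  e u v && (((i == a) && (j == b)) || ((i == b) && (j == a))).
have ba := ab; have ca := ac; have cb := bc.
rewrite eq_sym in ba; rewrite eq_sym in ca; rewrite eq_sym in cb.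
have E := (negPf ab, negPf ac, negPf bc, negPf ba, negPf ca, negPf cb, eqxx).
have [|||||f [[finj fe] fa fb]] := @universal_move _ h a b u v _ _ _ _ uv.
- move=> i j; rewrite /h.
  congr (_ || _ && _); rewrite orbC; congr (_ || _); exact: andbC.
- by move=> i; rewrite /h; do 3?[case: eqVneq => [->|_] /=; rewrite ?E ?andbF//].
- by apply: (@K_free_edge_or _ h b c) => //; rewrite /h !E /= !andbF.
- by [].
- by rewrite /h !E /= andbT.
exists (f c); rewrite -fa -fb !(inj_eq finj) !fe ca cb; split=> //.
by rewrite /h !E /= !andbF.
Qed.

End universal_graphs.

Lemma common_clique_contains_K (e : nat -> nat -> bool) (s : nat) J u v :
  symmetric e -> irreflexive e -> (2 < s)%N ->
  e u v -> common_clique e J (s - 2) u v -> contains_K e s.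
Proof.
move=> esym eirr s_gt2 euv [c [_ ce cuv]].
(* The clique indices are shifted by two to make room for [u] and [v]; the default 0 is never
   reached below s. *)
pose F (i : nat) : nat := match i with 0 => u | 1 => v
  | k.+2 => if insub k is Some j then c j else 0%N end.
have FE (i j : 'I_s) : i != j -> e (F i) (F j).
  have aux (k : nat) : (k.+2 < s)%N -> exists j : 'I_(s - 2), val j = k /\ F k.+2 = c j.
    move=> ks; have h : (k < s - 2)%N by rewrite ltn_subRL.
    by exists (Ordinal h); split => //=; rewrite insubT.
  case: i j => [[|[|i]] Hi] [[|[|j]] Hj] //=; rewrite -?val_eqE//= => ij.
  - by have [k [_ /= ->]] := aux j Hj; have /andP[] := cuv k.
  - by rewrite esym.
  - by have [k [_ /= ->]] := aux j Hj; have /andP[] := cuv k.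
  - by have [k [_ /= ->]] := aux i Hi; rewrite esym; have /andP[] := cuv k.
  - by have [k [_ /= ->]] := aux i Hi; rewrite esym; have /andP[] := cuv k.
  - have [k [kE /= ->]] := aux i Hi; have [l [lE /= ->]] := aux j Hj.
    by apply: ce; rewrite -val_eqE kE lE.
(* Injectivity is free: vertices of distinct index are adjacent, and no vertex is adjacent to
   itself. *)
exists (fun i => F i); split=> // i j; apply: contra_eq => /FE.
by move=> h; apply/eqP => Fij; move: h; rewrite Fij eirr.
Qed.

Local Open Scope ring_scope.

(** * The Borel space of graphs *)

Section measurable_formulas.
Context d (T : measurableType d).

Lemma measurable_prop (P : Prop) : measurable [set t : T | P].
Proof.
have [p|np] := pselect P.
  by rewrite (_ : mkset _ = setT)//; apply/seteqP; split.
by rewrite (_ : mkset _ = set0)//; apply/seteqP; split.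
Qed.

Lemma measurable_not (P : T -> Prop) :
  measurable [set t | P t] -> measurable [set t | ~ P t].
Proof. exact: measurableC. Qed.

Lemma measurable_andP (P Q : T -> Prop) : measurable [set t | P t] ->
  measurable [set t | Q t] -> measurable [set t | P t /\ Q t].
Proof. exact: measurableI. Qed.

Lemma measurable_imp (P Q : T -> Prop) : measurable [set t | P t] ->
  measurable [set t | Q t] -> measurable [set t | P t -> Q t].
Proof.
move=> mP mQ; rewrite (_ : mkset _ = ~` [set t | P t] `|` [set t | Q t]).
  by apply: measurableU => //; exact: measurableC.
apply/seteqP; split => t /=; last by move=> [].
by move=> h; have [/h|] := pselect (P t); [right|left].
Qed.

Lemma measurable_ex (I : countType) (P : I -> T -> Prop) :
  (forall i, measurable [set t | P i t]) ->
  measurable [set t | exists i, P i t].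
Proof.
move=> mP.
rewrite (_ : mkset _ = \bigcup_(i in setT) [set t | P i t]).
  by apply: countable_bigcupT_measurable.
  
apply/seteqP; split => t /=; first by move=> [i Pi]; exists i.
by move=> [i _ Pi]; exists i.
Qed.

Lemma measurable_all (I : countType) (P : I -> T -> Prop) :
  (forall i, measurable [set t | P i t]) ->
  measurable [set t | forall i, P i t].
Proof.
move=> mP; rewrite (_ : mkset _ = ~` [set t | exists i, ~ P i t]).
  apply/measurableC/measurable_ex => i; exact/measurable_not.
apply/seteqP; split => t /=; first by move=> h [i]; apply; exact: h.
by move=> h i; apply: contrapT => Pi; apply: h; exists i.
Qed.

End measurable_formulas.

(** * Events determined by finitely many vertices *)

Section graph_space_windows.
Implicit Types (g : graph_space) (C : set graph_space) (n : nat).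

Lemma edge_ext g g' : (forall i j, edge g i j = edge g' i j) -> g = g'.
Proof.
move=> h; apply/val_inj/funext => -[i j].
by have := h i j.
Qed.

Definition agree n g g' :=
  forall i j, (i < n)%N -> (j < n)%N -> edge g i j = edge g' i j.

Definition window n C := forall g g', agree n g g' -> C g -> C g'.

Lemma agree_sym n g g' : agree n g g' -> agree n g' g.
Proof. by move=> h i j ilt jlt; rewrite h. Qed.

Lemma agree_le m n g g' : (m <= n)%N -> agree n g g' -> agree m g g'.
Proof. by move=> mn h i j im jm; apply: h; apply: leq_trans mn. Qed.

Lemma window_le m n C : (m <= n)%N -> window m C -> window n C.
Proof. by move=> mn mC g g' /(agree_le mn); exact: mC. Qed.

Lemma windowE n C g g' : window n C -> agree n g g' -> C g <-> C g'.
Proof. by move=> nC gg'; split; apply: nC => //; exact: agree_sym. Qed.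

Lemma windowC n C : window n C -> window n (~` C).
Proof. by move=> nC g g' gg' nCg /(nC _ _ (agree_sym gg')). Qed.

Lemma windowI n C C' : window n C -> window n C' -> window n (C `&` C').
Proof. by move=> h h' g g' gg' [Cg C'g]; split; [exact: h Cg|exact: h' C'g]. Qed.

Lemma windowU n C C' : window n C -> window n C' -> window n (C `|` C').
Proof.
by move=> h h' g g' gg' [Cg|C'g]; [left; exact: h Cg|right; exact: h' C'g].
Qed.

Lemma windowT n : window n setT.
Proof. by []. Qed.

Definition pattern n (h : {ffun 'I_n * 'I_n -> bool}) : set graph_space :=
  [set g | forall p : 'I_n * 'I_n, edge g p.1 p.2 = h p].

Lemma window_of_pattern n (h : {ffun 'I_n * 'I_n -> bool}) : window n (pattern h).
Proof. by move=> g g' gg' gh p; rewrite -gh gg'. Qed.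

Lemma window_pattern n C : window n C ->
  C = \bigcup_(h in [set h | C `&` @pattern n h !=set0]) pattern h.
Proof.
move=> nC; apply/seteqP; split=> g.
  move=> Cg; have gh : pattern [ffun p : 'I_n * 'I_n => edge g p.1 p.2] g.
    by move=> p; rewrite ffunE.
  by exists [ffun p : 'I_n * 'I_n => edge g p.1 p.2] => //; exists g.
move=> [h [g' [Cg' g'h] gh]]; apply: nC Cg' => i j ilt jlt.
by have := g'h (Ordinal ilt, Ordinal jlt); rewrite -gh.
Qed.

Lemma window_preimage_measurable d (T : measurableType d) (F : T -> graph_space)
    n C : (forall i j, measurable [set t | edge (F t) i j]) -> window n C ->
  measurable (F @^-1` C).
Proof.
move=> mF /window_pattern ->; rewrite preimage_bigcup.
apply: fin_bigcup_measurable; first exact: finite_finset.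
move=> h _; apply: measurable_all => p; case: (h p); first exact: mF.
rewrite (_ : mkset _ = ~` [set t | edge (F t) p.1 p.2]).
  exact/measurableC/mF.
by apply/seteqP; split => t /=; [move=> ->|move=> /negP/negbTE].
Qed.

(** If no window around g stays in U, counterexamples agreeing with g below n converge pointwise to
    g from outside U, against openness. *)
Lemma open_window (U : set graphN) : open U ->
  U = \bigcup_n [set g | forall g', agree n g g' -> U g'].
Proof.
move=> oU; apply/seteqP; split=> g; last by move=> [n _]; apply.
move=> Ug; apply: contrapT => nex.
have {}nex n : exists g', agree n g g' /\ ~ U g'.
  apply: contrapT => h; apply: nex; exists n => // g' gg'.
  by apply: contrapT => Ug'; apply: h; exists g'.
have [y yP] := choice nex.
case: oU => V oV VU.
have : (fun n => set_val (y n) : {ptws (nat * nat)%type -> bool}) @ \oo -->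
    (set_val g : {ptws (nat * nat)%type -> bool}).
  apply/pointwise_cvgP => -[i j].
  suff : (fun n => edge (y n) i j) @ \oo --> edge g i j by [].
  apply: cvg_near_cst; near=> n; apply/esym.
  have [+ _] := yP n; apply; near: n; exact: nbhs_infty_gt.
have : nbhs (set_val g : {ptws (nat * nat)%type -> bool}) V.
  by apply: open_nbhs_nbhs; split=> //; move: Ug; rewrite -VU.
move=> /[swap] /[apply] -[N _ /(_ N (leqnn N))] /= VN.
by have [_] := yP N; rewrite -VU.
Unshelve. all: by end_near. Qed.

Lemma measurable_edge i j : measurable [set g : graph_space | edge g i j].
Proof.
apply: sub_sigma_algebra.
exists [set f : {ptws (nat * nat)%type -> bool} | f (i, j)] => //.
rewrite (_ : mkset _ = (fun f : {ptws (nat * nat)%type -> bool} => f (i, j)) @^-1`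
  [set true]); last by [].
apply: open_comp; last exact: discrete_open.
move=> f _; exact: (@proj_continuous _ (fun=> bool) (i, j)).
Qed.

Lemma window_measurable n C : window n C -> measurable C.
Proof. by move=> nC; apply: (@window_preimage_measurable _ _ id _ _ measurable_edge nC). Qed.

Definition windows : set (set graph_space) := [set C | exists n, window n C].

Lemma graph_space_measurableE : @measurable _ graph_space = <<s windows >>.
Proof.
apply/seteqP; split; last first.
  apply: smallest_sub; first exact: sigma_algebra_measurable.
  by move=> C [n]; exact: window_measurable.
apply: smallest_sub; first exact: smallest_sigma_algebra.
move=> U oU; rewrite (open_window oU); apply: sigma_algebra_bigcup => n.
apply: sub_sigma_algebra; exists n => g g' gg' h g'' g'g''; apply: h.
by move=> i j ilt jlt; rewrite gg'// g'g''.
Qed.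

Lemma windows_setI : setI_closed windows.
Proof.
move=> C C' [n nC] [m mC']; exists (maxn n m); apply: windowI.
  exact: window_le (leq_maxl _ _) nC.
exact: window_le (leq_maxr _ _) mC'.
Qed.

Lemma measurable_fun_graph d (T : measurableType d) (F : T -> graph_space) :
  (forall i j, measurable [set t | edge (F t) i j]) -> measurable_fun setT F.
Proof.
move=> mF; apply: (@measurability _ _ T graph_space setT F windows graph_space_measurableE).
move=> _ [C [n nC] <-]; rewrite setTI; exact: window_preimage_measurable nC.
Qed.

Lemma graph_measure_unique (R : realType)
    (mu1 mu2 : {measure set graph_space -> \bar R}) : (mu1 setT < +oo)%E ->
  (forall n C, window n C -> mu1 C = mu2 C) ->
  forall A, measurable A -> mu1 A = mu2 A.
Proof.
move=> mu1oo h A mA.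
apply: (measure_unique windows (fun=> setT)) => //.
- exact: graph_space_measurableE.
- exact: windows_setI.
- by move=> _; exists 0%N.
- by apply/seteqP; split=> // x _; exists 0%N.
- by move=> C [n]; exact: h.
Qed.

Lemma window_measure_pattern (R : realType)
    (mu1 mu2 : {measure set graph_space -> \bar R}) n C : window n C ->
  (forall h : {ffun 'I_n * 'I_n -> bool}, mu1 (pattern h) = mu2 (pattern h)) ->
  mu1 C = mu2 C.
Proof.
move=> nC h; rewrite (window_pattern nC).
have mp (f : {ffun 'I_n * 'I_n -> bool}) : measurable (pattern f).
  exact: window_measurable (@window_of_pattern _ _).
have tp D : trivIset D (@pattern n).
  by move=> f f' _ _ [g [gf gf']]; apply/ffunP => p; rewrite -gf gf'.
rewrite !measure_fin_bigcup//; try exact: finite_finset.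
by apply: eq_fsbigr => f _; exact: h.
Qed.

Lemma graph_measure_unique_pattern (R : realType)
    (mu1 mu2 : {measure set graph_space -> \bar R}) : (mu1 setT < +oo)%E ->
  (forall n (h : {ffun 'I_n * 'I_n -> bool}), mu1 (pattern h) = mu2 (pattern h)) ->
  forall A, measurable A -> mu1 A = mu2 A.
Proof.
move=> mu1oo h; apply: graph_measure_unique => // n C nC.
exact: window_measure_pattern nC (h n).
Qed.

End graph_space_windows.

(** * Probability measures and approximation of events *)

Section image_probability.
Context d d' (T : measurableType d) (T' : measurableType d') (R : realType).
Variables (P : probability T R) (f : T -> T') (mf : measurable_fun setT f).

Definition image_probability : probability T' R :=
  distribution P (mfun_Sub (mem_set mf)).

End image_probability.

Section product_probability.
Context d d' (T : measurableType d) (T' : measurableType d') (R : realType).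
Variables (P : probability T R) (Q : probability T' R).

Definition product_probability : set (T * T') -> \bar R := (P \x Q)%E.

HB.instance Definition _ := Measure.on product_probability.

Let m_setT : product_probability setT = 1%E.
Proof.
rewrite /product_probability -setXTT product_measure1E//.
have hP := probability_setT P; have hQ := probability_setT Q.
by rewrite [X in (X * _)%E]hP [X in (_ * X)%E]hQ mule1.
Qed.

HB.instance Definition _ := Measure_isProbability.Build _ _ _
  product_probability m_setT.

End product_probability.

Section probability_facts.
Context d (T : measurableType d) (R : realType) (P : probability T R).
Implicit Types A B : set T.

Definition pr A : R := fine (P A).

Lemma prE A : measurable A -> P A = (pr A)%:E.
Proof. by move=> mA; rewrite /pr fineK// fin_num_measure. Qed.

Lemma pr_ge0 A : 0 <= pr A.
Proof. exact/fine_ge0/measure_ge0. Qed.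

Lemma pr_le1 A : measurable A -> pr A <= 1.
Proof. by move=> mA; rewrite -lee_fin -prE// probability_le1. Qed.

Lemma pr_le A B : measurable A -> measurable B -> A `<=` B -> pr A <= pr B.
Proof. by move=> mA mB AB; rewrite -lee_fin -!prE// le_measure ?inE. Qed.

Lemma pr_setT : pr setT = 1.
Proof. by rewrite /pr probability_setT. Qed.

Lemma prU_le A B : measurable A -> measurable B -> pr (A `|` B) <= pr A + pr B.
Proof.
move=> mA mB; rewrite -lee_fin EFinD -!prE//; last exact: measurableU.
exact: measureU2.
Qed.

Lemma pr_dist A B : measurable A -> measurable B -> `|pr A - pr B| <= pr (A `+` B).
Proof.
move=> mA mB.
have mAB := measurableD mA mB; have mBA := measurableD mB mA.
have h1 : pr A <= pr B + pr (A `+` B).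
  apply: le_trans (prU_le mB (measurableU _ _ mAB mBA)); apply: pr_le => //.
    by apply: measurableU => //; exact: measurableU.
  by move=> x Ax; have [|nBx] := pselect (B x); [left|right; left].
have h2 : pr B <= pr A + pr (A `+` B).
  apply: le_trans (prU_le mA (measurableU _ _ mAB mBA)); apply: pr_le => //.
    by apply: measurableU => //; exact: measurableU.
  by move=> x Bx; have [|nAx] := pselect (A x); [left|right; right].
by rewrite ler_norml; lra.
Qed.

Lemma pr0_ae A : measurable A -> P A = 1%E -> P (~` A) = 0%E.
Proof. by move=> mA PA; rewrite probability_setC// PA subee. Qed.

Lemma measurableY A B : measurable A -> measurable B -> measurable (A `+` B).
Proof. by move=> mA mB; apply: measurableU; exact: measurableD. Qed.

Lemma pr_bigcup_tail (F : (set T)^nat) (e : R) : (forall n, measurable (F n)) ->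
  0 < e -> exists n, pr ((\bigcup_i F i) `\` \big[setU/set0]_(i < n) F i) <= e.
Proof.
move=> mF e0; pose G n := (\bigcup_i F i) `\` \big[setU/set0]_(i < n) F i.
have mG n : measurable (G n).
  by apply: measurableD; [exact: bigcupT_measurable|exact: bigsetU_measurable].
have G0 : \bigcap_n G n = set0.
  apply/seteqP; split => // x Gx; have [[i _ Fi] _] := Gx 0%N I.
  have [_] := Gx i.+1 I; apply; rewrite -bigcup_mkord; exists i => //=.
have : P \o G @ \oo --> P (\bigcap_n G n).
  apply: nonincreasing_cvg_mu => //.
  - by rewrite (le_lt_trans (probability_le1 P (mG 0%N))) ?ltry.
  - by rewrite G0.
  - move=> m n mn; apply/subsetPset => x [Fx nx]; split=> //.
    by apply: contra_not nx; rewrite -!bigcup_mkord => -[i im Fi]; exists i => //=;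
       exact: leq_trans mn.
rewrite G0 measure0 => /fine_cvgP[_] /cvgrPdist_le /(_ e e0)[N _ /(_ N (leqnn N))].
rewrite /= sub0r normrN ger0_norm; first by exists N.
exact/fine_ge0/measure_ge0.
Qed.

(** The events approximated by the algebra [G] form a Dynkin class: a countable union is first cut
    to finitely many terms by [pr_bigcup_tail], and finite unions keep the property. *)
Lemma approximation (G : set (set T)) : measurable = <<s G >> ->
  G setT -> setC_closed G -> setU_closed G ->
  forall A (e : R), measurable A -> 0 < e -> exists2 C, G C & pr (A `+` C) <= e.
Proof.
move=> mG GT GC GU A e mA; move: e.
have Gm B : G B -> measurable B by move=> GB; rewrite mG; exact: sub_sigma_algebra.
pose Q A := forall e, 0 < e -> exists2 C, G C & pr (A `+` C) <= e.
have QU B C : measurable B -> measurable C -> Q B -> Q C -> Q (B `|` C).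
  move=> mB mC QB QC e e0.
  have e2 : 0 < e / 2 by rewrite divr_gt0.
  have [B' GB' BB'] := QB _ e2; have [C' GC' CC'] := QC _ e2.
  exists (B' `|` C'); first exact: GU.
  have mBB' := measurableY mB (Gm _ GB'); have mCC' := measurableY mC (Gm _ GC').
  have : pr ((B `|` C) `+` (B' `|` C')) <= pr ((B `+` B') `|` (C `+` C')).
    apply: pr_le => //; [|exact: measurableU|by move=> x /=; tauto].
    by apply: measurableY; apply: measurableU => //; exact: Gm.
  by move=> /le_trans; apply; apply: le_trans (prU_le mBB' mCC') _; lra.
have QG B : G B -> Q B.
  by move=> GB e e0; exists B => //; rewrite setYK /pr measure0 ltW.
suff : Q A by [].
apply: (dynkin_induction mG) => //.
- move=> B C GB GC'; rewrite -(setCK (B `&` C)) setCI.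
  by apply: (GC); apply: GU; exact: GC.
- exact: QG.
- move=> B mB QB e /QB[C GC' BC]; exists (~` C); first exact: GC.
  rewrite (_ : _ `+` _ = B `+` C)// /setY !setDE !setCK setUC.
  by congr (_ `|` _); exact: setIC.
- move=> F mF _ QF e e0; have e2 : 0 < e / 2 by rewrite divr_gt0.
  have [n nF] := pr_bigcup_tail mF e2.
  pose U := \big[setU/set0]_(i < n) F i.
  have mU : measurable U by apply: bigsetU_measurable.
  have : Q U.
    rewrite /U; elim: n {nF U mU} => [|n IH].
      rewrite big_ord0; apply: QG; rewrite -setCT; exact: GC.
    by rewrite big_ord_recr /=; apply: QU => //; apply: bigsetU_measurable.
  move=> /(_ _ e2)[C GC' UC]; exists C => //.
  have mF' : measurable (\bigcup_i F i) by exact: bigcupT_measurable.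
  have m1 := measurableD mF' mU; have m2 := measurableY mU (Gm _ GC').
  have : pr ((\bigcup_i F i) `+` C) <= pr (((\bigcup_i F i) `\` U) `|` (U `+` C)).
    apply: pr_le; [by apply: measurableY => //; exact: Gm|exact: measurableU|].
    move=> x [[Fx Cx]|[Cx Fx]].
      by have [|nUx] := pselect (U x); [right; left|left].
    right; right; split=> // Ux; apply: Fx; move: Ux.
    by rewrite /U -bigcup_mkord => -[i _ Fi]; exists i.
  by move=> /le_trans; apply; apply: le_trans (prU_le m1 m2) _; lra.
- by rewrite -mG.
Qed.

End probability_facts.

Lemma window_approximation (R : realType) (mu : probability graph_space R) A e :
  measurable A -> 0 < e -> exists n C, window n C /\ pr mu (A `+` C) <= e.
Proof.
move=> mA e0.
have [|||C [n nC] AC] := approximation mu graph_space_measurableE _ _ _ mA e0.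
- by exists 0%N.
- by move=> C [n nC]; exists n; exact: windowC.
- move=> C C' [n nC] [m mC']; exists (maxn n m); apply: windowU.
    exact: window_le (leq_maxl _ _) nC.
  exact: window_le (leq_maxr _ _) mC'.
by exists n, C.
Qed.

(** * Relabelling and invariance *)

Section relabelling.
Implicit Types (g : graph_space) (C : set graph_space) (n : nat).

Lemma measurable_relabel f : measurable_fun setT (relabel f).
Proof. by apply: measurable_fun_graph => i j; exact: measurable_edge. Qed.

Lemma edge_relabel f g i j : edge (relabel f g) i j = edge g (f i) (f j).
Proof. by []. Qed.

Lemma relabel_comp f h g : relabel f (relabel h g) = relabel (h \o f) g.
Proof. exact: edge_ext. Qed.

Lemma relabel_preimage_comp f h (C : set graph_space) :
  relabel f @^-1` (relabel h @^-1` C) = relabel (f \o h) @^-1` C.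
Proof. by apply/funext => g; rewrite /preimage /mkset /= relabel_comp. Qed.

Lemma measurable_relabel_preimage f (A : set graph_space) :
  measurable A -> measurable (relabel f @^-1` A).
Proof. by move=> mA; rewrite -[X in measurable X]setTI; exact: measurable_relabel. Qed.

Lemma window_relabel f n m C : window n C -> (forall i, (i < n)%N -> (f i < m)%N) ->
  window m (relabel f @^-1` C).
Proof.
move=> nC fnm g g' gg'; apply: nC => i j ilt jlt.
by apply: gg'; exact: fnm.
Qed.

Lemma relabel_window_eq f f' n C : window n C -> (forall i, (i < n)%N -> f i = f' i) ->
  relabel f @^-1` C = relabel f' @^-1` C.
Proof.
move=> nC ff'; apply/funext => g; apply/propext; apply: (windowE nC) => i j ilt jlt.
by rewrite !edge_relabel !ff'.
Qed.

(** By induction on n, composing with the transposition of [h n] and [f n]; it fixes the earlier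
    values, which differ from both. *)
Lemma extend_injection n (f : nat -> nat) :
  (forall i j, (i < n)%N -> (j < n)%N -> f i = f j -> i = j) ->
  exists2 h, bijective h & forall i, (i < n)%N -> h i = f i.
Proof.
elim: n => [|n IH] finj; first by exists id => //; exists id.
have [|h hbij hf] := IH.
  by move=> i j ilt jlt; apply: finj; exact: ltnW.
pose t x := if x == h n then f n else if x == f n then h n else x.
have tt : cancel t t.
  rewrite /t => x; have [->|xh] := eqVneq x (h n).
    by rewrite eqxx; case: eqVneq => //.
  have [->|xf] := eqVneq x (f n); first by rewrite eqxx.
  by rewrite (negPf xh) (negPf xf).
exists (t \o h); first by apply: bij_comp hbij; exists t.
move=> i; rewrite ltnS leq_eqVlt => /predU1P[->|ilt] /=; first by rewrite /t eqxx.
have ni : i <> n by move=> E; move: ilt; rewrite E ltnn.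
rewrite /t (inj_eq (bij_inj hbij)) (negbTE (introN eqP ni)) hf//.
case: eqP => // /finj; rewrite ltnS (ltnW ilt) ltnSn => /(_ isT isT) //.
Qed.

(** On a window an injection coincides with some permutation, and windows determine the measure. *)
Lemma perm_invariant_injection (R : realType) (mu : probability graph_space R) f :
  perm_invariant mu -> injective f ->
  forall A, measurable A -> mu (relabel f @^-1` A) = mu A.
Proof.
move=> inv finj A mA.
apply: (@graph_measure_unique _ (image_probability mu (measurable_relabel f)) mu) => //.
  exact: fin_num_fun_lty.
move=> n C nC; change (mu (relabel f @^-1` C) = mu C).
have [|h hbij hf] := @extend_injection n f; first by move=> i j _ _ /finj.
rewrite -(relabel_window_eq nC hf) inv//; exact: window_measurable nC.
Qed.

End relabelling.

(** * Universality is a Borel condition *)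

Section universal_measurable.
Variable s : nat.

(** Only quantifiers over countable types remain: finite graphs are transported to ['I_n], and
    one-point extension replaces the quantification over sets, maps and automorphisms. *)
Lemma universal_K_free_countable (e : nat -> nat -> bool) :
  universal_K_free e s <->
  [/\ ~ exists f : {ffun 'I_s -> nat}, injective f /\
        forall i j, i != j -> e (f i) (f j),
      forall (n : nat) (h : {ffun 'I_n * 'I_n -> bool}),
        [/\ symmetric (fun i j => h (i, j)), irreflexive (fun i j => h (i, j)) &
            K_free (fun i j => h (i, j)) s] ->
        exists f : {ffun 'I_n -> nat}, injective f /\
          forall p : 'I_n * 'I_n, e (f p.1) (f p.2) = h p
    & one_point_extension e].
Proof.
have K_freeE : K_free e s <-> ~ exists f : {ffun 'I_s -> nat}, injective f /\
        forall i j, i != j -> e (f i) (f j).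
  split=> h [f [finj fe]]; apply: h; first by exists f.
  exists (finfun f); split => [i j|i j ij]; rewrite !ffunE; first exact: finj.
  exact: fe.
split=> -[h1 h2 h3].
  split; [exact/K_freeE| |exact: homogeneous_one_point_extension].
  move=> n h [hsym hirr hfree].
  have [f [finj fe]] := h2 'I_n (fun i j => h (i, j)) hsym hirr hfree.
  exists (finfun f); split => [i j|[i j]]; rewrite !ffunE; first exact: finj.
  exact: fe.
split; [exact/K_freeE| |exact: one_point_extension_homogeneous].
move=> W h hsym hirr hfree.
have [|f [finj fe]] := h2 #|W| [ffun p => h (enum_val p.1) (enum_val p.2)].
  split.
  - by move=> i j; rewrite !ffunE /= hsym.
  - by move=> i; rewrite !ffunE /= hirr.
  - move=> [f [finj fh]]; apply: hfree; exists (fun i => enum_val (f i)); split.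
      by move=> i j /enum_val_inj /finj.
    by move=> i j /fh; rewrite ffunE.
exists (f \o enum_rank); split; first by move=> x y /finj /enum_rank_inj.
by move=> x y; have := fe (enum_rank x, enum_rank y); rewrite ffunE /= !enum_rankK.
Qed.

Lemma measurable_edge_eq i j b : measurable [set g : graph_space | edge g i j = b].
Proof.
case: b; first exact: (measurable_edge i j).
rewrite (_ : mkset _ = ~` [set g : graph_space | edge g i j]).
  by apply: measurableC; exact: measurable_edge.
by apply/seteqP; split => g /=; [move=> ->|move=> /negP/negbTE].
Qed.

Lemma measurable_partial_iso r :
  measurable [set g : graph_space | partial_iso (edge g) r].
Proof.
rewrite (_ : mkset _ = [set g : graph_space | forall p q : nat * nat,
    p \in r /\ q \in r -> (p.1 == q.1) = (p.2 == q.2) /\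
    exists b, edge g p.1 q.1 = b /\ edge g p.2 q.2 = b]); last first.
  apply/seteqP; split => g /=.
    move=> /partial_isoP h p q [pr qr]; have [? e] := h p q pr qr; split=> //.
    by exists (edge g p.2 q.2).
  move=> h; apply/partial_isoP => p q pr qr; have [? [b [-> ->]]] := h p q (conj pr qr).
  by split.
apply: measurable_all => p; apply: measurable_all => q.
apply: measurable_imp; first exact: measurable_prop.
apply: measurable_andP; first exact: measurable_prop.
by apply: measurable_ex => b; apply: measurable_andP; exact: measurable_edge_eq.
Qed.

Lemma measurable_universal :
  measurable [set g : graph_space | universal_K_free (edge g) s].
Proof.
under eq_set do rewrite (propext (universal_K_free_countable _)).
rewrite (_ : mkset _ =
  ~` [set g | exists f : {ffun 'I_s -> nat}, injective f /\
        forall i j, i != j -> edge g (f i) (f j)] `&`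
  ([set g | forall (n : nat) (h : {ffun 'I_n * 'I_n -> bool}),
        [/\ symmetric (fun i j => h (i, j)), irreflexive (fun i j => h (i, j)) &
            K_free (fun i j => h (i, j)) s] ->
        exists f : {ffun 'I_n -> nat}, injective f /\
          forall p : 'I_n * 'I_n, edge g (f p.1) (f p.2) = h p] `&`
   [set g | one_point_extension (edge g)])); last first.
  by apply/seteqP; split => g /=; [case|case=> ? []].
apply: measurableI; [apply: measurableC|apply: measurableI].
- apply: measurable_ex => f; apply: measurable_andP; first exact: measurable_prop.
  apply: measurable_all => i; apply: measurable_all => j.
  by apply: measurable_imp; [exact: measurable_prop|exact: measurable_edge].
- apply: measurable_all => n; apply: measurable_all => h.
  apply: measurable_imp; first exact: measurable_prop.
  apply: measurable_ex => f; apply: measurable_andP; first exact: measurable_prop.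
  by apply: measurable_all => p; exact: measurable_edge_eq.
- apply: measurable_all => r; apply: measurable_imp; first exact: measurable_partial_iso.
  by apply: measurable_all => c; apply: measurable_ex => k; exact: measurable_partial_iso.
Qed.

End universal_measurable.

Section almost_sure.
Context d (T : measurableType d) (R : realType) (P : probability T R).

Lemma ae_setP (Q : T -> Prop) : measurable [set x | Q x] ->
  {ae P, forall x, Q x} <-> P [set x | Q x] = 1%E.
Proof.
move=> mQ; change (P.-negligible (~` [set x | Q x]) <-> P [set x | Q x] = 1%E).
have N := negligibleP P (measurableC mQ).
split=> [/N|PQ]; last by apply/N; exact: pr0_ae.
change (P (~` [set x | Q x]) = 0%E -> P [set x | Q x] = 1%E).
rewrite probability_setC// (prE P mQ) -EFinB => -[h].
by congr _%:E; lra.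
Qed.

End almost_sure.

Lemma universal_relabel (R : realType) (mu : probability graph_space R) s f :
  perm_invariant mu -> injective f ->
  {ae mu, forall g, universal_K_free (edge g) s} ->
  {ae mu, forall g, universal_K_free (edge (relabel f g)) s}.
Proof.
move=> inv finj; have mU := measurable_universal s.
rewrite (ae_setP mu mU).
rewrite (@ae_setP _ _ _ mu (fun g => universal_K_free (edge (relabel f g)) s)).
  by move=> <-; exact: (perm_invariant_injection inv finj mU).
exact: measurable_relabel_preimage mU.
Qed.

(** * Expectations and averages *)

Section mean.
Context d (T : measurableType d) (R : realType) (P : probability T R).
Implicit Types f g : T -> R.

Definition bounded_measurable f :=
  measurable_fun setT f /\ exists M : R, forall x, `|f x| <= M.

Lemma bm_cst c : bounded_measurable (fun=> c).
Proof. by split; [exact: measurable_cst|exists `|c|]. Qed.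

Lemma bmD f g : bounded_measurable f -> bounded_measurable g ->
  bounded_measurable (fun x => f x + g x).
Proof.
move=> [mf [M fM]] [mg [N gN]]; split; first exact: measurable_funD.
by exists (M + N) => x; apply: le_trans (ler_normD _ _) _; exact: lerD.
Qed.

Lemma bmN f : bounded_measurable f -> bounded_measurable (fun x => - f x).
Proof.
move=> [mf [M fM]]; split; first exact: measurableT_comp.
by exists M => x; rewrite normrN.
Qed.

Lemma bmM f g : bounded_measurable f -> bounded_measurable g ->
  bounded_measurable (fun x => f x * g x).
Proof.
move=> [mf [M fM]] [mg [N gN]]; split; first exact: measurable_funM.
by exists (M * N) => x; rewrite normrM; exact: ler_pM.
Qed.

Lemma bm_norm f : bounded_measurable f -> bounded_measurable (fun x => `|f x|).
Proof.
move=> [mf [M fM]]; split; first exact: measurableT_comp.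
by exists M => x; rewrite normr_id.
Qed.

Lemma bm_indic (A : set T) : measurable A -> bounded_measurable (\1_A).
Proof.
move=> mA; split; first exact: measurable_indic.
by exists 1 => x; rewrite indicE; case: (_ \in _); rewrite ?normr1 ?normr0.
Qed.

Lemma bm_sum n (F : nat -> T -> R) : (forall i, bounded_measurable (F i)) ->
  bounded_measurable (fun x => \sum_(i < n) F i x).
Proof.
move=> bF; elim: n => [|n IH].
  by under [X in bounded_measurable X]eq_fun do rewrite big_ord0; exact: bm_cst.
under [X in bounded_measurable X]eq_fun do rewrite big_ord_recr /=.
exact: bmD.
Qed.

Lemma bm_integrable f : bounded_measurable f -> P.-integrable setT (EFin \o f).
Proof.
move=> [mf [M fM]]; apply: measurable_bounded_integrable => //.
  exact: fin_num_fun_lty.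
exists M; split; first exact: num_real.
by move=> N MN x _; apply: le_trans (fM x) (ltW MN).
Qed.

Definition mean f : R := \int[P]_x f x.

Lemma mean_EFin f : bounded_measurable f -> (\int[P]_x (f x)%:E = (mean f)%:E)%E.
Proof.
by move=> /bm_integrable fi; rewrite /mean /Rintegral fineK// integrable_fin_num.
Qed.

Lemma mean_cst c : mean (fun=> c) = c.
Proof.
rewrite /mean Rintegral_cst//.
by rewrite [X in _ * X](pr_setT P) mulr1.
Qed.

Lemma meanD f g : bounded_measurable f -> bounded_measurable g ->
  mean (fun x => f x + g x) = mean f + mean g.
Proof. by move=> bf bg; rewrite /mean RintegralD//; exact: bm_integrable. Qed.

Lemma meanZ c f : bounded_measurable f -> mean (fun x => c * f x) = c * mean f.
Proof. by move=> bf; rewrite /mean RintegralZl//; exact: bm_integrable. Qed.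

Lemma meanB f g : bounded_measurable f -> bounded_measurable g ->
  mean (fun x => f x - g x) = mean f - mean g.
Proof. by move=> bf bg; rewrite /mean RintegralB//; exact: bm_integrable. Qed.

Lemma mean_sum n (F : nat -> T -> R) : (forall i, bounded_measurable (F i)) ->
  mean (fun x => \sum_(i < n) F i x) = \sum_(i < n) mean (F i).
Proof.
move=> bF; elim: n => [|n IH].
  rewrite big_ord0 -[RHS](mean_cst 0); congr mean.
  by apply/funext => x; rewrite big_ord0.
rewrite big_ord_recr /= -IH -(meanD (bm_sum n bF) (bF n)).
by congr mean; apply/funext => x; rewrite big_ord_recr.
Qed.

Lemma mean_indic A : measurable A -> mean \1_A = pr P A.
Proof.
move=> mA; rewrite /mean /Rintegral /pr; congr fine.
by rewrite integral_indic// setIT.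
Qed.

Lemma mean_le f g : bounded_measurable f -> bounded_measurable g ->
  (forall x, f x <= g x) -> mean f <= mean g.
Proof.
by move=> bf bg fg; apply: le_Rintegral => //; exact: bm_integrable.
Qed.

Lemma mean_ae_eq f g : bounded_measurable f -> bounded_measurable g ->
  {ae P, forall x, f x = g x} -> mean f = mean g.
Proof.
move=> [mf _] [mg _] fg; congr fine; apply: ae_eq_integral => //.
- exact/measurable_EFinP.
- exact/measurable_EFinP.
- by apply: filterS fg => x -> _.
Qed.

Lemma mean_eq0 f : bounded_measurable f -> (forall x, 0 <= f x) ->
  mean f = 0 -> {ae P, forall x, f x = 0}.
Proof.
move=> bf f0 m0; have [mf _] := bf.
have mEf : measurable_fun setT (EFin \o f) by exact/measurable_EFinP.
have : (\int[P]_x `|(EFin \o f) x| = 0)%E.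
  under eq_integral do rewrite gee0_abs ?lee_fin//.
  by rewrite mean_EFin// m0.
move=> /(ae_eq_integral_abs P measurableT mEf).
by apply: filterS => x /(_ I) [].
Qed.

Lemma mean_cvg (f_ : nat -> T -> R) f (M : R) : (forall n, measurable_fun setT (f_ n)) ->
  (forall n x, `|f_ n x| <= M) -> measurable_fun setT f ->
  {ae P, forall x, f_ ^~ x @ \oo --> f x} ->
  mean (f_ n) @[n --> \oo] --> mean f.
Proof.
move=> mf_ fM mf ff.
have bc : bounded_measurable (fun _ : T => M) := bm_cst M.
have [||||| fi _] := @dominated_convergence _ _ _ P setT measurableT
  (fun n => EFin \o f_ n) (EFin \o f) (fun=> M%:E).
- by move=> n; exact/measurable_EFinP.
- exact/measurable_EFinP.
- apply: filterS ff => x /= ff _.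
  by apply/fine_cvgP; split; [exact: nearW|exact: ff].
- exact: (bm_integrable bc).
- by apply: aeW => x n _; rewrite /= lee_fin.
have -> : (\int[P]_x (EFin \o f) x = (mean f)%:E)%E.
  by rewrite /mean /Rintegral fineK// integrable_fin_num.
by move=> /fine_cvgP[_].
Qed.

End mean.
Arguments bm_indic {d T R A}.
Arguments bm_cst {d T R}.

Section averages.
Context d (T : measurableType d) (R : realType) (P : probability T R).

(** Monotone convergence bounds the integral of the infinite sum by B, so the sum is finite almost
    everywhere. *)
Lemma ae_summable (f : nat -> T -> R) (B : R) :
  (forall n, bounded_measurable (f n)) -> (forall n x, 0 <= f n x) ->
  (forall n, \sum_(i < n) mean P (f i) <= B) ->
  {ae P, forall x, cvgn (series (f ^~ x))}.
Proof.
move=> bf f0 fB.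
pose g x : \bar R := (\sum_(i <oo) (f i x)%:E)%E.
have mf n : measurable_fun setT (fun x => (f n x)%:E).
  by apply/measurable_EFinP; case: (bf n).
have f0E n x : (0 <= (f n x)%:E)%E by rewrite lee_fin.
have gB : (\int[P]_x g x <= B%:E)%E.
  rewrite integral_nneseries//.
  apply: lime_le; first by apply: is_cvg_nneseries => n _ _; exact: integral_ge0.
  apply: nearW => n; rewrite big_mkord.
  under eq_bigr do rewrite mean_EFin//.
  by rewrite sumEFin lee_fin.
have g0 x : (0 <= g x)%E by exact: nneseries_ge0.
have gi : P.-integrable setT g.
  apply/integrableP; split.
    by apply: (ge0_emeasurable_sum (P := xpredT)) => //.
  under eq_integral do rewrite gee0_abs//.
  by apply: le_lt_trans gB _; rewrite ltry.
have := integrable_ae measurableT gi; apply: filterS => x /(_ I) gx.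
apply: nondecreasing_is_cvgn.
  by apply/nondecreasing_seqP => n; rewrite seriesSr lerDl.
exists (fine (g x)) => _ [n _ <-].
rewrite -lee_fin fineK// /series /= -sumEFin.
exact: nneseries_lim_ge.
Qed.

Variables (Z : nat -> set T) (c : R).
Hypotheses (mZ : forall i, measurable (Z i))
  (Zc : forall i j, i != j -> pr P (Z i `&` Z j) = c).

(** Only averages over 2^k terms are taken: along this subsequence the L^1 norms of the increments
    are summable, which yields almost sure convergence without any maximal inequality. *)
Definition average k x : R := (2 ^+ k)^-1 * \sum_(i < 2 ^ k) \1_(Z i) x.

Let bZ i : bounded_measurable (\1_(Z i) : T -> R). Proof. exact: bm_indic. Qed.

Lemma bm_average k : bounded_measurable (average k).
Proof. by apply: bmM; [exact: bm_cst|exact: (bm_sum _ bZ)]. Qed.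

Lemma average_ge0 k x : 0 <= average k x.
Proof. by rewrite mulr_ge0// sumr_ge0. Qed.

Lemma average_le1 k x : average k x <= 1.
Proof.
rewrite /average mulrC ler_pdivrMr ?exprn_gt0// mul1r.
have -> : 2 ^+ k = \sum_(i < 2 ^ k) (1 : R).
  by rewrite sumr_const card_ord -natrX.
by apply: ler_sum => i _; rewrite indicE; case: (_ \in _).
Qed.

Let mean_ZZ i j : i != j -> mean P (fun x => \1_(Z i) x * \1_(Z j) x) = c.
Proof.
move=> ij; rewrite -(Zc ij) -mean_indic; last exact: measurableI.
by congr mean; apply/funext => x; rewrite indicI.
Qed.

Let W N i x : R := \1_(Z (N + i)) x - \1_(Z i) x.

Let bW N i : bounded_measurable (W N i).
Proof. by apply: bmD => //; exact: bmN. Qed.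

(* The increments over disjoint blocks are orthogonal in L^2. *)
Let mean_WW N i j : (i < N)%N -> (j < N)%N -> i != j ->
  mean P (fun x => W N i x * W N j x) = 0.
Proof.
move=> iN jN ij.
have Ni : (N + i != j)%N by apply/eqP => e; move: jN; rewrite -e ltnNge leq_addr.
have Nj : (i != N + j)%N by apply/eqP => e; move: iN; rewrite e ltnNge leq_addr.
pose q a b x : R := \1_(Z a) x * \1_(Z b) x.
have bq a b : bounded_measurable (q a b) by exact: bmM.
rewrite (_ : (fun x => _) = (fun x =>
   (q (N + i) (N + j) x - q (N + i) j x) - (q i (N + j) x - q i j x))).
  have bB a b a' b' : bounded_measurable (fun x => q a b x - q a' b' x).
    by apply: bmD => //; exact: bmN.
  by rewrite !meanB// /q !mean_ZZ ?eqn_add2l//; ring.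
by apply/funext => x; rewrite /W /q; ring.
Qed.

Let mean_sumW2 N n : (n <= N)%N ->
  mean P (fun x => (\sum_(i < n) W N i x) ^+ 2) <= n%:R.
Proof.
elim: n => [_|n IH nN].
  under [X in mean P X]eq_fun do rewrite big_ord0 expr0n /=.
  by rewrite mean_cst.
have bS : bounded_measurable (fun x => \sum_(i < n) W N i x).
  exact: (bm_sum _ (bW N)).
have bS2 : bounded_measurable (fun x => (\sum_(i < n) W N i x) ^+ 2).
  by under [X in bounded_measurable X]eq_fun do rewrite expr2; exact: bmM.
have bSW : bounded_measurable (fun x => \sum_(i < n) W N i x * W N n x).
  apply: (@bm_sum _ _ _ _ (fun i x => W N i x * W N n x)) => i.
  exact: bmM.
have bWW : bounded_measurable (fun x => W N n x * W N n x) by exact: bmM.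
rewrite (_ : (fun x => _) = (fun x => (\sum_(i < n) W N i x) ^+ 2 +
  (2 * (\sum_(i < n) W N i x * W N n x) + W N n x * W N n x))); last first.
  by apply/funext => x; rewrite big_ord_recr /= -mulr_suml; ring.
have b2 := bmM (bm_cst (2 : R)) bSW.
rewrite meanD//; last exact: bmD.
rewrite meanD// meanZ// (mean_sum P n (F := fun i x => W N i x * W N n x)); last first.
  by move=> i; exact: bmM.
rewrite big1; last first.
  move=> i _; apply: mean_WW => //; first exact: ltn_trans (ltn_ord i) nN.
  by rewrite ltn_eqF.
rewrite mulr0 add0r -natr1; apply: lerD; first by apply: IH; exact: ltnW.
rewrite -[leRHS](mean_cst P 1); apply: mean_le => //; first exact: bm_cst.
move=> x; rewrite /W !indicE.
by case: (_ \in _); case: (_ \in _); rewrite ?subrr ?subr0 ?sub0r ?mulrNN ?mulr1 ?mulr0.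
Qed.

Let average_step k x : average k.+1 x - average k x =
  (2 ^+ k.+1)^-1 * \sum_(i < 2 ^ k) W (2 ^ k) i x.
Proof.
rewrite /average expnS mul2n -addnn big_split_ord /= /W sumrB.
rewrite exprS invfM; have : (2 ^+ k : R) != 0 by rewrite expf_neq0.
by move=> k0; field.
Qed.

(** By orthogonality the mean square of the increment is at most 2^k / 4^(k+1), hence at most t^2
    for t = (3/4)^k, as 1/2 <= 9/16. Integrating |D| <= t + D^2 / t gives 2t. *)
Let mean_step k : mean P (fun x => `|average k.+1 x - average k x|) <=
  2 * (3 / 4) ^+ k.
Proof.
pose t : R := (3 / 4) ^+ k; have t0 : 0 < t by rewrite exprn_gt0.
pose D x := average k.+1 x - average k x.
have bD : bounded_measurable D.
  by apply: bmD; [exact: bm_average|apply: bmN; exact: bm_average].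
have bD2 : bounded_measurable (fun x => t + t^-1 * (D x * D x)).
  apply: bmD; first exact: bm_cst.
  by apply: bmM; [exact: bm_cst|exact: bmM].
have bDD : bounded_measurable (fun x => D x * D x) by exact: bmM.
apply: (@le_trans _ _ (mean P (fun x => t + t^-1 * (D x * D x)))).
  apply: mean_le => //; first exact: bm_norm.
  move=> x; rewrite -/(D x).
  have [xt|tx] := leP `|D x| t.
    by apply: le_trans xt _; rewrite lerDl mulr_ge0 ?invr_ge0 ?(ltW t0)// -expr2 sqr_ge0.
  apply: (@le_trans _ _ (t^-1 * (D x * D x))); last by rewrite lerDr ltW.
  have -> : D x * D x = `|D x| * `|D x|.
    by rewrite -normrM ger0_norm// -expr2 sqr_ge0.
  by rewrite mulrC ler_pdivlMr// ler_wpM2l// ltW.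
rewrite meanD//; [|exact: bm_cst|by apply: bmM => //; exact: bm_cst].
rewrite mean_cst meanZ// mulr_natl mulr2n lerD2l ler_pdivrMl//.
have -> : mean P (fun x => D x * D x) = ((2 ^+ k.+1)^-1) ^+ 2 *
    mean P (fun x => (\sum_(i < 2 ^ k) W (2 ^ k) i x) ^+ 2).
  rewrite -meanZ; last first.
    under [X in bounded_measurable X]eq_fun do rewrite expr2.
    by apply: bmM; exact: (bm_sum _ (bW _)).
  by congr mean; apply/funext => x; rewrite /D average_step; ring.
apply: (@le_trans _ _ (((2 ^+ k.+1)^-1) ^+ 2 * (2 ^ k)%:R)).
  by rewrite ler_wpM2l ?sqr_ge0//; exact: mean_sumW2.
rewrite natrX /t -expr2 -exprM mulnC exprM exprVn -exprM mulnC exprM.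
have -> : (((2 ^+ 2) ^+ k.+1)^-1 * 2 ^+ k : R) = 4^-1 * (1 / 2) ^+ k.
  rewrite exprS expr_div_n expr1n -exprM mulnC exprM.
  have : (2 ^+ k : R) != 0 by rewrite expf_neq0.
  by move=> k0; field.
apply: (@le_trans _ _ ((1 / 2) ^+ k)).
  by rewrite ler_piMl ?exprn_ge0//; lra.
by apply: lerXn2r; rewrite ?nnegrE; lra.
Qed.

Lemma averages_converge : exists D : T -> R,
  [/\ measurable_fun setT D, forall x, 0 <= D x <= 1 &
      {ae P, forall x, average k x @[k --> \oo] --> D x}].
Proof.
pose L x := limn_sup (fun k => average k x).
have mL : measurable_fun setT L.
  apply: measurable_fun_limn_sup => [x _|x _|n].
  - by exists 1 => _ [k _ <-]; exact: average_le1.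
  - by exists 0 => _ [k _ <-]; exact: average_ge0.
  - by case: (bm_average n).
(* Clamping gives the bounds at every point and changes nothing where the averages converge. *)
exists (fun x => Num.max 0 (Num.min (L x) 1)); split.
- apply: measurable_maxr; first exact: measurable_cst.
  by apply: measurable_minr => //; exact: measurable_cst.
- by move=> x; rewrite le_max lexx ge_max ler01 /= ge_min lexx orbT.
have bD k : bounded_measurable (fun x => `|average k.+1 x - average k x|).
  by apply: bm_norm; apply: bmD; [exact: bm_average|apply: bmN; exact: bm_average].
have : {ae P, forall x, cvgn (series (fun k => `|average k.+1 x - average k x|))}.
  (* 8 is the sum of the geometric series with terms 2 (3/4)^i. *)
  apply: (@ae_summable _ 8) => // n.
  apply: (@le_trans _ _ (\sum_(i < n) (2 * (3 / 4) ^+ i))).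
    by apply: ler_sum => i _; exact: mean_step.
  suff -> : \sum_(i < n) (2 * (3 / 4) ^+ i : R) = 8 - 8 * (3 / 4) ^+ n.
    by rewrite gerBl mulr_ge0// exprn_ge0//; lra.
  elim: n => [|n IH]; first by rewrite big_ord0 expr0; lra.
  by rewrite big_ord_recr /= IH exprS; lra.
apply: filterS => x cx.
have cvx : cvgn (fun k => average k x).
  have /normed_cvg : cvgn [normed series (telescope (fun k => average k x))] by exact: cx.
  rewrite telescopeK => h.
  rewrite (_ : (fun k => _) = (fun k => (average k x - average 0%N x) + average 0%N x)).
    by apply: is_cvgD => //; exact: is_cvg_cst.
  by apply/funext => k; rewrite subrK.
have -> : L x = limn (fun k => average k x) by exact: cvg_limn_supE.
set l := limn _.
have l0 : 0 <= l by apply: limr_ge => //; apply: nearW => k; exact: average_ge0.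
have l1 : l <= 1 by apply: limr_le => //; apply: nearW => k; exact: average_le1.
by rewrite (min_idPl l1) (max_idPr l0).
Qed.

(** The mean of h times the averages tends to that of h times D by dominated convergence, and to a
    by Cesaro, the correlations being equal to a from N on. *)
Lemma mean_average_limit (D h : T -> R) (a : R) N :
  {ae P, forall x, average k x @[k --> \oo] --> D x} -> measurable_fun setT D ->
  bounded_measurable h ->
  (forall j, (N <= j)%N -> mean P (fun x => h x * \1_(Z j) x) = a) ->
  mean P (fun x => h x * D x) = a.
Proof.
move=> cD mD bh hZ; have [mh [M hM]] := bh.
have h1 : mean P (fun x => h x * average k x) @[k --> \oo] --> mean P (fun x => h x * D x).
  apply: (@mean_cvg _ _ _ _ (fun k x => h x * average k x) _ M).
  - by move=> k; apply: measurable_funM => //; case: (bm_average k).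
  - move=> k x; rewrite normrM -[leRHS]mulr1; apply: ler_pM => //.
    by rewrite ger0_norm ?average_ge0// average_le1.
  - exact: measurable_funM.
  - by apply: filterS cD => x cx; apply: cvgM => //; exact: cvg_cst.
pose u j := mean P (fun x => h x * \1_(Z j) x).
have u_a : u @ \oo --> a.
  by apply: cvg_near_cst; exists N => // j /= /hZ.
(* [arithmetic_mean] at n averages n.+1 terms, whence the predecessor. *)
have e : (fun k => (2 ^ k).-1) @ \oo --> \oo.
  move=> A [n _ nA]; exists n => // k /= nk; apply: nA => /=.
  by rewrite -ltnS prednK ?expn_gt0//; apply: leq_ltn_trans nk (ltn_expl _ _).
have h2 := cvg_comp _ _ e (cesaro u_a).
apply: (cvg_unique _ h1) => //; rewrite (_ : (fun k => _) =
  arithmetic_mean u \o (fun k => (2 ^ k).-1))//.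
apply/funext => k; rewrite /arithmetic_mean /= prednK ?expn_gt0// natrX.
rewrite /series /= big_mkord -(mean_sum P _ (F := fun j x => h x * \1_(Z j) x)); last first.
  by move=> j; exact: bmM.
rewrite -meanZ; last by apply: (bm_sum _ (F := fun j x => h x * \1_(Z j) x)) => j; exact: bmM.
congr mean; apply/funext => x; rewrite /average mulrCA; congr (_ * _).
by rewrite mulr_sumr.
Qed.

End averages.

(** * Ergodic exchangeable graphs are dissociated *)

Section window_determined.
Context (R : realType) (mu : probability graph_space R).

(** Approximation by windows carries the equality of integrals over to all events. Testing it on the
    event g <= f and on its complement makes the L^1 distance vanish. *)
Lemma window_determined (f g : graph_space -> R) :
  bounded_measurable f -> bounded_measurable g ->
  (forall x, 0 <= f x <= 1) -> (forall x, 0 <= g x <= 1) ->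
  (forall n C, window n C ->
    mean mu (fun x => \1_C x * f x) = mean mu (fun x => \1_C x * g x)) ->
  {ae mu, forall x, f x = g x}.
Proof.
move=> bf bg f01 g01 fg.
have close (h : graph_space -> R) A C : bounded_measurable h ->
    (forall x, 0 <= h x <= 1) -> measurable A -> measurable C ->
    `|mean mu (fun x => \1_A x * h x) - mean mu (fun x => \1_C x * h x)| <=
      pr mu (A `+` C).
  move=> bh h01 mA mC; have mAC := measurableY mA mC.
  have bA := bmM (bm_indic mA) bh; have bC := bmM (bm_indic mC) bh.
  rewrite -meanB//.
  have bAC : bounded_measurable (fun x => \1_A x * h x - \1_C x * h x).
    by apply: bmD => //; exact: bmN.
  apply: le_trans (le_normr_Rintegral measurableT (bm_integrable mu bAC)) _.
  rewrite -mean_indic//; apply: mean_le; [exact: bm_norm|exact: bm_indic|].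
  move=> x; rewrite -mulrBl normrM (@ger0_norm _ (h x)); last by have /andP[] := h01 x.
  have /andP[h0 h1] := h01 x.
  apply: (@le_trans _ _ `|\1_A x - \1_C x|); first by rewrite ler_piMr.
  rewrite !indicE.
  have [xA|xA] := boolP (x \in A); have [xC|xC] := boolP (x \in C).
  - by rewrite subrr normr0; case: (_ \in _).
  - rewrite subr0 normr1 mem_set//; left.
    by split; [exact/set_mem|move: xC; rewrite notin_setE].
  - rewrite sub0r normrN normr1 mem_set//; right.
    by split; [exact/set_mem|move: xA; rewrite notin_setE].
  - by rewrite subrr normr0; case: (_ \in _).
have eqA A : measurable A ->
    mean mu (fun x => \1_A x * f x) = mean mu (fun x => \1_A x * g x).
  move=> mA; apply/eqP; rewrite -subr_eq0 -normr_le0.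
  apply/ler_addgt0Pl => e e0; rewrite addr0.
  have e2 : 0 < e / 2 by rewrite divr_gt0.
  have [n [C [nC AC]]] := window_approximation mu mA e2.
  have mC := window_measurable nC.
  have := close f A C bf f01 mA mC; have := close g A C bg g01 mA mC.
  rewrite (fg n C nC) !ler_norml; lra.
have bD : bounded_measurable (fun x => f x - g x) by apply: bmD => //; exact: bmN.
have [mf _] := bf; have [mg _] := bg.
pose A := [set x | g x <= f x].
have mA : measurable A.
  rewrite (_ : A = (fun x => g x <= f x) @^-1` [set true]).
    by rewrite -[X in measurable X]setTI; exact: measurable_fun_ler.
  by apply/seteqP; split.
have mCA := measurableC mA.
have m0 : mean mu (fun x => `|f x - g x|) = 0.
  pose F := fun B => mean mu (fun x => \1_B x * f x) - mean mu (fun x => \1_B x * g x).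
  have F0 B : measurable B -> F B = 0 by move=> mB; rewrite /F eqA// subrr.
  rewrite (_ : 0 = F A - F (~` A)); last by rewrite !F0// subrr.
  have b1 := bmM (bm_indic mA) bf; have b2 := bmM (bm_indic mA) bg.
  have b3 := bmM (bm_indic mCA) bf; have b4 := bmM (bm_indic mCA) bg.
  have b12 := bmD b1 (bmN b2); have b34 := bmD b3 (bmN b4).
  rewrite /F -!meanB//; congr mean; apply/funext => x.
  rewrite !indicE in_setC; have [xA|xA] := boolP (x \in A).
    by rewrite ger0_norm ?subr_ge0; [rewrite /=; ring|move/set_mem: xA].
  rewrite ltr0_norm ?subr_lt0; first by rewrite /=; ring.
  by move: xA; rewrite notin_setE /A /= => /negP; rewrite -ltNge.
have := mean_eq0 (bm_norm bD) (fun x => normr_ge0 _) m0.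
by apply: filterS => x /normr0_eq0/eqP; rewrite subr_eq0 => /eqP.
Qed.

End window_determined.

Section exchangeable.
Context (R : realType) (mu : probability graph_space R).
Hypothesis inv : perm_invariant mu.

Lemma relabel_window_pr n f C : window n C ->
  (forall i j, (i < n)%N -> (j < n)%N -> f i = f j -> i = j) ->
  pr mu (relabel f @^-1` C) = pr mu C.
Proof.
move=> nC /extend_injection[h hbij hf].
rewrite -(relabel_window_eq nC hf) /pr inv//.
exact: window_measurable nC.
Qed.

(** Two injective relabellings with disjoint ranges glue into one that is injective below n + m, so
    the joint law does not depend on them. *)
Lemma relabel_pair_pr n m f f' C C' : window n C -> window m C' ->
  (forall i j, (i < n)%N -> (j < n)%N -> f i = f j -> i = j) ->
  (forall i j, (i < m)%N -> (j < m)%N -> f' i = f' j -> i = j) ->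
  (forall i j, (i < n)%N -> (j < m)%N -> f i <> f' j) ->
  pr mu (relabel f @^-1` C `&` relabel f' @^-1` C') =
  pr mu (C `&` relabel (addn n) @^-1` C').
Proof.
move=> nC mC' finj f'inj ff'.
pose F x := if (x < n)%N then f x else f' (x - n)%N.
have w : window (n + m) (C `&` relabel (addn n) @^-1` C').
  apply: windowI; first exact: window_le (leq_addr _ _) nC.
  by apply: (window_relabel mC') => i im; rewrite ltn_add2l.
rewrite -[RHS](relabel_window_pr (f := F) w).
  rewrite preimage_setI; congr (pr mu (_ `&` _)).
    by apply: (relabel_window_eq nC) => i ilt; rewrite /F ilt.
  rewrite relabel_preimage_comp.
  apply: (relabel_window_eq mC') => i _.
  by rewrite /F /= ltnNge leq_addr /= addKn.
move=> i j ilt jlt; rewrite /F.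
case: ifP => iln; case: ifP => jln.
- exact: finj.
- by move=> /ff' []//; lia.
- by move=> /esym /ff' []//; lia.
- by move=> /f'inj; lia.
Qed.

Lemma mean_relabel f (h : graph_space -> R) : injective f -> bounded_measurable h ->
  mean mu (h \o relabel f) = mean mu h.
Proof.
move=> finj bh; have [mh _] := bh.
have eqmu : forall A, measurable A -> pushforward mu (relabel f) A = mu A.
  by move=> A; exact: perm_invariant_injection.
have mEh : measurable_fun setT (EFin \o h) by exact/measurable_EFinP.
rewrite /mean /Rintegral; congr fine.
transitivity (\int[pushforward mu (relabel f)]_x (h x)%:E)%E.
  rewrite integral_pushforward//; first exact: measurable_relabel.
  apply: bm_integrable; split.
    by apply: measurableT_comp => //; exact: measurable_relabel.
  by have [_ [M hM]] := bh; exists M => x; exact: hM.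
apply: eq_measure_integral; first exact: measurable_relabel.
by move=> ? A mA _; exact: eqmu.
Qed.

Lemma bm_relabel f (h : graph_space -> R) : bounded_measurable h ->
  bounded_measurable (h \o relabel f).
Proof.
move=> [mh [M hM]]; split; last by exists M => x; exact: hM.
by apply: measurableT_comp => //; exact: measurable_relabel.
Qed.

Hypothesis erg : perm_ergodic mu.

(** The events D < c and c < D have probability 0 or 1. If one of them is full, D - c has constant
    sign and mean 0, so it vanishes almost surely; if both are null, nothing remains to be shown. *)
Lemma ergodic_constant (D : graph_space -> R) : bounded_measurable D ->
  (forall f, bijective f -> {ae mu, forall g, D (relabel f g) = D g}) ->
  {ae mu, forall g, D g = mean mu D}.
Proof.
move=> bD Dinv; have [mD _] := bD; set c := mean mu D.
have zero_one (b : R -> bool) : measurable_fun setT (b \o D) ->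
    mu [set g | b (D g)] = 0%E \/ mu [set g | b (D g)] = 1%E.
  move=> mbD.
  have mA : measurable [set g | b (D g)].
    rewrite (_ : mkset _ = (b \o D) @^-1` [set true]).
      by rewrite -[X in measurable X]setTI; exact: mbD.
    by apply/seteqP; split.
  apply: erg => // f /Dinv [N [mN muN0 DN]].
  apply/eqP; rewrite -measure_le0 -muN0; apply: le_measure; rewrite ?inE//.
    by apply: measurableY => //; exact: measurable_relabel_preimage.
  move=> g [] [/= h1 h2]; apply: DN => /= Dg.
    by apply: h2; rewrite -Dg.
  by apply: h2; rewrite Dg.
have mean0 : mean mu (fun x => D x - c) = 0.
  by rewrite meanB ?mean_cst ?subrr//; exact: bm_cst.
have bDc : bounded_measurable (fun x => D x - c).
  by apply: bmD => //; apply: bmN; exact: bm_cst.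
have ae_of_one (b : R -> bool) : measurable_fun setT (b \o D) ->
    mu [set g | b (D g)] = 1%E -> {ae mu, forall g, b (D g)}.
  move=> mbD; apply: (ae_setP _ _).2.
  rewrite (_ : mkset _ = (b \o D) @^-1` [set true]).
    by rewrite -[X in measurable X]setTI; exact: mbD.
  by apply/seteqP; split.
have mlt : measurable_fun setT ((fun x => x < c) \o D).
  exact: (measurable_fun_ltr mD (measurable_cst c)).
have mgt : measurable_fun setT ((fun x => c < x) \o D).
  exact: (measurable_fun_ltr (measurable_cst c) mD).
have b_norm := bm_norm bDc.
have concl : mean mu (fun x => `|D x - c|) = 0 -> {ae mu, forall g, D g = c}.
  move=> /(mean_eq0 b_norm (fun x => normr_ge0 _)).
  by apply: filterS => x /normr0_eq0/eqP; rewrite subr_eq0 => /eqP.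
have [lt0|/(ae_of_one _ mlt) lt1] := zero_one _ mlt; last first.
  apply: concl; rewrite -(mulr0 (-1)) -mean0 -meanZ//.
  have bN := bmM (bm_cst (-1)) bDc.
  apply: mean_ae_eq => //; apply: filterS lt1 => x xc.
  by rewrite ltr0_norm ?subr_lt0// mulN1r.
have [gt0|/(ae_of_one _ mgt) gt1] := zero_one _ mgt; last first.
  apply: concl; rewrite -mean0; apply: mean_ae_eq => //.
  by apply: filterS gt1 => x xc; rewrite gtr0_norm ?subr_gt0.
have mA (b : R -> bool) : measurable_fun setT (b \o D) ->
    measurable [set g | b (D g)].
  move=> mbD; rewrite (_ : mkset _ = (b \o D) @^-1` [set true]).
    by rewrite -[X in measurable X]setTI; exact: mbD.
  by apply/seteqP; split.
exists ([set g | D g < c] `|` [set g | c < D g]); split.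
- by apply: measurableU; [exact: (mA _ mlt)|exact: (mA _ mgt)].
- apply: null_set_setU => //; [exact: (mA _ mlt)|exact: (mA _ mgt)].
- by move=> g /= /eqP; rewrite neq_lt => /orP.
Qed.

(* The averages of the indicator of C over disjoint blocks of vertices converge to
   an invariant limit, which is constant by ergodicity. *)
Lemma dissociated n m C Y : window n C -> window m Y ->
  pr mu (C `&` relabel (addn n) @^-1` Y) = pr mu C * pr mu Y.
Proof.
move=> nC mY.
pose f j := addn (n * j)%N.
have finj j x y : f j x = f j y -> x = y by rewrite /f => /addnI.
have fdisj i j x y : (x < n)%N -> (y < n)%N -> i != j -> f i x <> f j y.
  move=> xn yn ij e; move/eqP: ij; apply.
  by have := congr1 (divn^~ n) e; rewrite /f !(mulnC n) !divnMDl ?divn_small ?addn0//;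
     apply: leq_ltn_trans xn.
have f_large j x : (x < n)%N -> (j <= f j x)%N.
  by move=> xn; rewrite /f; nia.
pose Z j := relabel (f j) @^-1` C.
have mC := window_measurable nC.
have mZ j : measurable (Z j) by exact: measurable_relabel_preimage.
have ZZ i j : i != j -> pr mu (Z i `&` Z j) = pr mu (C `&` relabel (addn n) @^-1` C).
  move=> ij; apply: (relabel_pair_pr nC nC).
  - by move=> x y _ _; exact: finj.
  - by move=> x y _ _; exact: finj.
  - by move=> x y xn yn; exact: fdisj.
have [D [mD D01 Dlim]] := averages_converge mZ ZZ.
have bD : bounded_measurable D.
  split=> //; exists 1 => x; have /andP[D0 D1] := D01 x.
  by rewrite ger0_norm.
(* Blocks of index at least N avoid the vertices that W uses through [p]. By exchangeability the
   correlation with them depends neither on the block nor on [p], and the invariance of D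
   follows. *)
have ZY k (W : set graph_space) p : window k W -> injective p -> 
    mean mu (fun x => \1_(relabel p @^-1` W) x * D x) =
    pr mu (C `&` relabel (addn n) @^-1` W).
  move=> kW pinj; have mW := window_measurable kW.
  have mpW := measurable_relabel_preimage p mW.
  pose N := (\max_(i < k) p i).+1.
  have pN i : (i < k)%N -> (p i < N)%N.
    by move=> ik; rewrite ltnS; apply: (leq_bigmax (Ordinal ik)).
  apply: (mean_average_limit mZ Dlim mD (bm_indic mpW) (N := N)) => j Nj.
  have -> : (fun x => \1_(relabel p @^-1` W) x * \1_(Z j) x) =
      (\1_(Z j `&` relabel p @^-1` W) : graph_space -> R).
    by apply/funext => x; rewrite indicI /= mulrC.
  rewrite mean_indic; last exact: measurableI.
  apply: (relabel_pair_pr nC kW).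
  - by move=> x y _ _; exact: finj.
  - by move=> x y _ _; exact: pinj.
  - move=> x y xn yk e; have := f_large j x xn; rewrite e leqNgt.
    by rewrite (leq_trans (pN _ yk))//.
have ZYid k (W : set graph_space) : window k W ->
    mean mu (fun x => \1_W x * D x) = pr mu (C `&` relabel (addn n) @^-1` W).
  move=> kW; rewrite -(ZY k W id kW (fun _ _ => id)).
  congr mean; apply/funext => x; congr (_ * _).
  by rewrite (_ : relabel id @^-1` W = W)//; apply/funext => g;
     rewrite /preimage /mkset (_ : relabel id g = g)//; exact: edge_ext.
have Dinv p : bijective p -> {ae mu, forall g, D (relabel p g) = D g}.
  move=> pbij; have [q pq qp] := pbij.
  apply: window_determined => //; first exact: bm_relabel.
  move=> k W kW.
  have mqW := measurable_relabel_preimage q (window_measurable kW).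
  have -> : (fun x => \1_W x * D (relabel p x)) =
      (fun x => \1_(relabel q @^-1` W) x * D x) \o relabel p.
    apply/funext => x; rewrite /= !indicE; congr ((_ : bool)%:R * _).
    have e : relabel q (relabel p x) = x.
      by apply: edge_ext => i j; rewrite !edge_relabel !qp.
    by apply/idP/idP; rewrite !inE /preimage /= e.
  rewrite mean_relabel//; [|exact: bij_inj|by apply: bmM => //; exact: bm_indic].
  by rewrite (ZY k W q kW (can_inj qp)) (ZYid k W kW).
have Dc := ergodic_constant bD Dinv.
have dY k (W : set graph_space) : window k W ->
    pr mu (C `&` relabel (addn n) @^-1` W) = mean mu D * pr mu W.
  move=> kW; have mW := window_measurable kW.
  rewrite -(ZYid k W kW) -mean_indic// -meanZ; last exact: bm_indic.
  apply: mean_ae_eq.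
  - by apply: bmM => //; exact: bm_indic.
  - by apply: bmM; [exact: bm_cst|exact: bm_indic].
  - by apply: filterS Dc => x ->; rewrite mulrC.
(* The sure event identifies the constant. *)
have dC : mean mu D = pr mu C.
  have := dY 0%N setT (@windowT 0).
  by rewrite preimage_setT setIT pr_setT mulr1 => ->.
by rewrite (dY _ _ mY) dC.
Qed.

End exchangeable.

(** * Bernoulli measures *)

Section sequence_space.
Context d (X : measurableType d).

Definition box n (A : nat -> set X) : set (sequence_space X) :=
  [set x | forall i, (i < n)%N -> A i (x i)].

Lemma measurable_coord i : measurable_fun setT (fun x : sequence_space X => x i).
Proof.
move=> _ A mA; rewrite setTI; apply: sub_sigma_algebra; exists i => //.
by exists A => //; rewrite setTI.
Qed.

Lemma measurable_coord_preimage i (A : set X) : measurable A ->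
  measurable [set x : sequence_space X | A (x i)].
Proof. by move=> mA; rewrite -[X in measurable X]setTI; exact: measurable_coord. Qed.

Lemma measurable_box n A : (forall i, measurable (A i)) -> measurable (box n A).
Proof.
move=> mA; apply: measurable_all => i; apply: measurable_imp.
  exact: measurable_prop.
exact: measurable_coord_preimage.
Qed.

Definition boxes : set (set (sequence_space X)) :=
  [set B | exists n A, (forall i, measurable (A i)) /\ B = box n A].

Lemma boxT A : box 0 A = setT.
Proof. by apply/seteqP; split. Qed.

Lemma boxes_setI : setI_closed boxes.
Proof.
move=> _ _ [n [A [mA ->]]] [m [B [mB ->]]].
exists (maxn n m), (fun i => (if (i < n)%N then A i else setT) `&`
  (if (i < m)%N then B i else setT)); split.
  by move=> i; apply: measurableI; case: ifP.
apply/seteqP; split=> x /=.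
  by move=> [xA xB] i _; split; case: ifP => // im; [exact: xA|exact: xB].
move=> h; split=> i im.
  by have [] := h i (leq_trans im (leq_maxl _ _)); rewrite im.
by have [_] := h i (leq_trans im (leq_maxr _ _)); rewrite im.
Qed.

Lemma sequence_space_measurableE : @measurable _ (sequence_space X) = <<s boxes >>.
Proof.
apply/seteqP; split; apply: smallest_sub; try exact: smallest_sigma_algebra.
- move=> _ [i _ [A mA <-]]; apply: sub_sigma_algebra.
  exists i.+1, (fun j => if j == i then A else setT); split.
    by move=> j; case: ifP.
  apply/seteqP; split=> x /=; first by move=> [_ Ax] j _; case: eqP => // ->.
  by move=> /(_ i (ltnSn i)); rewrite eqxx.
- by move=> _ [n [A [mA ->]]]; exact: measurable_box.
Qed.

Lemma measurable_fun_sequence d' (T : measurableType d') (F : T -> sequence_space X) :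
  (forall i, measurable_fun setT (fun t => F t i)) -> measurable_fun setT F.
Proof.
move=> mF; apply: (@measurability _ _ T (sequence_space X) setT F boxes
  sequence_space_measurableE).
move=> _ [_ [n [A [mA ->]]] <-]; rewrite setTI.
apply: measurable_all => i; apply: measurable_imp; first exact: measurable_prop.
by rewrite -[X in measurable X]setTI; exact: mF.
Qed.

Context (R : realType).

Lemma sequence_measure_unique (P Q : {measure set (sequence_space X) -> \bar R}) :
  (P setT < +oo)%E ->
  (forall n A, (forall i, measurable (A i)) -> P (box n A) = Q (box n A)) ->
  forall A, measurable A -> P A = Q A.
Proof.
move=> Poo h A mA; apply: (measure_unique boxes (fun=> setT)) => //.
- exact: sequence_space_measurableE.
- exact: boxes_setI.
- by move=> _; exists 0%N, (fun=> setT); rewrite boxT.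
- by apply/seteqP; split=> // x _; exists 0%N.
- by move=> _ [n [B [mB ->]]]; exact: h.
Qed.

Variables (m : probability X R) (M : probability (sequence_space X) R).
Hypothesis mM : bernoulli_measure m M.

Lemma bernoulli_box n A : (forall i, measurable (A i)) ->
  M (box n A) = (\prod_(i < n) m (A i))%E.
Proof. exact: mM. Qed.

Lemma bernoulli_unique (M' : probability (sequence_space X) R) :
  bernoulli_measure m M' -> forall A, measurable A -> M A = M' A.
Proof.
move=> mM'; apply: sequence_measure_unique; first exact: fin_num_fun_lty.
by move=> n A mA; rewrite [RHS]mM'//; exact: bernoulli_box.
Qed.

Definition splice n (p : sequence_space X * sequence_space X) : sequence_space X :=
  fun i => if (i < n)%N then p.1 i else p.2 (i - n)%N.

Lemma splice_lt n p i : (i < n)%N -> splice n p i = p.1 i.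
Proof. by rewrite /splice => ->. Qed.

Lemma splice_shift n p i : splice n p (n + i)%N = p.2 i.
Proof. by rewrite /splice -ltn_subRL subnn addKn. Qed.

Lemma measurable_splice n : measurable_fun setT (splice n).
Proof.
apply: measurable_fun_sequence => i; rewrite /splice.
have [ilt|ilt] := ltnP i n.
  exact: (measurableT_comp (measurable_coord i) measurable_fst).
exact: (measurableT_comp (measurable_coord (i - n)) measurable_snd).
Qed.

(** Independence as a measure-preserving map: an event on the first n coordinates and one on the
    later ones pull back to a rectangle. *)
Lemma bernoulli_splice n A : measurable A ->
  (M \x M)%E (splice n @^-1` A) = M A.
Proof.
move: A; apply: (@sequence_measure_unique
  (image_probability (product_probability M M) (measurable_splice n)) M).
  exact: fin_num_fun_lty.
move=> k A mA; change ((M \x M)%E (splice n @^-1` (box k A)) = M (box k A)).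
pose k1 := minn n k.
have -> : splice n @^-1` (box k A) = box k1 A `*` box (k - n) (fun i => A (n + i)%N).
  apply/seteqP; split=> -[x y] /=.
    move=> h; split=> i; rewrite ?leq_min => ik.
      by have /andP[i1 i2] := ik; have := h i i2; rewrite splice_lt.
    have := h (n + i)%N; rewrite splice_shift; apply.
    by move: ik; rewrite ltn_subRL.
  move=> [h1 h2] i ik; rewrite /splice; case: ltnP => ni.
    by apply: h1; rewrite leq_min ni.
  by have := h2 (i - n)%N; rewrite subnKC//; apply; rewrite ltn_sub2rE.
rewrite product_measure1E; [|exact: measurable_box|exact: measurable_box].
have -> : M (box k A) = (\prod_(i < k) m (A i))%E by exact: bernoulli_box.
transitivity ((\prod_(i < k1) m (A i)) * (\prod_(i < k - n) m (A (n + i)%N)))%E.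
  by congr (_ * _)%E; exact: bernoulli_box.
rewrite -!(big_mkord xpredT (fun i => m (A i))).
rewrite -(big_mkord xpredT (fun i => m (A (n + i)%N))).
have [nk|kn] := leqP n k.
  rewrite (@big_cat_nat _ _ _ n 0 k)//= /k1 (minn_idPl nk); congr (_ * _)%E.
  rewrite -[n in RHS]add0n big_addn; apply: eq_bigr => i _.
  by rewrite addnC.
rewrite /k1 (minn_idPr (ltnW kn)).
have /eqP -> : (k - n == 0)%N by rewrite subn_eq0 ltnW.
by rewrite [X in (_ * X)%E]big_geq// mule1.
Qed.

Lemma bernoulli_independent n (C Y : set (sequence_space X)) :
  measurable C -> measurable Y ->
  (forall x y, (forall i, (i < n)%N -> x i = y i) -> C x -> C y) ->
  M (C `&` [set x | Y (fun i => x (n + i)%N)]) = (M C * M Y)%E.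
Proof.
move=> mC mY dC.
have mY' : measurable [set x : sequence_space X | Y (fun i => x (n + i)%N)].
  rewrite (_ : mkset _ = (fun x : sequence_space X =>
    (fun i => x (n + i)%N) : sequence_space X) @^-1` Y)//.
  rewrite -[X in measurable X]setTI.
  by apply: measurable_fun_sequence => // i; exact: measurable_coord.
rewrite -(bernoulli_splice n (measurableI _ _ mC mY')).
rewrite -product_measure1E//; congr ((M \x M)%E _).
apply/seteqP; split=> -[x y] /= [h1 h2]; split.
- by apply: dC h1 => i ilt; rewrite splice_lt.
- suff -> : y = (fun i => splice n (x, y) (n + i)%N) by [].
  by apply/funext => i; rewrite splice_shift.
- by apply: dC h1 => i ilt; rewrite splice_lt.
- suff -> : (fun i => splice n (x, y) (n + i)%N) = y by [].
  by apply/funext => i; rewrite splice_shift.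
Qed.

Lemma measurable_reindex (f : nat -> nat) :
  measurable_fun setT (fun x : sequence_space X => (x \o f : sequence_space X)).
Proof. by apply: measurable_fun_sequence => i; exact: measurable_coord. Qed.

Lemma bernoulli_reindex (f : nat -> nat) : injective f ->
  forall A : set (sequence_space X), measurable A ->
  M [set x : sequence_space X | A (x \o f)] = M A.
Proof.
move=> finj; apply: (@sequence_measure_unique
  (image_probability M (measurable_reindex f)) M); first exact: fin_num_fun_lty.
move=> n A mA.
change (M [set x : sequence_space X | box n A (x \o f)] = M (box n A)).
pose N := (\max_(i < n) f i).+1.
have fN i : (i < n)%N -> (f i < N)%N.
  by move=> ilt; rewrite ltnS; apply: (leq_bigmax (Ordinal ilt)).
(* [B k] collects the constraints on coordinate k: a single [A i] when k = f i, as [f] is injective,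
   and the whole space when k is not a value of [f] below n. *)
pose B k := \bigcap_(i in [set i | (i < n)%N /\ f i = k]) A i.
have mB k : measurable (B k).
  by apply: bigcap_measurableType => i _; exact: mA.
have -> : [set x : sequence_space X | box n A (x \o f)] = box N B.
  apply/seteqP; split=> x /=.
    by move=> h k _ i [/= ilt <-]; exact: h.
  by move=> h i ilt; apply: (h (f i) (fN i ilt)).
transitivity (\prod_(k < N) m (B k))%E; first exact: bernoulli_box.
transitivity (\prod_(k < N) \prod_(i < n | f i == k) m (A i))%E.
  apply: eq_bigr => k _.
  have [[i /eqP fik]|nex] := pselect (exists i : 'I_n, f i = k).
    rewrite (big_pred1 i); last first.
      move=> j /=; rewrite -(eqP fik) (inj_eq finj).
      by rewrite -val_eqE.
    congr (m _); apply/seteqP; split=> x.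
      by apply; split; [exact: ltn_ord|exact/eqP].
    by move=> Ax j [jn]; rewrite -(eqP fik) => /finj ->.
  rewrite big_pred0.
    rewrite (_ : B k = setT) ?probability_setT//; apply/seteqP; split=> // x _ i [ilt fik].
    by exfalso; apply: nex; exists (Ordinal ilt).
  by move=> i; apply/negbTE/eqP => fik; apply: nex; exists i.
transitivity (\prod_(i < n) m (A i))%E; last by rewrite bernoulli_box.
rewrite (exchange_big_dep xpredT)//=; apply: eq_bigr => i _.
rewrite (big_pred1 (Ordinal (fN i (ltn_ord i))))//.
Qed.

End sequence_space.

(* An event invariant mod 0 is close to a window event and to its translate by a
   permutation, and these are independent. *)
Lemma dissociated_ergodic (R : realType) (mu : probability graph_space R) :
  perm_invariant mu ->
  (forall n m C Y, window n C -> window m Y ->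
     pr mu (C `&` relabel (addn n) @^-1` Y) = pr mu C * pr mu Y) ->
  perm_ergodic mu.
Proof.
move=> inv dis A mA Ainv.
suff : pr mu A = pr mu A * pr mu A.
  move=> /eqP; rewrite -subr_eq0 -{1}[pr mu A]mulr1 -mulrBr mulf_eq0 subr_eq0.
  by rewrite prE// => /orP[/eqP ->|/eqP <-]; [left|right].
apply/eqP; rewrite -subr_eq0 -normr_le0; apply/ler_addgt0Pl => e e0; rewrite addr0.
have e4 : 0 < e / 4 by rewrite divr_gt0.
have [N [C [NC AC]]] := window_approximation mu mA e4.
have mC := window_measurable NC; have mAC := measurableY mA mC.
have [|p pbij pE] := @extend_injection N (addn N).
  by move=> i j _ _ /addnI.
have pC := relabel_window_eq NC pE.
pose A' := relabel p @^-1` A; pose C' := relabel p @^-1` C.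
have mA' : measurable A' by exact: measurable_relabel_preimage.
have mC' : measurable C' by exact: measurable_relabel_preimage.
have mAC' := measurableY mA' mC'.
have hA : pr mu (A `&` A') = pr mu A.
  have m1 := measurableI _ _ mA mA'; have m2 := measurableY mA' mA.
  apply/eqP; rewrite eq_le; apply/andP; split.
    by apply: pr_le => // x [].
  have -> : pr mu (A `&` A') = pr mu (A `&` A') + pr mu (A' `+` A).
    by rewrite {3}/pr (Ainv p pbij) addr0.
  apply: le_trans (prU_le _ m1 m2); apply: pr_le => //; first exact: measurableU.
  by move=> x Ax; have [|] := pselect (A' x); [left|right; right].
have hAC' : pr mu (A' `+` C') <= e / 4.
  rewrite (_ : A' `+` C' = relabel p @^-1` (A `+` C)) // /pr inv//.
have hC : pr mu (C `&` C') = pr mu C * pr mu C by rewrite /C' pC (dis _ _ _ _ NC NC).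
have h1 : `|pr mu (A `&` A') - pr mu (C `&` C')| <= e / 2.
  apply: le_trans (pr_dist _ _ _) _; [exact: measurableI|exact: measurableI|].
  apply: (@le_trans _ _ (pr mu ((A `+` C) `|` (A' `+` C')))).
    apply: pr_le; [|exact: measurableU|].
      by apply: measurableY; exact: measurableI.
    move=> x [[[Ax A'x] nC]|[[Cx C'x] nA]].
      have [Cx|] := pselect (C x); last by left; left.
      by right; left; split=> // C'x; apply: nC.
    have [Ax|] := pselect (A x); last by left; right.
    by right; right; split=> // A'x; apply: nA.
  by apply: le_trans (prU_le _ mAC mAC') _; lra.
have h2 : `|pr mu A - pr mu C| <= e / 4.
  exact: le_trans (pr_dist _ mA mC) AC.
have a0 := pr_ge0 mu A; have a1 := pr_le1 mu mA.
have c0 := pr_ge0 mu C; have c1 := pr_le1 mu mC.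
have h3 : `|pr mu C * pr mu C - pr mu A * pr mu A| <= e / 2.
  have -> : pr mu C * pr mu C - pr mu A * pr mu A =
    - ((pr mu A - pr mu C) * (pr mu A + pr mu C)) by ring.
  rewrite normrN normrM (ger0_norm (addr_ge0 a0 c0)).
  apply: (@le_trans _ _ (e / 4 * 2)); last by lra.
  by apply: ler_pM => //; [exact: addr_ge0|lra].
by move: h1 h3; rewrite hA hC !ler_norml; lra.
Qed.

(** * Laws of sampled graphs are ergodic *)

Section sampling.
Context (R : realType) (G : measurable_graph R).
Local Notation X := (mg_carrier G).
Local Notation m := (mg_measure G).

Lemma edge_sample (x : sequence_space X) i j :
  edge (sample_graph x) i j = (i != j) && ((x i, x j) \in mg_edges G).
Proof. by []. Qed.

Lemma measurable_sample : measurable_fun setT (@sample_graph R G).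
Proof.
apply: measurable_fun_graph => i j.
rewrite (_ : mkset _ = [set x : sequence_space X | i != j /\ mg_edges G (x i, x j)]).
  apply: measurable_andP; first exact: measurable_prop.
  rewrite (_ : mkset _ =
    (fun x : sequence_space X => (x i, x j)) @^-1` mg_edges G)//.
  rewrite -[X in measurable X]setTI; apply: measurable_fun_pair => //;
    [exact: measurable_coord|exact: measurable_coord|exact: mg_edges_measurable].
apply/seteqP; split=> x /=; rewrite edge_sample.
  by move=> /andP[? /set_mem].
by move=> [ij /mem_set h]; apply/andP.
Qed.

Lemma sample_relabel f (x : sequence_space X) : injective f ->
  relabel f (sample_graph x) = sample_graph (x \o f : sequence_space X).
Proof.
move=> finj; apply: edge_ext => i j; rewrite edge_relabel.
by rewrite !edge_sample (inj_eq finj).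
Qed.

Lemma agree_sample n (x y : sequence_space X) : (forall i, (i < n)%N -> x i = y i) ->
  agree n (sample_graph x) (sample_graph y).
Proof. by move=> xy i j ilt jlt; rewrite !edge_sample !xy. Qed.

Lemma graph_measure_ergodic s (mu : probability graph_space R) :
  K_free_universal G s -> is_graph_measure G mu ->
  [/\ perm_invariant mu, perm_ergodic mu &
      {ae mu, forall g, universal_K_free (edge g) s}].
Proof.
move=> [_ [M' mM' aeM']] [M mM muM].
have mS (A : set graph_space) : measurable A ->
    measurable (@sample_graph R G @^-1` A).
  by move=> mA; rewrite -[X in measurable X]setTI; exact: measurable_sample.
have inv : perm_invariant mu.
  move=> f fbij A mA; have finj := bij_inj fbij.
  rewrite !muM//; last exact: measurable_relabel_preimage.
  rewrite /pushforward -(bernoulli_reindex mM finj (mS _ mA)).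
  congr (M _); apply/funext => x; rewrite /preimage /mkset /=.
  by rewrite sample_relabel.
split=> //.
  apply: dissociated_ergodic => // n k C Y nC kY.
  have mC := window_measurable nC; have mY := window_measurable kY.
  have mY' := measurable_relabel_preimage (addn n) mY.
  apply: EFin_inj; rewrite EFinM -!prE//; last exact: measurableI.
  rewrite !muM//; last exact: measurableI.
  rewrite /pushforward -(bernoulli_independent (n := n) mM (mS _ mC) (mS _ mY)).
    congr (M _); rewrite preimage_setI; congr (_ `&` _).
    apply/funext => x; rewrite /preimage /mkset /=.
    by rewrite sample_relabel//; exact: addnI.
  by move=> x y /agree_sample xy; apply: nC.
have mU := measurable_universal s.
apply: (ae_setP mu mU).2.
(* Each of the two hypotheses brings its own Bernoulli measure; uniqueness identifies them. *)
rewrite muM// /pushforward (bernoulli_unique mM mM' (mS _ mU)).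
exact: (ae_setP M' (mS _ mU)).1.
Qed.

End sampling.

(** * The unit interval *)

(* The carrier is the whole line, on which the Lebesgue measure of [0, 1] is
   complete once all subsets of the complement of [0, 1] are made measurable. *)
Definition unit_lebesgue (R : realType) : Type := R.

Section unit_lebesgue.
Context (R : realType).
Local Notation cara := (((wlength (@idfun R))^*)%mu.-cara.-measurable).
Local Notation I := (`[0%R, 1%R]%classic : set R).

HB.instance Definition _ := Pointed.copy (unit_lebesgue R) R.

Definition unit_measurable : set (set (unit_lebesgue R)) := [set A | cara (A `&` I)].

Lemma borel_cara (B : set R) : measurable B -> cara B.
Proof. by move=> mB; exact: sub_caratheodory. Qed.

Let um0 : unit_measurable set0.
Proof. by rewrite /unit_measurable /= set0I; exact: measurable0. Qed.

Let umC A : unit_measurable A -> unit_measurable (~` A).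
Proof.
rewrite /unit_measurable /= => mA.
rewrite (_ : ~` A `&` I = I `\` (A `&` I)).
  by apply: measurableD => //; apply: borel_cara; exact: measurable_itv.
apply/seteqP; split => x /=; first by move=> [nA xI]; split=> // -[].
by move=> [xI nAI]; split=> // Ax; apply: nAI.
Qed.

Let umU (F : (set (unit_lebesgue R))^nat) :
  (forall i, unit_measurable (F i)) -> unit_measurable (\bigcup_i F i).
Proof.
rewrite /unit_measurable /= => mF; rewrite setI_bigcupl.
exact: bigcupT_measurable.
Qed.

Definition unit_display : measure_display. Proof. exact: default_measure_display. Qed.

HB.instance Definition _ := @isMeasurable.Build unit_display (unit_lebesgue R)
  unit_measurable um0 umC umU.

Definition unit_measure (A : set (unit_lebesgue R)) : \bar R :=
  completed_lebesgue_measure (A `&` I).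

Let m0 : unit_measure set0 = 0%E.
Proof. by rewrite /unit_measure set0I measure0. Qed.

Let m_ge0 A : (0 <= unit_measure A)%E.
Proof. exact: measure_ge0. Qed.

Let m_sigma_additive : semi_sigma_additive unit_measure.
Proof.
move=> F mF tF mUF; rewrite /unit_measure setI_bigcupl.
apply: measure_semi_sigma_additive.
- by move=> i; exact: mF.
- exact: trivIset_setIr.
- by rewrite -setI_bigcupl; exact: mUF.
Qed.

HB.instance Definition _ := isMeasure.Build _ _ _ unit_measure
  m0 m_ge0 m_sigma_additive.

Lemma unit_measure_borel (B : set R) : unit_measure B = lebesgue_measure (B `&` I).
Proof. by []. Qed.

Let m_setT : unit_measure setT = 1%E.
Proof.
rewrite unit_measure_borel setTI lebesgue_measure_itv /= lte_fin ltr01.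
by rewrite oppr0 adde0.
Qed.

HB.instance Definition _ := Measure_isProbability.Build _ _ _ unit_measure m_setT.

Lemma unit_measurable_borel (B : set R) :
  measurable B -> measurable (B : set (unit_lebesgue R)).
Proof.
move=> mB; apply: borel_cara; apply: measurableI => //; exact: measurable_itv.
Qed.

Lemma measurable_unit_id : measurable_fun setT (id : unit_lebesgue R -> R).
Proof. by move=> _ B mB; rewrite setTI; exact: unit_measurable_borel. Qed.

Lemma unit_measure_complete : measure_is_complete unit_measure.
Proof.
move=> A [N [mN N0 AN]]; apply: completed_lebesgue_measure_is_complete.
by exists (N `&` I); split => //; exact: setSI.
Qed.

Lemma unit_measure_approx (A : set (unit_lebesgue R)) : measurable A ->
  exists B N : set R, [/\ measurable B, measurable N, unit_measure N = 0%E &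
    forall x : R, I x -> ~ N x -> A x <-> B x].
Proof.
move=> mA.
have := mA; rewrite /measurable /= /unit_measurable /mkset.
rewrite -completed_caratheodory_measurable g_sigma_completed_algebra_genE.
move=> [B mB [N' [N [mN N0 N'N]] AB]]; exists B, N; split => //.
  rewrite unit_measure_borel; apply/eqP; rewrite -measure_le0 -N0.
  apply: le_measure; [rewrite inE|by rewrite inE|exact: subIsetl].
  by apply: measurableI => //; exact: measurable_itv.
move=> x Ix nN; split=> [Ax|Bx].
  have : (A `&` I) x by [].
  by rewrite -AB => -[//|/N'N].
have : (B `|` N') x by left.
by rewrite AB => -[].
Qed.

Lemma unit_measure_lebesgue : continuous_lebesgue_space (unit_measure : probability _ R).
Proof.
split; first exact: unit_measure_complete.
exists I, I, id; split.
- exists (~` I); split=> //.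
    by apply/unit_measurable_borel/measurableC; exact: measurable_itv.
  change (lebesgue_measure (~` I `&` I) = 0%E).
  by rewrite setICl measure0.
- by split=> //; rewrite setDv; exact: negligible_set0.
- by split=> [x //|x y _ _ //|x Ix]; exists x.
- by move=> A AI; rewrite image_id /measurable /= /unit_measurable /= (setIidl AI).
- by move=> A AI mA; rewrite image_id /= /unit_measure (setIidl AI).
Qed.

End unit_lebesgue.

(** * Coding bit sequences by nested intervals *)

Lemma mkseqS T (f : nat -> T) n : mkseq f n.+1 = rcons (mkseq f n) (f n).
Proof. by rewrite /mkseq -addn1 iotaD map_cat /= cats1. Qed.

Section interval_code.
Context (R : realType).
Implicit Types (nu : seq bool -> R) (u : R) (w : seq bool) (n : nat).

(** For additive weights, the total weight of the words of the same length preceding w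
    lexicographically: the interval of w starts here and has length [nu w]. *)
Definition left_end nu w : R :=
  \sum_(k < size w) (if nth false w k then nu (rcons (take k w) false) else 0).

Lemma left_end_rcons nu w b :
  left_end nu (rcons w b) = left_end nu w + (if b then nu (rcons w false) else 0).
Proof.
rewrite /left_end size_rcons big_ord_recr /= nth_rcons ltnn eqxx.
rewrite -cats1 take_size_cat//; congr (_ + _); apply: eq_bigr => i _.
by rewrite nth_cat ltn_ord takel_cat// ltnW.
Qed.

Lemma left_end_nil nu : left_end nu [::] = 0.
Proof. by rewrite /left_end big_ord0. Qed.

Fixpoint code_prefix nu u n : seq bool :=
  if n is n'.+1 then let w := code_prefix nu u n' in
    rcons w (left_end nu w + nu (rcons w false) <= u)
  else [::].

(** The address of u in the nested subdivision of the unit interval. Under a uniform u its law gives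
    weight [nu w] to the prefix w, so every law of bit sequences is realized. *)
Definition itv_code nu u n : bool :=
  left_end nu (code_prefix nu u n) + nu (rcons (code_prefix nu u n) false) <= u.

Lemma size_code_prefix nu u n : size (code_prefix nu u n) = n.
Proof. by elim: n => //= n IH; rewrite size_rcons IH. Qed.

Lemma code_prefixE nu u n : mkseq (itv_code nu u) n = code_prefix nu u n.
Proof. by elim: n => // n IH; rewrite mkseqS IH. Qed.

Record additive_weights nu : Prop := AdditiveWeights {
  weights_nil : nu [::] = 1;
  weights_ge0 : forall w, 0 <= nu w;
  weights_split : forall w, nu w = nu (rcons w false) + nu (rcons w true) }.

Section additive.
Variable nu : seq bool -> R.
Hypothesis nuA : additive_weights nu.

Let nu0 w : 0 <= nu w. Proof. exact: weights_ge0. Qed.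

Lemma left_end_ge0 w : 0 <= left_end nu w.
Proof. by apply: sumr_ge0 => i _; case: ifP. Qed.

Lemma right_end_le1 w : left_end nu w + nu w <= 1.
Proof.
elim/last_ind: w => [|w b IH]; first by rewrite left_end_nil add0r weights_nil.
apply: le_trans IH; rewrite left_end_rcons [in leRHS](weights_split nuA) -addrA lerD2l.
by case: b; rewrite ?add0r// lerDl.
Qed.

Lemma code_prefix_itv u n : 0 <= u < 1 ->
  left_end nu (code_prefix nu u n) <= u <
  left_end nu (code_prefix nu u n) + nu (code_prefix nu u n).
Proof.
move=> u01; elim: n => [|n]; first by rewrite left_end_nil add0r weights_nil.
rewrite [code_prefix _ _ n.+1]/=; set w := code_prefix nu u n => /andP[h1 h2].
rewrite left_end_rcons.
have [h|h] := leP (left_end nu w + nu (rcons w false)) u; rewrite ?addr0.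
  by rewrite h /=; move: h2; rewrite (weights_split nuA w) addrA.
by rewrite h1.
Qed.

Lemma code_prefix_unique u w : left_end nu w <= u < left_end nu w + nu w ->
  code_prefix nu u (size w) = w.
Proof.
elim/last_ind: w => // w b IH; rewrite left_end_rcons => /andP[h1 h2].
have hw := weights_split nuA w; have n0 := nu0 (rcons w false); have n1 := nu0 (rcons w true).
have wu : left_end nu w <= u < left_end nu w + nu w.
  by apply/andP; case: b h1 h2 => h1 h2; split; lra.
rewrite size_rcons /= IH//; congr rcons.
by case: b h1 h2 => h1 h2; [lra|apply/negbTE; rewrite -ltNge; lra].
Qed.

Lemma itv_codeP u w : 0 <= u < 1 ->
  mkseq (itv_code nu u) (size w) = w <-> left_end nu w <= u < left_end nu w + nu w.
Proof.
move=> u01; rewrite code_prefixE; split; last exact: code_prefix_unique.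
by have := code_prefix_itv (size w) u01 => + e; rewrite e.
Qed.

(** The points with a given prefix form an interval. Two distinct points sharing a code would thus
    give a code shared by a whole interval, that is, an atom of the law of the code. *)
Lemma itv_code_convex x y z : 0 <= x -> x <= z <= y -> y < 1 ->
  itv_code nu x =1 itv_code nu y -> itv_code nu z =1 itv_code nu x.
Proof.
move=> x0 /andP[xz zy] y1 xy n.
have e k : mkseq (itv_code nu x) k = mkseq (itv_code nu y) k by exact: eq_mkseq.
suff : mkseq (itv_code nu z) n.+1 = mkseq (itv_code nu x) n.+1.
  by rewrite !mkseqS => /rcons_inj[].
set w := mkseq (itv_code nu x) n.+1.
have sw : size w = n.+1 by rewrite size_mkseq.
have h1 : left_end nu w <= x < left_end nu w + nu w.
  by apply/itv_codeP; [apply/andP; split; lra|rewrite sw].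
have h2 : left_end nu w <= y < left_end nu w + nu w.
  by apply/itv_codeP; [apply/andP; split; lra|rewrite sw -e].
by rewrite -sw; apply/itv_codeP; apply/andP; split; lra.
Qed.

End additive.

(** Joint measurability in weights and point is needed because the weights will depend on a random
    graph. A bit is decided by one of finitely many prefixes. *)
Lemma measurable_itv_code d (T : measurableType d) (nu : T -> seq bool -> R) (u : T -> R) :
  (forall w, measurable_fun setT (fun t => nu t w)) -> measurable_fun setT u ->
  forall n, measurable_fun setT (fun t => itv_code (nu t) (u t) n).
Proof.
move=> mnu mu.
have mleft w : measurable_fun setT (fun t => left_end (nu t) w).
  apply: (@measurable_sum _ _ _ setT 'I_(size w) (index_enum _)
    (fun k t => if nth false w k then nu t (rcons (take k w) false) else 0)) => k.
  by case: (nth false w k) => //; exact: measurable_cst.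
pose Q w t := left_end (nu t) w + nu t (rcons w false) <= u t.
have mQ w : measurable_fun setT (Q w).
  by apply: measurable_fun_ler => //; exact: measurable_funD.
have mQb w b : measurable [set t | Q w t = b].
  by rewrite -[X in measurable X]setTI; exact: (mQ w measurableT [set b]).
have mpre w : measurable [set t | code_prefix (nu t) (u t) (size w) = w].
  elim/last_ind: w => [|w b IH].
    by rewrite (_ : mkset _ = setT)//; apply/seteqP; split.
  rewrite (_ : mkset _ = [set t | code_prefix (nu t) (u t) (size w) = w] `&`
     [set t | Q w t = b]); first exact: measurableI.
  apply/seteqP; split=> t /=; rewrite size_rcons /=.
    move=> /eqP; rewrite eqseq_rcons => /andP[/eqP e /eqP qb].
    by split=> //; rewrite -qb e.
  by move=> [e qb]; rewrite e -/(Q w t) qb.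
move=> n; apply: (measurable_fun_bool true).
rewrite setTI (_ : _ @^-1` _ = [set t | exists w : n.-tuple bool,
   code_prefix (nu t) (u t) (size w) = w /\ Q w t = true]).
  by apply: measurable_ex => w; exact: measurable_andP.
apply/seteqP; split=> t /=.
  rewrite /itv_code => h; exists (Tuple (introT eqP (size_code_prefix (nu t) (u t) n))).
  by rewrite /= size_code_prefix.
by move=> [w [e q]]; move: e; rewrite size_tuple /itv_code => ->.
Qed.

End interval_code.

Section bit_sequences.
Context (R : realType).

Definition bit_cylinder (w : seq bool) : set (sequence_space bool) :=
  [set t | mkseq t (size w) = w].

Definition bit_cylinders : set (set (sequence_space bool)) :=
  [set C | C = set0 \/ exists w, C = bit_cylinder w].

Lemma bit_cylinder_nth w : bit_cylinder w =
  [set t | forall i, (i < size w)%N -> t i = nth false w i].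
Proof.
apply/seteqP; split=> t /=; rewrite /bit_cylinder /=.
  by move=> e i ilt; rewrite -[in RHS]e nth_mkseq.
move=> h; apply: (@eq_from_nth _ false); rewrite size_mkseq// => i ilt.
by rewrite nth_mkseq// h.
Qed.

Lemma measurable_bit_cylinder w : measurable (bit_cylinder w).
Proof.
rewrite bit_cylinder_nth; apply: measurable_all => i.
apply: measurable_imp; first exact: measurable_prop.
exact: (@measurable_coord_preimage _ bool i [set nth false w i]).
Qed.

Lemma bit_cylinders_setI : setI_closed bit_cylinders.
Proof.
suff h (w w' : seq bool) : (size w <= size w')%N ->
    bit_cylinders (bit_cylinder w `&` bit_cylinder w').
  move=> A B [->|[w ->]]; first by move=> _; left; rewrite set0I.
  move=> [->|[w' ->]]; first by left; rewrite setI0.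
  have [|/ltnW] := leqP (size w) (size w'); first exact: h.
  by rewrite setIC; exact: h.
move=> ww'; have [e|ne] := eqVneq (take (size w) w') w.
  right; exists w'; apply/seteqP; split=> t; first by move=> [].
  move=> tw'; split=> //; rewrite /bit_cylinder /= -e -tw'.
  rewrite (_ : size (take _ _) = size w); last first.
    by rewrite size_take size_mkseq; case: ltnP => //; lia.
  rewrite /mkseq -map_take take_iota.
  by congr (map _ (iota _ _)); lia.
left; apply/seteqP; split=> // t [tw tw']; move/eqP: ne; apply.
rewrite -[RHS]tw -[in LHS]tw' /mkseq -map_take take_iota.
by congr (map _ (iota _ _)); lia.
Qed.

Lemma bit_sequences_measurableE :
  @measurable _ (sequence_space bool) = <<s bit_cylinders >>.
Proof.
apply/seteqP; split; apply: smallest_sub; try exact: smallest_sigma_algebra.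
  move=> _ [i _ [A mA <-]]; rewrite setTI.
  rewrite (_ : _ @^-1` A = \bigcup_(w in [set w : i.+1.-tuple bool | A (nth false w i)])
    bit_cylinder w).
    apply: (@fin_bigcup_measurable _ (g_sigma_algebraType bit_cylinders)).
      exact: finite_finset.
    by move=> w _; apply: sub_sigma_algebra; right; exists w.
  apply/seteqP; split=> t /=.
    move=> At; exists (Tuple (introT eqP (size_mkseq t i.+1))).
      by change (A (nth false (mkseq t i.+1) i)); rewrite nth_mkseq.
    by change (mkseq t (size (mkseq t i.+1)) = mkseq t i.+1); rewrite size_mkseq.
  move=> [w Aw]; rewrite bit_cylinder_nth /= size_tuple => h.
  by rewrite /preimage /= h.
move=> _ [->|[w ->]]; first exact: measurable0.
exact: measurable_bit_cylinder.
Qed.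

Lemma bit_measure_unique (P Q : {measure set (sequence_space bool) -> \bar R}) :
  (P setT < +oo)%E -> (forall w, P (bit_cylinder w) = Q (bit_cylinder w)) ->
  forall A, measurable A -> P A = Q A.
Proof.
move=> Poo h A mA; apply: (measure_unique bit_cylinders (fun=> setT)) => //.
- exact: bit_sequences_measurableE.
- exact: bit_cylinders_setI.
- by move=> _; right; exists [::]; apply/seteqP; split.
- by apply/seteqP; split=> // x _; exists 0%N.
- by move=> _ [->|[w ->]]; rewrite ?measure0.
Qed.

Lemma measurable_bits d (T : measurableType d) (c : T -> sequence_space bool) :
  (forall n, measurable_fun setT (fun t => c t n)) -> measurable_fun setT c.
Proof. exact: measurable_fun_sequence. Qed.

Local Notation m := (@unit_measure R : probability _ R).

Lemma unit_interval_ae : m (~` (`[0%R, 1%R[%classic : set R)) = 0%E.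
Proof.
change (lebesgue_measure (~` `[0%R, 1%R[%classic `&` `[0%R, 1%R]%classic : set R) = 0%E).
rewrite (_ : _ `&` _ = [set 1%R]); first exact: lebesgue_measure_set1.
apply/seteqP; split=> x /=; rewrite !in_itv /=; last by move=> ->; rewrite ltxx lexx ler01.
by move=> [/negP]; rewrite negb_and -leNgt -ltNge => h h'; apply/eqP; lra.
Qed.

Lemma measurable_code nu : measurable_fun setT
  (fun u : unit_lebesgue R => itv_code nu u : sequence_space bool).
Proof.
apply: measurable_bits => n; apply: measurable_itv_code.
  by move=> w; exact: measurable_cst.
exact: measurable_unit_id.
Qed.

Lemma code_law nu w : additive_weights nu ->
  m [set u | bit_cylinder w (itv_code nu u)] = (nu w)%:E.
Proof.
move=> nuA.
have m1 : measurable [set u : unit_lebesgue R | bit_cylinder w (itv_code nu u)].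
  rewrite -[X in measurable X]setTI.
  exact: (measurable_code nu measurableT (measurable_bit_cylinder w)).
pose J : set R := `[left_end nu w, left_end nu w + nu w[%classic.
have mJ : measurable (J : set (unit_lebesgue R)).
  by apply: unit_measurable_borel; exact: measurable_itv.
have -> : m [set u | bit_cylinder w (itv_code nu u)] = m J.
  rewrite !prE//; congr _%:E; apply/eqP; rewrite -subr_eq0 -normr_le0.
  have mI : measurable (~` (`[0%R, 1%R[%classic : set R) : set (unit_lebesgue R)).
    by apply: unit_measurable_borel; apply: measurableC; exact: measurable_itv.
  have <- : pr m (~` (`[0%R, 1%R[%classic : set R)) = 0.
    by rewrite /pr unit_interval_ae.
  apply: le_trans (pr_dist m m1 mJ) _; apply: pr_le => //; first exact: measurableY.
  move=> u [] [/= h1 h2]; rewrite in_itv /= => u01.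
    by apply: h2; rewrite /J /= in_itv /=; exact/(itv_codeP nuA w u01).
  by apply: h2; apply/(itv_codeP nuA w u01); move: h1; rewrite /J /= in_itv.
change (lebesgue_measure (J `&` `[0%R, 1%R]%classic) = (nu w)%:E).
have w0 := weights_ge0 nuA w; have l0 := left_end_ge0 nuA w.
have r1 := right_end_le1 nuA w.
rewrite setIidl; last first.
  by move=> u; rewrite /J /= !in_itv /= => /andP[h1 h2]; apply/andP; split; lra.
rewrite /J lebesgue_measure_itv /= lte_fin; case: ltP => h.
  by rewrite -EFinB; congr _%:E; lra.
by congr _%:E; lra.
Qed.

Section realization.
Context d (T : measurableType d) (P : probability T R) (c : T -> sequence_space bool).
Hypothesis mc : measurable_fun setT c.

Definition law_weights w : R := pr P (c @^-1` bit_cylinder w).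

Let mcw w : measurable (c @^-1` bit_cylinder w).
Proof. by rewrite -[X in measurable X]setTI; exact: (mc _ (measurable_bit_cylinder w)). Qed.

Lemma law_weights_additive : additive_weights law_weights.
Proof.
split.
- rewrite /law_weights (_ : _ @^-1` _ = setT) ?pr_setT//; apply/seteqP; split=> //.
- by move=> w; exact: pr_ge0.
- move=> w; rewrite /law_weights; apply: EFin_inj; rewrite EFinD -!prE//.
  rewrite -measureU//; last first.
    apply/seteqP; split=> // t [] /=; rewrite /bit_cylinder /= !size_rcons !mkseqS.
    by move=> /eqP; rewrite eqseq_rcons => /andP[_ /eqP ->] /eqP;
       rewrite eqseq_rcons => /andP[].
  congr (P _); rewrite -preimage_setU; congr (_ @^-1` _).
  apply/seteqP; split=> t; rewrite /bit_cylinder /= !size_rcons !mkseqS.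
    by move=> ->; case: (t _); [right|left].
  by move=> [] /eqP; rewrite eqseq_rcons => /andP[/eqP].
Qed.

Lemma law_realization (A : set (sequence_space bool)) : measurable A ->
  m [set u : unit_lebesgue R | A (itv_code law_weights u)] = P (c @^-1` A).
Proof.
move: A; apply: (@bit_measure_unique
  (image_probability m (measurable_code law_weights)) (image_probability P mc)).
  exact: fin_num_fun_lty.
move=> w; change (m [set u | bit_cylinder w (itv_code law_weights u)] =
  P (c @^-1` bit_cylinder w)).
by rewrite code_law ?prE//; exact: law_weights_additive.
Qed.

End realization.

(** With these weights [itv_code] gives binary digits. *)
Definition dyadic_weights (w : seq bool) : R := 2^-1 ^+ size w.

Lemma dyadic_weights_additive : additive_weights dyadic_weights.
Proof.
split; rewrite /dyadic_weights //=.
by move=> w; rewrite !size_rcons exprS; field.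
Qed.

(** The superior limit makes this a measurable function of all bit sequences; on the binary digits
    of a point of [0, 1[ it is a limit and returns the point. *)
Definition real_of_bits (t : sequence_space bool) : R :=
  limn_sup (fun n => left_end dyadic_weights (mkseq t n)).

Lemma measurable_real_of_bits : measurable_fun setT real_of_bits.
Proof.
have le1 w : left_end dyadic_weights w <= 1.
  apply: le_trans (right_end_le1 dyadic_weights_additive w).
  by rewrite lerDl (weights_ge0 dyadic_weights_additive).
apply: measurable_fun_limn_sup => [t _|t _|n].
- by exists 1 => _ [k _ <-].
- by exists 0 => _ [k _ <-]; exact: (left_end_ge0 dyadic_weights_additive).
move=> _ Y mY; rewrite setTI.
rewrite (_ : _ @^-1` Y = \bigcup_(w in [set w : n.-tuple bool |
   Y (left_end dyadic_weights w)]) bit_cylinder w).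
  apply: fin_bigcup_measurable; first exact: finite_finset.
  by move=> w _; exact: measurable_bit_cylinder.
apply/seteqP; split=> t /=.
  move=> Yt; exists (Tuple (introT eqP (size_mkseq t n))) => //.
  by change (mkseq t (size (mkseq t n)) = mkseq t n); rewrite size_mkseq.
by move=> [w Yw]; rewrite /bit_cylinder /= size_tuple /preimage /= => ->.
Qed.

Lemma real_of_bitsK u : 0 <= u < 1 -> real_of_bits (itv_code dyadic_weights u) = u.
Proof.
move=> u01; pose b n := left_end dyadic_weights (mkseq (itv_code dyadic_weights u) n).
have bu n : `|u - b n| <= 2^-1 ^+ n.
  have E : dyadic_weights (mkseq (itv_code dyadic_weights u) n) = 2^-1 ^+ n.
    by rewrite /dyadic_weights size_mkseq.
  have := code_prefix_itv dyadic_weights_additive n u01.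
  rewrite -code_prefixE -/(b n) E => /andP[h1 h2].
  have : 0 <= (2^-1 : R) ^+ n by rewrite exprn_ge0// invr_ge0.
  by move: (2^-1 ^+ n) h2 => p h2 p0; rewrite ler_norml; apply/andP; split; lra.
have cb : b @ \oo --> u.
  apply/cvgrPdist_le => e e0; near=> n; apply: le_trans (bu n) _.
  near: n; have /cvgrPdist_le/(_ e e0) : (2^-1 : R) ^+ n @[n --> \oo] --> 0.
    by apply: cvg_expr; rewrite ger0_norm; lra.
  by apply: filterS => n; rewrite sub0r normrN ger0_norm// exprn_ge0//; lra.
by rewrite /real_of_bits cvg_limn_supE; [apply/cvg_lim|apply: cvgP; exact: cb].
Unshelve. all: by end_near. Qed.

End bit_sequences.

Lemma pr_ae_eq d (T : measurableType d) (R : realType) (P : probability T R)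
    (A B N : set T) : measurable A -> measurable B -> measurable N -> P N = 0%E ->
  (forall x, ~ N x -> A x <-> B x) -> P A = P B.
Proof.
move=> mA mB mN N0 AB; rewrite !prE//; congr _%:E; apply/eqP.
rewrite -subr_eq0 -normr_le0; have <- : pr P N = 0 by rewrite /pr N0.
apply: le_trans (pr_dist P mA mB) _; apply: pr_le => //; first exact: measurableY.
move=> x [] [h1 h2]; apply: contrapT => /AB h; exact/h2/h.
Qed.

Lemma complete_measurable d (T : measurableType d) (R : realType) (P : probability T R)
    (A B N : set T) : measure_is_complete P -> measurable B -> measurable N ->
  P N = 0%E -> (forall x, ~ N x -> A x <-> B x) -> measurable A.
Proof.
move=> cP mB mN N0 AB.
have mAN : measurable (A `&` N) by apply: cP; exists N; split => // x [].
rewrite (_ : A = (A `&` N) `|` (B `\` N)).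
  by apply: measurableU => //; exact: measurableD.
apply/seteqP; split=> x.
  move=> Ax; have [Nx|Nx] := pselect (N x); [by left|right; split=> //; exact/AB].
by move=> [[]//|[Bx Nx]]; exact/AB.
Qed.

(** * Independent points from a single point *)

Section product_splitting.
Context (R : realType).
Local Notation X := (unit_lebesgue R).
Local Notation m := (@unit_measure R : probability _ R).
Local Notation bits := (@itv_code R (@dyadic_weights R)).

(* Realizing the law of the interleaved bits of two independent points provides a
   measure preserving map from X to X * X without computing the law of the bits. *)
Let interleave (p : X * X) : sequence_space bool :=
  fun n => if odd n then bits p.2 n./2 else bits p.1 n./2.

Let measurable_interleave : measurable_fun setT interleave.
Proof.
apply: measurable_bits => n; rewrite /interleave.
have mb := measurable_code (@dyadic_weights R).
have mbk k : measurable_fun setT (fun u : X => bits u k).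
  exact: (measurableT_comp (@measurable_coord _ bool k) mb).
case: (odd n).
  exact: (measurableT_comp (mbk n./2) measurable_snd).
exact: (measurableT_comp (mbk n./2) measurable_fst).
Qed.

Let nu := law_weights (product_probability m m) interleave.

Definition first_half (u : X) : X := real_of_bits R (fun n => itv_code nu u n.*2).
Definition second_half (u : X) : X := real_of_bits R (fun n => itv_code nu u n.*2.+1).

Let measurable_sub (f : nat -> nat) : measurable_fun setT
  (fun t : sequence_space bool => real_of_bits R (t \o f)).
Proof. exact: (measurableT_comp (@measurable_real_of_bits R) (@measurable_reindex _ bool f)). Qed.

Let unit_Ico : set R := `[0%R, 1%R[%classic.

Let halves_borel (B1 B2 : set R) : measurable B1 -> measurable B2 ->
  m [set u : X | B1 (first_half u) /\ B2 (second_half u)] =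
  (m (B1 : set X) * m (B2 : set X))%E.
Proof.
move=> mB1 mB2.
pose A : set (sequence_space bool) := [set t : sequence_space bool |
  B1 (real_of_bits R (t \o double)) /\ B2 (real_of_bits R (t \o (fun n => n.*2.+1)))].
have mA : measurable A.
  by apply: measurable_andP; rewrite -[X in measurable X]setTI; exact: measurable_sub.
transitivity ((m \x m)%E (interleave @^-1` A)).
  exact: (law_realization (product_probability m m) measurable_interleave mA).
rewrite -product_measure1E; [|exact: unit_measurable_borel|exact: unit_measurable_borel].
have mI : measurable (unit_Ico : set X).
  by apply: unit_measurable_borel; exact: measurable_itv.
have mN : measurable ((~` unit_Ico : set X) `*` setT `|` setT `*` (~` unit_Ico : set X)).
  by apply: measurableU; apply: measurableX => //; exact: measurableC.
apply: (@pr_ae_eq _ _ _ (product_probability m m) _ _ _ _ _ mN).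
- by rewrite -[X in measurable X]setTI; exact: measurable_interleave.
- by apply: measurableX; exact: unit_measurable_borel.
- have h1 : product_probability m m ((~` unit_Ico : set X) `*` setT) = 0%E.
    change ((m \x m)%E ((~` unit_Ico : set X) `*` setT) = 0%E).
    rewrite product_measure1E//; last exact: measurableC.
    by rewrite [X in (X * _)%E](unit_interval_ae R) mul0e.
  have h2 : product_probability m m (setT `*` (~` unit_Ico : set X)) = 0%E.
    change ((m \x m)%E (setT `*` (~` unit_Ico : set X)) = 0%E).
    rewrite product_measure1E//; last exact: measurableC.
    by rewrite [X in (_ * X)%E](unit_interval_ae R) mule0.
  by apply: null_set_setU => //; apply: measurableX => //; exact: measurableC.
move=> [x y] nN.
have Ix : 0 <= x < 1.
  have : unit_Ico x by apply: contrapT => Ix; apply: nN; left.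
  by rewrite /unit_Ico /= in_itv.
have Iy : 0 <= y < 1.
  have : unit_Ico y by apply: contrapT => Iy; apply: nN; right.
  by rewrite /unit_Ico /= in_itv.
have -> : (interleave @^-1` A) (x, y) = A (interleave (x, y)) by [].
rewrite /A /mkset.
have -> : interleave (x, y) \o double = bits x.
  by apply/funext => n; rewrite /interleave /= odd_double doubleK.
have -> : interleave (x, y) \o (fun n => n.*2.+1) = bits y.
  by apply/funext => n; rewrite /interleave /= odd_double /= uphalf_double.
by rewrite !real_of_bitsK.
Qed.

Let measurable_first_borel (B : set R) : measurable B ->
  measurable [set u : X | B (first_half u)].
Proof.
move=> mB; rewrite -[X in measurable X]setTI.
exact: (measurableT_comp (measurable_sub double) (measurable_code nu) measurableT mB).
Qed.

Let measurable_second_borel (B : set R) : measurable B ->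
  measurable [set u : X | B (second_half u)].
Proof.
move=> mB; rewrite -[X in measurable X]setTI.
exact: (measurableT_comp (measurable_sub (fun n => n.*2.+1)) (measurable_code nu)
  measurableT mB).
Qed.

Let borel_version (A : set X) : measurable A -> exists B N : set R,
  [/\ measurable B, measurable N, m (N : set X) = 0%E &
    forall x, ~ N x -> A x <-> B x].
Proof.
move=> /unit_measure_approx[B [N [mB mN N0 AB]]].
pose I : set R := `[0%R, 1%R]%classic.
have mI : measurable I by exact: measurable_itv.
have mNI : measurable (N `|` ~` I) by apply: measurableU => //; exact: measurableC.
exists B, (N `|` ~` I); split => //.
  apply: null_set_setU => //; try by apply: unit_measurable_borel => //; exact: measurableC.
  change (lebesgue_measure (~` I `&` I) = 0%E).
  by rewrite setICl measure0.
move=> x /not_orP[nN /contrapT xI]; exact: AB.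
Qed.

Let half_null (N : set R) : measurable N -> m (N : set X) = 0%E ->
  m [set u : X | N (first_half u)] = 0%E /\ m [set u : X | N (second_half u)] = 0%E.
Proof.
move=> mN N0; split.
  transitivity (m [set u : X | N (first_half u) /\ setT (second_half u)]).
    by congr (m _); apply/seteqP; split=> u //= [].
  by rewrite halves_borel// [X in (X * _)%E]N0 mul0e.
transitivity (m [set u : X | setT (first_half u) /\ N (second_half u)]).
  by congr (m _); apply/seteqP; split=> u //= [].
by rewrite halves_borel// [X in (_ * X)%E]N0 mule0.
Qed.

(** The sigma-algebra of X is completed, so Borel sets are not enough: a measurable set differs from
    a Borel one inside a Borel null set, whose preimage is null by [half_null], and completeness
    concludes. *)
Lemma measurable_first_half : measurable_fun setT first_half.
Proof.
move=> _ A mA; rewrite setTI; have [B [N [mB mN N0 AB]]] := borel_version mA.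
have [N1 _] := half_null mN N0.
apply: (complete_measurable (@unit_measure_complete R) (measurable_first_borel mB)
  (measurable_first_borel mN) N1) => u; exact: AB.
Qed.

Lemma measurable_second_half : measurable_fun setT second_half.
Proof.
move=> _ A mA; rewrite setTI; have [B [N [mB mN N0 AB]]] := borel_version mA.
have [_ N1] := half_null mN N0.
apply: (complete_measurable (@unit_measure_complete R) (measurable_second_borel mB)
  (measurable_second_borel mN) N1) => u; exact: AB.
Qed.

Lemma halves_independent (A1 A2 : set X) : measurable A1 -> measurable A2 ->
  m (first_half @^-1` A1 `&` second_half @^-1` A2) = (m A1 * m A2)%E.
Proof.
move=> mA1 mA2.
have [B1 [N1 [mB1 mN1 N10 AB1]]] := borel_version mA1.
have [B2 [N2 [mB2 mN2 N20 AB2]]] := borel_version mA2.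
have [N1' _] := half_null mN1 N10; have [_ N2'] := half_null mN2 N20.
rewrite (pr_ae_eq mA1 (unit_measurable_borel mB1) (unit_measurable_borel mN1) N10 AB1).
rewrite (pr_ae_eq mA2 (unit_measurable_borel mB2) (unit_measurable_borel mN2) N20 AB2).
rewrite -halves_borel//.
have mU := measurableU _ _ (measurable_first_borel mN1) (measurable_second_borel mN2).
apply: (pr_ae_eq _ _ mU).
- apply: measurableI; rewrite -[X in measurable X]setTI.
    exact: measurable_first_half.
  exact: measurable_second_half.
- by apply: measurableI; [exact: measurable_first_borel|exact: measurable_second_borel].
- apply: null_set_setU => //; first exact: measurable_first_borel.
  exact: measurable_second_borel.
- move=> u /not_orP[/AB1 h1 /AB2 h2].
  by split=> -[a b]; split; [exact/h1|exact/h2|exact/h1|exact/h2].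
Qed.

Let unit_sequence (u : X) : sequence_space X :=
  fun n => first_half (iter n second_half u).

Let measurable_unit_sequence : measurable_fun setT unit_sequence.
Proof.
apply: measurable_fun_sequence => i.
have mi : measurable_fun setT (iter i second_half).
  elim: i => [|i IH]; first exact: measurable_id.
  exact: (measurableT_comp measurable_second_half IH).
exact: (measurableT_comp measurable_first_half mi).
Qed.

(** Splitting off a first half and splitting the second half again, forever, turns one uniform point
    into an independent sequence; induction on the box peels off one coordinate at a time. *)
Lemma unit_bernoulli : exists M : probability (sequence_space X) R, bernoulli_measure m M.
Proof.
exists (image_probability m measurable_unit_sequence) => n A mA.
change (m (unit_sequence @^-1` box n A) = (\prod_(i < n) m (A i))%E).
have mbox k (B : nat -> set X) : (forall i, measurable (B i)) ->
    measurable (unit_sequence @^-1` box k B).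
  move=> mB; rewrite -[X in measurable X]setTI.
  by apply: measurable_unit_sequence => //; exact: measurable_box.
elim: n A mA => [|n IH] A mA.
  by rewrite boxT preimage_setT big_ord0 probability_setT.
rewrite big_ord_recl /= -(IH (fun i => A i.+1))// -halves_independent//; last exact: mbox.
congr (m _); apply/seteqP; split=> u /=.
  move=> h; split; first exact: (h 0%N).
  by move=> i ilt; have := h i.+1 ilt; rewrite /unit_sequence iterSr.
move=> [h0 h] [|i] ilt; first exact: h0.
by rewrite /unit_sequence iterSr; exact: (h i).
Qed.

End product_splitting.

(** * Types of vertices *)

Lemma ae_countable d (T : measurableType d) (R : realType) (P : probability T R)
    (I : countType) (Q : I -> T -> Prop) :
  (forall i, {ae P, forall x, Q i x}) -> {ae P, forall x i, Q i x}.
Proof.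
move=> aeQ.
have : {ae P, forall x n, if unpickle n is Some i then Q i x else True}.
  by apply: ae_foralln => n; case: unpickle => [i|]; [exact: aeQ|exact: aeW].
by apply: filterS => x h i; have := h (pickle i); rewrite pickleK.
Qed.

Section almost_sure_cliques.
Context (R : realType) (s : nat) (mu : probability graph_space R).
Hypotheses (s_gt2 : (2 < s)%N) (inv : perm_invariant mu)
  (univ : {ae mu, forall g, universal_K_free (edge g) s}).

Definition clique_through (e : nat -> nat) (g : graph_space) p q :=
  exists c : {ffun 'I_(s - 2) -> nat},
    (forall i j, i != j -> edge g (e (c i)) (e (c j))) /\
    forall i, edge g p (e (c i)) && edge g q (e (c i)).

Let pair_then (e : nat -> nat) p q i :=
  match i with 0 => p | 1 => q | k.+2 => e k end%N.

Let pair_then_inj e p q : injective e -> p != q -> (forall k, e k != p) ->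
  (forall k, e k != q) -> injective (pair_then e p q).
Proof.
move=> einj pq ep eq [|[|i]] [|[|j]] //= h.
- by rewrite h eqxx in pq.
- by have := ep j; rewrite h eqxx.
- by rewrite h eqxx in pq.
- by have := eq j; rewrite h eqxx.
- by have := ep i; rewrite h eqxx.
- by have := eq i; rewrite h eqxx.
- by rewrite (einj _ _ h).
Qed.

(* Any injective relabelling of a random graph with law mu is again almost surely
   universal, so that cliques can be found within any prescribed infinite set. *)
Lemma ae_clique_through (e : nat -> nat) p q : injective e -> p != q -> (forall k, e k != p) ->
  (forall k, e k != q) ->
  {ae mu, forall g, edge g p q = false <-> clique_through e g p q}.
Proof.
move=> einj pq ep eq; have finj := pair_then_inj einj pq ep eq.
apply: filterS (universal_relabel inv finj univ) => g gU.
have [gfree _ _] := gU.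
have gsym : symmetric (edge (relabel (pair_then e p q) g)) by move=> i j; exact: edge_sym.
have girr : irreflexive (edge (relabel (pair_then e p q) g)) by move=> i; exact: edge_irr.
split=> [npq|[c [cc cpq]]].
  have [c [cJ cc cuv]] := universal_common_clique gsym girr s_gt2 gU (u := 0%N) (v := 1%N) isT npq.
  (* The clique avoids 0 and 1, the places of [p] and [q], so it lies in the range of [e]. *)
  have c2 i : c i = (c i - 2).+2 by have [] := cJ i; lia.
  have cE i : pair_then e p q (c i) = e (c i - 2)%N by rewrite {1}(c2 i).
  exists [ffun i => (c i - 2)%N]; split=> [i j ij|i]; rewrite !ffunE.
    by move: (cc i j ij); rewrite edge_relabel !cE.
  by move: (cuv i); rewrite !edge_relabel !cE.
apply/negbTE/negP => epq; apply: gfree.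
apply: (@common_clique_contains_K _ s setT 0%N 1%N gsym girr s_gt2 epq).
by exists (fun i => (c i).+2); split.
Qed.

Lemma ae_separated_through (e : nat -> nat) p q : injective e -> p != q -> (forall k, e k != p) ->
  (forall k, e k != q) ->
  {ae mu, forall g, exists k, edge g p (e k) != edge g q (e k)}.
Proof.
move=> einj pq ep eq; have finj := pair_then_inj einj pq ep eq.
apply: filterS (universal_relabel inv finj univ) => g gU.
have girr : irreflexive (edge (relabel (pair_then e p q) g)) by move=> i; exact: edge_irr.
have gsym : symmetric (edge (relabel (pair_then e p q) g)) by move=> i j; exact: edge_sym.
have [w [w0 w1]] := universal_separated gsym girr s_gt2 gU (u := 0%N) (v := 1%N) isT.
by case: w w0 w1 => [|[|k]] // _ _; exists k.
Qed.

End almost_sure_cliques.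

Section vertex_types.
Implicit Types (g : graph_space) (w : seq bool).

Definition vertex_type g (j : nat) : sequence_space bool :=
  fun k => edge g j.*2.+1 k.*2.

Definition type_cylinder j w : set graph_space :=
  [set g | bit_cylinder w (vertex_type g j)].

Definition types_in (js : nat -> nat) (ws : seq (seq bool)) : set graph_space :=
  [set g | forall i, (i < size ws)%N -> type_cylinder (js i) (nth [::] ws i) g].

Lemma window_type_cylinder N j w : (j.*2.+1 < N)%N -> ((size w).*2 <= N)%N ->
  window N (type_cylinder j w).
Proof.
move=> jN wN g g' gg'; rewrite /type_cylinder !bit_cylinder_nth /= => h i iw.
rewrite -h// /vertex_type gg'//; apply: leq_trans wN.
by rewrite ltn_double.
Qed.

Lemma measurable_type_cylinder j w : measurable (type_cylinder j w).
Proof.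
apply: (@window_measurable (maxn j.*2.+2 (size w).*2)).
by apply: window_type_cylinder; [exact: leq_maxl|exact: leq_maxr].
Qed.

Lemma measurable_types_in js ws : measurable (types_in js ws).
Proof.
apply: measurable_all => i; apply: measurable_imp; first exact: measurable_prop.
exact: measurable_type_cylinder.
Qed.

Context (R : realType) (mu : probability graph_space R).
Hypothesis inv : perm_invariant mu.

(** Both sides equal the probability of E, where the vertices N, N + 1, ... take the place of the
    chosen odd ones: words of length at most N / 2 only look at even vertices below N, which the
    relabelling fixes. *)
Lemma types_in_pr N Y ws js js' : window N Y ->
  (forall i, (i < size ws)%N -> ((size (nth [::] ws i)).*2 <= N)%N) ->
  (forall i, (i < size ws)%N -> (N <= (js i).*2.+1)%N) ->
  (forall i, (i < size ws)%N -> (N <= (js' i).*2.+1)%N) ->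
  (forall i j, (i < size ws)%N -> (j < size ws)%N -> js i = js j -> i = j) ->
  (forall i j, (i < size ws)%N -> (j < size ws)%N -> js' i = js' j -> i = j) ->
  pr mu (Y `&` types_in js ws) = pr mu (Y `&` types_in js' ws).
Proof.
move=> NY wN.
pose E := Y `&` [set g : graph_space | forall i, (i < size ws)%N ->
   bit_cylinder (nth [::] ws i) (fun k => edge g (N + i)%N k.*2)].
have wE : window (N + size ws) E.
  apply: windowI; first exact: window_le (leq_addr _ _) NY.
  move=> g g' gg' h i iw; have := h i iw; rewrite !bit_cylinder_nth /= => {}h k kw.
  rewrite -h// gg' ?ltn_add2l//.
  by apply: leq_trans (leq_addr _ _); apply: leq_trans (wN i iw); rewrite ltn_double.
suff H js0 : (forall i, (i < size ws)%N -> (N <= (js0 i).*2.+1)%N) ->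
  (forall i j, (i < size ws)%N -> (j < size ws)%N -> js0 i = js0 j -> i = j) ->
  pr mu (Y `&` types_in js0 ws) = pr mu E.
  by move=> h1 h2 h3 h4; rewrite !H.
move=> jN jinj.
pose F x := if (x < N)%N then x else (js0 (x - N)%N).*2.+1.
have FN i : F (N + i)%N = (js0 i).*2.+1 by rewrite /F ltnNge leq_addr /= addKn.
have Flt x : (x < N)%N -> F x = x by rewrite /F => ->.
rewrite -[RHS](relabel_window_pr inv (f := F) wE); last first.
  move=> x y xl yl.
  have [xN|Nx] := ltnP x N; have [yN|Ny] := ltnP y N.
  - by rewrite !Flt.
  - rewrite Flt// -(subnKC Ny) FN => e; have := jN (y - N)%N; rewrite -e ltn_subLR//.
    by move=> /(_ yl); rewrite leqNgt xN.
  - rewrite (Flt y)// -(subnKC Nx) FN => e; have := jN (x - N)%N; rewrite e ltn_subLR//.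
    by move=> /(_ xl); rewrite leqNgt yN.
  - rewrite -(subnKC Nx) -(subnKC Ny) !FN => -[] /double_inj /jinj.
    by rewrite !ltn_subLR// => /(_ xl yl) ->.
congr (pr mu _); rewrite /E preimage_setI; congr (_ `&` _).
  have -> : relabel F @^-1` Y = relabel id @^-1` Y.
    by apply: (relabel_window_eq NY) => i; exact: Flt.
  by apply/funext => g; rewrite /preimage /mkset (_ : relabel id g = g)//; exact: edge_ext.
apply/funext => g; apply/propext; rewrite /types_in /type_cylinder /=.
split=> h i iw; have := h i iw; rewrite !bit_cylinder_nth /vertex_type /= => {}h k kw;
  rewrite -h// edge_relabel FN Flt//; apply: leq_trans (wN i iw); by rewrite ltn_double.
Qed.

(** Here Y concerns even vertices only, so the odd ones need not lie beyond a window. E lists the n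
    odd vertices first and the even vertices after them. *)
Lemma types_in_pr0 N0 Y ws js js' : window N0 Y ->
  (forall i j, (i < size ws)%N -> (j < size ws)%N -> js i = js j -> i = j) ->
  (forall i j, (i < size ws)%N -> (j < size ws)%N -> js' i = js' j -> i = j) ->
  pr mu (relabel double @^-1` Y `&` types_in js ws) =
  pr mu (relabel double @^-1` Y `&` types_in js' ws).
Proof.
move=> NY; pose n := size ws; pose N := maxn N0 (\max_(w <- ws) size w).
have wN i : (i < n)%N -> (size (nth [::] ws i) <= N)%N.
  move=> iw; apply: leq_trans (leq_maxr _ _).
  by apply: (@leq_bigmax_seq _ ws predT (fun w => size w)) => //; exact: mem_nth.
pose E : set graph_space := relabel (addn n) @^-1` Y `&`
  [set g | forall i, (i < n)%N ->
   bit_cylinder (nth [::] ws i) (fun k => edge g i (n + k)%N)].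
have wE : window (n + N) E.
  apply: windowI.
    apply: (window_relabel NY) => i iN; rewrite ltn_add2l.
    by apply: leq_trans iN _; exact: leq_maxl.
  move=> g g' gg' h i iw; have := h i iw; rewrite !bit_cylinder_nth /= => {}h k kw.
  rewrite -h// gg'//; first exact: ltn_addr.
  by rewrite ltn_add2l; apply: leq_trans kw (wN i iw).
suff H js0 : (forall i j, (i < n)%N -> (j < n)%N -> js0 i = js0 j -> i = j) ->
  pr mu (relabel double @^-1` Y `&` types_in js0 ws) = pr mu E.
  by move=> h1 h2; rewrite !H.
move=> jinj.
pose F x := if (x < n)%N then (js0 x).*2.+1 else (x - n).*2.
have Fn k : F (n + k)%N = k.*2 by rewrite /F ltnNge leq_addr /= addKn.
have Flt x : (x < n)%N -> F x = (js0 x).*2.+1 by rewrite /F => ->.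
rewrite -[RHS](relabel_window_pr inv (f := F) wE); last first.
  move=> x y xl yl.
  have [xn|nx] := ltnP x n; have [yn|ny] := ltnP y n.
  - by rewrite !Flt// => -[] /double_inj /jinj; apply.
  - by rewrite Flt// -(subnKC ny) Fn => /(congr1 odd); rewrite /= !odd_double.
  - by rewrite (Flt y)// -(subnKC nx) Fn => /(congr1 odd); rewrite /= !odd_double.
  - by rewrite -(subnKC nx) -(subnKC ny) !Fn => /double_inj ->.
congr (pr mu _); rewrite preimage_setI relabel_preimage_comp; congr (_ `&` _).
  by apply: (relabel_window_eq NY) => i _; rewrite /= Fn.
apply/funext => g; apply/propext; rewrite /types_in /type_cylinder /=.
by split=> h i iw; have := h i iw; rewrite !bit_cylinder_nth /vertex_type /= => {}h k kw;
  rewrite -h// edge_relabel Fn Flt.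
Qed.

Lemma type_cylinder_pair w i j : i != j ->
  pr mu (type_cylinder i w `&` type_cylinder j w) = pr mu (types_in id [:: w; w]).
Proof.
move=> ij; have := @types_in_pr0 0%N setT [:: w; w] id
  (fun k => if k is 0%N then i else j) (@windowT 0).
rewrite preimage_setT !setTI => -> //.
  congr (pr mu _); apply/seteqP; split=> g /=.
    by move=> [gi gj] [|[|k]].
  by move=> h; split; [exact: (h 0%N)|exact: (h 1%N)].
move=> [|[|k]] [|[|l]] //= _ _ e; first by rewrite e eqxx in ij.
by rewrite e eqxx in ij.
Qed.

(** The last clause states through moments that, relative to events below N, the types of distinct
    odd vertices beyond N are independent with common weights D. *)
Definition is_type_weights (D : graph_space -> seq bool -> R) :=
  [/\ forall w, measurable_fun setT (fun g => D g w),
      forall g w, 0 <= D g w <= 1,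
      {ae mu, forall g, additive_weights (D g)} &
      forall ws N Y js, window N Y ->
        (forall i, (i < size ws)%N -> ((size (nth [::] ws i)).*2 <= N)%N) ->
        (forall i, (i < size ws)%N -> (N <= (js i).*2.+1)%N) ->
        (forall i j, (i < size ws)%N -> (j < size ws)%N -> js i = js j -> i = j) ->
        mean mu (fun g => \1_Y g * \prod_(w <- ws) D g w) =
        pr mu (Y `&` types_in js ws)].

(* De Finetti: given the even vertices, the types of the odd ones are independent
   with the limits of the empirical frequencies as common law. *)
Lemma type_weights_exist : exists D, is_type_weights D.
Proof.
have mZ w j : measurable (type_cylinder j w) by exact: measurable_type_cylinder.
have [D0 HD] := choice (fun w => averages_converge (mZ w) (type_cylinder_pair w)).
exists (fun g w => D0 w g).
have mD w : measurable_fun setT (D0 w) by have [] := HD w.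
have D01 w g : 0 <= D0 w g <= 1 by have [_ + _] := HD w; exact.
have bD w : bounded_measurable (D0 w).
  by split=> //; exists 1 => g; have /andP[d0 d1] := D01 w g; rewrite ger0_norm.
have cD w : {ae mu, forall g, average R (fun j => type_cylinder j w) k g @[k --> \oo] --> D0 w g}.
  by have [] := HD w.
split=> //.
  have := ae_countable (P := mu) cD; apply: filterS => g cg; split.
  - have h : average R (fun j => type_cylinder j [::]) k g @[k --> \oo] --> (1 : R).
      apply: cvg_near_cst; apply: nearW => k; rewrite /average.
      under eq_bigr do rewrite indicE mem_set//.
      by rewrite sumr_const card_ord natrX mulVf// expf_neq0.
    exact: (cvg_unique _ (cg [::]) h).
  - by move=> w; have /andP[] := D01 w g.
  - move=> w; have h := cvgD (cg (rcons w false)) (cg (rcons w true)).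
    suff E k : average R (fun j => type_cylinder j w) k g =
        average R (fun j => type_cylinder j (rcons w false)) k g +
        average R (fun j => type_cylinder j (rcons w true)) k g.
      have h2 : average R (fun j => type_cylinder j w) k g @[k --> \oo] -->
          D0 (rcons w false) g + D0 (rcons w true) g.
        by rewrite (eq_cvg _ _ E); exact: h.
      exact: (cvg_unique _ (cg w) h2).
    rewrite /average -mulrDr -big_split /=; congr (_ * _).
    apply: eq_bigr => j _; rewrite !indicE.
    rewrite -[RHS]natrD; congr (_%:R).
    set t := vertex_type g j.
    have E b : (g \in type_cylinder j (rcons w b)) = (mkseq t (size w) == w) && (t (size w) == b).
      rewrite -eqseq_rcons -mkseqS; apply/idP/eqP; rewrite inE /type_cylinder /bit_cylinder /=.
        by rewrite size_rcons.
      by rewrite size_rcons.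
    have E0 : (g \in type_cylinder j w) = (mkseq t (size w) == w).
      by apply/idP/eqP; rewrite inE.
    by rewrite !E E0; case: (_ == w); case: (t _).
(* One word at a time: D of w is a limit of frequencies of w among the types. For each index l >= N
   the event that vertex l has prefix w is absorbed into Y, and the window grows to N' before the
   induction hypothesis applies. *)
elim=> [|w ws IH] N Y js NY wN jN jinj.
  have -> : types_in js [::] = setT by apply/seteqP; split.
  rewrite setIT -mean_indic; last exact: window_measurable NY.
  by congr mean; apply/funext => g; rewrite big_nil mulr1.
have mY := window_measurable NY.
have bP : bounded_measurable (fun g => \prod_(v <- ws) D0 v g).
  elim: ws {IH wN jN jinj} => [|v ws IH].
    under [X in bounded_measurable X]eq_fun do rewrite big_nil; exact: bm_cst.
  under [X in bounded_measurable X]eq_fun do rewrite big_cons.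
  exact: bmM.
have bh := bmM (bm_indic mY) bP.
rewrite -(mean_average_limit (mZ w) (cD w) (mD w) bh (N := N)
  (a := pr mu (Y `&` types_in js (w :: ws)))).
  by congr mean; apply/funext => g; rewrite big_cons; ring.
move=> l Nl.
rewrite (_ : (fun g => _) = (fun g =>
    \1_(Y `&` type_cylinder l w) g * \prod_(v <- ws) D0 v g)); last first.
  by apply/funext => g; rewrite indicI /=; ring.
pose N' := maxn N l.*2.+2.
rewrite (IH N' _ (addn N')).
- transitivity (pr mu (Y `&` types_in (fun i => if i is i'.+1 then (N' + i')%N else l) (w :: ws))).
    congr (pr mu _); rewrite -setIA; congr (_ `&` _); apply/seteqP; split=> g /=.
      by move=> [gl h] [|i] iw //; exact: h.
    by move=> h; split; [exact: (h 0%N)|move=> i iw; exact: (h i.+1)].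
  apply: (types_in_pr NY) => //.
  + by move=> [|i] iw; rewrite /N'; lia.
  + by move=> [|i] [|j] iw jw; rewrite /N'; lia.
- apply: windowI; first exact: window_le (leq_maxl _ _) NY.
  apply: window_type_cylinder; first exact: leq_maxr.
  by apply: leq_trans (leq_maxl _ _); exact: (wN 0%N).
- by move=> i iw; apply: leq_trans (leq_maxl _ _); exact: (wN i.+1).
- by move=> i iw; lia.
- by move=> i j _ _ /addnI.
Qed.

End vertex_types.

(** * Graphs sampled from the even vertices *)

Lemma ae_xsection d d' (T : measurableType d) (T' : measurableType d') (R : realType)
    (P : probability T R) (Q : probability T' R) (B : set (T * T')) :
  measurable B -> product_probability P Q B = 0%E ->
  {ae P, forall x, Q (xsection B x) = 0%E}.
Proof.
move=> mB B0.
have mQ := measurable_fun_xsection Q mB.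
have : (\int[P]_x `|(Q \o xsection B) x| = 0)%E.
  by rewrite -B0; apply: eq_integral => x _; rewrite gee0_abs.
move=> /(ae_eq_integral_abs P measurableT mQ).
by apply: filterS => x /(_ I).
Qed.

Section assembly.
Variable k : nat.
Implicit Types (g : graph_space) (t : sequence_space bool) (tau : nat -> sequence_space bool).

Definition clique_between g (t t' : nat -> bool) : Prop :=
  exists c : {ffun 'I_k -> nat},
    (forall i j, i != j -> edge g (c i).*2 (c j).*2) /\
    forall i, t (c i) && t' (c i).

Lemma clique_between_sym g t t' : clique_between g t t' -> clique_between g t' t.
Proof.
move=> [c [cc ct]]; exists c; split=> // i; rewrite andbC; exact: ct.
Qed.

Definition type_adjacent g t t' : bool := ~~ `[< clique_between g t t' >].

Lemma type_adjacentC g t t' : type_adjacent g t t' = type_adjacent g t' t.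
Proof.
by congr (~~ _); apply: asbool_equiv_eq; split; exact: clique_between_sym.
Qed.

Definition assemble_edge (b : bool) g tau : rel nat := fun i j =>
  if odd i then
    if odd j then [&& b, i != j & type_adjacent g (tau i./2) (tau j./2)]
    else tau i./2 j./2
  else if odd j then tau j./2 i./2 else edge g i j.

Lemma assemble_edge_sym b g tau : symmetric (assemble_edge b g tau).
Proof.
move=> i j; rewrite /assemble_edge; case: (odd i); case: (odd j) => //.
  by rewrite eq_sym type_adjacentC.
exact: edge_sym.
Qed.

Lemma assemble_edge_irr b g tau : irreflexive (assemble_edge b g tau).
Proof.
by move=> i; rewrite /assemble_edge; case: (odd i); rewrite ?eqxx ?andbF//; exact: edge_irr.
Qed.

(* b = false drops the edges between odd vertices; the remaining ones determine
   them when g has the law of a universal graph. *)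
Definition assemble b g tau : graph_space :=
  mk_graphN (assemble_edge_sym b g tau) (assemble_edge_irr b g tau).

Lemma edge_assemble b g tau i j : edge (assemble b g tau) i j = assemble_edge b g tau i j.
Proof. by []. Qed.

Lemma edge_assemble_even b g tau i j :
  edge (assemble b g tau) i.*2 j.*2 = edge g i.*2 j.*2.
Proof. by rewrite edge_assemble /assemble_edge !odd_double. Qed.

Lemma edge_assemble_type b g tau i j :
  edge (assemble b g tau) i.*2.+1 j.*2 = tau i j.
Proof.
by rewrite edge_assemble /assemble_edge /= !odd_double /= uphalf_double doubleK.
Qed.

Lemma edge_assemble_odd b g tau i j : edge (assemble b g tau) i.*2.+1 j.*2.+1 =
  [&& b, i != j & type_adjacent g (tau i) (tau j)].
Proof.
rewrite edge_assemble /assemble_edge /= !odd_double /= !uphalf_double.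
by rewrite eqSS (inj_eq double_inj).
Qed.

Lemma vertex_type_assemble b g tau j : vertex_type (assemble b g tau) j = tau j.
Proof. by apply/funext => i; rewrite /vertex_type edge_assemble_type. Qed.

Lemma parity_ind (Q : nat -> Prop) :
  (forall i, Q i.*2) -> (forall i, Q i.*2.+1) -> forall i, Q i.
Proof.
move=> Q0 Q1 i; rewrite -(odd_double_half i); case: (odd i); rewrite ?add0n ?add1n.
  exact: Q1.
exact: Q0.
Qed.

Lemma edge_ext_parity g g' :
  (forall i j, edge g i.*2 j.*2 = edge g' i.*2 j.*2) ->
  (forall i j, edge g i.*2.+1 j.*2 = edge g' i.*2.+1 j.*2) ->
  (forall i j, edge g i.*2.+1 j.*2.+1 = edge g' i.*2.+1 j.*2.+1) -> g = g'.
Proof.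
move=> h0 h1 h2; apply: edge_ext => i j; elim/parity_ind: i => i; elim/parity_ind: j => j //.
by rewrite edge_sym h1 edge_sym.
Qed.

Lemma type_adjacent_assemble b g tau t t' :
  type_adjacent (assemble b g tau) t t' = type_adjacent g t t'.
Proof.
congr (~~ _); apply: asbool_equiv_eq; split=> -[c [cc ct]]; exists c; split=> // i j ij.
  by rewrite -(edge_assemble_even b g tau); exact: cc.
by rewrite edge_assemble_even; exact: cc.
Qed.

(** Assembling reads only the edges between even vertices and the types, and alters neither. So the
    graph without odd-odd edges determines the full one. *)
Lemma assemble_assemble b b' g tau :
  assemble b (assemble b' g tau) (vertex_type (assemble b' g tau)) = assemble b g tau.
Proof.
have e : vertex_type (assemble b' g tau) = tau.
  by apply/funext => j; exact: vertex_type_assemble.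
rewrite e; apply: edge_ext_parity => i j.
- by rewrite !edge_assemble_even.
- by rewrite !edge_assemble_type.
- by rewrite !edge_assemble_odd type_adjacent_assemble.
Qed.

Lemma measurable_clique_between d (T : measurableType d) (G : T -> graph_space)
    (t t' : T -> sequence_space bool) :
  (forall i j, measurable [set x | edge (G x) i j]) ->
  (forall i, measurable_fun setT (fun x => t x i)) ->
  (forall i, measurable_fun setT (fun x => t' x i)) ->
  measurable [set x | clique_between (G x) (t x) (t' x)].
Proof.
move=> mG mt mt'; apply: measurable_ex => c; apply: measurable_andP.
  apply: measurable_all => i; apply: measurable_all => j.
  by apply: measurable_imp; [exact: measurable_prop|exact: mG].
apply: measurable_all => i.
rewrite (_ : mkset _ = (fun x => t x (c i)) @^-1` [set true] `&`
   (fun x => t' x (c i)) @^-1` [set true]).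
  apply: measurableI; rewrite -[X in measurable X]setTI; [exact: mt|exact: mt'].
by apply/seteqP; split=> x /= => [/andP//|[-> ->]].
Qed.

Lemma measurable_type_adjacent d (T : measurableType d) (G : T -> graph_space)
    (t t' : T -> sequence_space bool) :
  (forall i j, measurable [set x | edge (G x) i j]) ->
  (forall i, measurable_fun setT (fun x => t x i)) ->
  (forall i, measurable_fun setT (fun x => t' x i)) ->
  measurable [set x | type_adjacent (G x) (t x) (t' x)].
Proof.
move=> mG mt mt'.
rewrite (_ : mkset _ = ~` [set x | clique_between (G x) (t x) (t' x)]).
  by apply: measurableC; exact: measurable_clique_between.
by apply/seteqP; split=> x /=; rewrite /type_adjacent => /asboolPn.
Qed.

Lemma measurable_assemble d (T : measurableType d) b (G : T -> graph_space)
    (tau : T -> nat -> sequence_space bool) :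
  (forall i j, measurable [set x | edge (G x) i j]) ->
  (forall j i, measurable_fun setT (fun x => tau x j i)) ->
  measurable_fun setT (fun x => assemble b (G x) (tau x)).
Proof.
move=> mG mt.
have mt1 j i : measurable [set x | tau x j i].
  rewrite (_ : mkset _ = (fun x => tau x j i) @^-1` [set true]).
    by rewrite -[X in measurable X]setTI; exact: mt.
  by apply/seteqP; split.
apply: measurable_fun_graph => i j.
elim/parity_ind: i => i; elim/parity_ind: j => j.
- by under eq_set do rewrite edge_assemble_even; exact: mG.
- by under eq_set do rewrite edge_sym edge_assemble_type; exact: mt1.
- by under eq_set do rewrite edge_assemble_type; exact: mt1.
- under eq_set do rewrite edge_assemble_odd.
  case: b; case: (i != j) => /=; try by rewrite (_ : mkset _ = set0)//; apply/seteqP; split.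
  exact: measurable_type_adjacent.
Qed.

End assembly.

Section sampled_types.
Context (R : realType) (mu : probability graph_space R).
Local Notation X := (unit_lebesgue R).
Local Notation m := (@unit_measure R : probability _ R).
Variables (D : graph_space -> seq bool -> R) (M : probability (sequence_space X) R).
Hypotheses (mM : bernoulli_measure m M) (wD : is_type_weights mu D).
Variable k : nat.

Definition sampled_types g (u : sequence_space X) : nat -> sequence_space bool :=
  fun j => itv_code (D g) (u j).

Definition sampled_graph b (p : graph_space * sequence_space X) : graph_space :=
  assemble k b p.1 (sampled_types p.1 p.2).

Lemma measurable_sampled_types j i :
  measurable_fun setT (fun p : graph_space * sequence_space X =>
    sampled_types p.1 p.2 j i).
Proof.
have [mD _ _ _] := wD.
apply: (measurable_itv_code (nu := fun p : graph_space * sequence_space X => D p.1)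
  (u := fun p => (p.2 j : R))).
  by move=> w; exact: (measurableT_comp (mD w) measurable_fst).
apply: (measurableT_comp (@measurable_unit_id R)).
exact: (measurableT_comp (measurable_coord j) measurable_snd).
Qed.

Lemma measurable_edge_fst i j :
  measurable [set p : graph_space * sequence_space X | edge p.1 i j].
Proof.
rewrite (_ : mkset _ = fst @^-1` [set g : graph_space | edge g i j])//.
rewrite -[X in measurable X]setTI.
by apply: measurable_fst => //; exact: measurable_edge.
Qed.

Lemma measurable_sampled_graph b : measurable_fun setT (sampled_graph b).
Proof.
apply: measurable_assemble; first exact: measurable_edge_fst.
exact: measurable_sampled_types.
Qed.

Lemma measurable_self_assemble b :
  measurable_fun setT (fun g => assemble k b g (vertex_type g)).
Proof.
apply: measurable_assemble; first exact: measurable_edge.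
move=> j i; apply: (measurable_fun_bool true); rewrite setTI.
exact: measurable_edge_eq.
Qed.

Let measurable_sampled_cylinder g w : measurable
  [set x : X | bit_cylinder w (itv_code (D g) x)].
Proof.
rewrite -[X in measurable X]setTI.
exact: (measurable_code (D g) measurableT (measurable_bit_cylinder w)).
Qed.

(** Given g, the points are independent and each has prefix w with probability [D g w], by
    [code_law]. Integrating the product over g is the last clause of [is_type_weights]. *)
Lemma sampled_cylinders_law Y N n (w : nat -> seq bool) : window N Y ->
  (forall j, (j < n)%N -> ((size (w j)).*2 <= N)%N) ->
  product_probability mu M [set p | Y p.1 /\ forall j, (j < n)%N ->
    bit_cylinder (w j) (sampled_types p.1 p.2 j)] =
  (pr mu (Y `&` types_in (addn N) (mkseq w n)))%:E.
Proof.
move=> NY wN; have [mD D01 aD joint] := wD.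
have mY := window_measurable NY.
rewrite -(joint (mkseq w n) N Y (addn N) NY); first last.
- by move=> i j _ _ /addnI.
- by move=> i _; lia.
- by move=> i; rewrite size_mkseq => iw; rewrite nth_mkseq//; exact: wN.
rewrite /product_probability /product_measure1.
have bP : bounded_measurable (fun g => \1_Y g * \prod_(v <- mkseq w n) D g v).
  apply: bmM; first exact: bm_indic.
  elim: (mkseq w n) => [|v ws IH].
    by under [X in bounded_measurable X]eq_fun do rewrite big_nil; exact: bm_cst.
  under [X in bounded_measurable X]eq_fun do rewrite big_cons.
  apply: bmM => //; split=> //; exists 1 => g.
  by have /andP[d0 d1] := D01 g v; rewrite ger0_norm.
rewrite -mean_EFin//; apply: ae_eq_integral => //.
- apply: measurable_fun_xsection; apply: measurable_andP.
    rewrite (_ : mkset _ = fst @^-1` Y)//.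
    by rewrite -[X in measurable X]setTI; by apply: measurable_fst.
  apply: measurable_all => j; apply: measurable_imp; first exact: measurable_prop.
  rewrite (_ : mkset _ = (fun p => sampled_types p.1 p.2 j) @^-1` bit_cylinder (w j))//.
  rewrite -[X in measurable X]setTI; apply: measurable_bits => //.
    by move=> i; exact: measurable_sampled_types.
  exact: measurable_bit_cylinder.
- by apply/measurable_EFinP; case: bP.
apply: filterS aD => g gA _ /=.
have [Yg|nYg] := pselect (Y g); last first.
  rewrite indicE memNset//= mul0r (_ : xsection _ _ = set0) ?measure0//.
  by apply/seteqP; split=> // u; rewrite /xsection /= inE => -[].
rewrite indicE mem_set//= mul1r.
rewrite (_ : xsection _ _ = box n (fun j => [set x : X | bit_cylinder (w j) (itv_code (D g) x)])).
  rewrite (bernoulli_box mM)//.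
  rewrite /mkseq big_map -[X in iota _ X]subn0 -/(index_iota 0 n) big_mkord -prodEFin.
  by apply: eq_bigr => j _; exact: code_law.
apply/seteqP; split=> u; rewrite /xsection /= inE; first by move=> [].
by move=> h; split.
Qed.

End sampled_types.

Lemma ae_mono d (T : measurableType d) (R : realType) (P : probability T R)
    (Q1 Q2 : T -> Prop) : (forall x, Q1 x -> Q2 x) ->
  {ae P, forall x, Q1 x} -> {ae P, forall x, Q2 x}.
Proof. by move=> h; apply: filterS => x; exact: h. Qed.

Section assemble_pattern.
Variables (n : nat) (h : {ffun 'I_n.*2 * 'I_n.*2 -> bool}).

Let H (i j : nat) : bool :=
  match insub i, insub j with Some a, Some b => h (a, b) | _, _ => false end.

Let HE (i j : 'I_n.*2) : H i j = h (i, j).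
Proof. by rewrite /H !valK. Qed.

Definition pattern_even : set graph_space :=
  [set g | forall i j, (i < n)%N -> (j < n)%N -> edge g i j = H i.*2 j.*2].

Definition pattern_word (j : nat) : seq bool := mkseq (fun i => H j.*2.+1 i.*2) n.

(** A pattern violating this is met by no graph assembled with b = false: such a graph has no
    odd-odd edges and is symmetric. *)
Definition pattern_consistent : Prop :=
  (forall i j, (i < n)%N -> (j < n)%N -> H i.*2.+1 j.*2.+1 = false) /\
  (forall i j, (i < n)%N -> (j < n)%N -> H j.*2 i.*2.+1 = H i.*2.+1 j.*2).

Lemma window_pattern_even : window n pattern_even.
Proof. by move=> g g' gg' gh i j ilt jlt; rewrite -gg'// gh. Qed.

Lemma pattern_assemble k g tau : pattern h (assemble k false g tau) <->
  pattern_consistent /\ ((relabel double @^-1` pattern_even) g /\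
   forall j, (j < n)%N -> bit_cylinder (pattern_word j) (tau j)).
Proof.
set ag := assemble k false g tau.
have E : pattern h ag <-> forall i j, (i < n.*2)%N -> (j < n.*2)%N -> edge ag i j = H i j.
  split=> [gh i j ilt jlt|gh p].
    by rewrite (gh (Ordinal ilt, Ordinal jlt)) -(HE (Ordinal ilt) (Ordinal jlt)).
  by rewrite gh// HE; case: p.
have even_lt i : (i < n)%N -> (i.*2 < n.*2)%N by rewrite ltn_double.
have odd_lt i : (i < n)%N -> (i.*2.+1 < n.*2)%N by rewrite ltn_Sdouble.
rewrite E; split.
  move=> gh; split.
    split=> i j ilt jlt; first by rewrite -gh ?odd_lt// edge_assemble_odd.
    by rewrite -!gh ?odd_lt ?even_lt// edge_sym.
  split; first by move=> i j ilt jlt; rewrite edge_relabel -gh ?even_lt// edge_assemble_even.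
  move=> j jlt; rewrite bit_cylinder_nth /pattern_word size_mkseq => i ilt.
  by rewrite nth_mkseq// -gh ?odd_lt ?even_lt// edge_assemble_type.
move=> [[H1 H2] [ev wd]] i j.
have T i' j' : (i' < n)%N -> (j' < n)%N -> edge ag i'.*2.+1 j'.*2 = H i'.*2.+1 j'.*2.
  move=> ilt jlt; have := wd i' ilt; rewrite bit_cylinder_nth /pattern_word size_mkseq.
  by move=> /(_ j' jlt); rewrite nth_mkseq// edge_assemble_type.
elim/parity_ind: i => i; elim/parity_ind: j => j; rewrite ?ltn_double ?ltn_Sdouble => ilt jlt.
- by rewrite edge_assemble_even; have := ev i j ilt jlt; rewrite edge_relabel.
- by rewrite edge_sym T// H2.
- exact: T.
- by rewrite edge_assemble_odd H1.
Qed.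

End assemble_pattern.

Section sampled_graph_law.
Context (R : realType) (mu : probability graph_space R) (s : nat).
Local Notation X := (unit_lebesgue R).
Local Notation m := (@unit_measure R : probability _ R).
Variables (D : graph_space -> seq bool -> R) (M : probability (sequence_space X) R).
Hypotheses (mM : bernoulli_measure m M) (inv : perm_invariant mu)
  (wD : is_type_weights mu D).
Hypotheses (s_gt2 : (2 < s)%N) (univ : {ae mu, forall g, universal_K_free (edge g) s}).
Local Notation k := (s - 2)%N.

(** Without odd-odd edges a pattern fixes a window event on even vertices and finitely many prefixes
    of types. Sampled types have the joint law of the types of odd vertices beyond the window, and
    [types_in_pr0] trades these for the first ones. *)
Lemma sampled_graph_half_law A : measurable A ->
  product_probability mu M (sampled_graph D k false @^-1` A) =
  mu ((fun g => assemble k false g (vertex_type g)) @^-1` A).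
Proof.
pose P1 := image_probability (product_probability mu M)
  (measurable_sampled_graph wD k false).
pose P2 := image_probability mu (measurable_self_assemble k false).
suff h B : measurable B -> P1 B = P2 B by exact: h.
move: B; apply: graph_measure_unique; first exact: fin_num_fun_lty.
(* The doubled window holds n even and n odd vertices. *)
move=> n C0 nC0; have nC : window n.*2 C0.
  by apply: window_le nC0; rewrite -addnn leq_addr.
apply: (window_measure_pattern nC) => h.
change (product_probability mu M (sampled_graph D k false @^-1` pattern h) =
  mu ((fun g => assemble k false g (vertex_type g)) @^-1` pattern h)).
have [cons|ncons] := pselect (pattern_consistent h); last first.
  rewrite (_ : _ @^-1` _ = set0); last first.
    by apply/seteqP; split=> // p; rewrite /preimage /= /sampled_graph pattern_assemble => -[].
  rewrite (_ : _ @^-1` _ = set0); last first.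
    by apply/seteqP; split=> // p; rewrite /preimage /= pattern_assemble => -[].
  by rewrite !measure0.
pose Y := relabel double @^-1` pattern_even h.
have wY : window n.*2 Y.
  by apply: (window_relabel (@window_pattern_even _ h)) => i; rewrite ltn_double.
have mY := window_measurable wY.
rewrite (_ : _ @^-1` _ = [set p | Y p.1 /\ forall j, (j < n)%N ->
    bit_cylinder (pattern_word h j) (sampled_types D p.1 p.2 j)]); last first.
  apply/seteqP; split=> p; rewrite /preimage /= /sampled_graph pattern_assemble.
    by move=> [].
  by move=> ?; split.
rewrite (sampled_cylinders_law mM wD wY); last first.
  by move=> j _; rewrite size_mkseq.
rewrite (_ : _ @^-1` _ = Y `&` types_in id (mkseq (pattern_word h) n)); last first.
  apply/seteqP; split=> g; rewrite /preimage /= pattern_assemble /types_in /=.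
    move=> [_ [Yg hg]]; split=> // i; rewrite size_mkseq => ilt.
    by rewrite nth_mkseq//; exact: hg.
  move=> [Yg hg]; split=> //; split=> // j jlt; have := hg j.
  by rewrite size_mkseq nth_mkseq//; apply.
rewrite prE; last by apply: measurableI => //; exact: measurable_types_in.
congr _%:E; apply: (types_in_pr0 inv (@window_pattern_even _ h)) => //.
by move=> i j _ _ /addnI.
Qed.

Lemma ae_self_assemble : {ae mu, forall g, assemble k true g (vertex_type g) = g}.
Proof.
have ae_odd (i : nat * nat) : {ae mu, forall g, i.1 != i.2 ->
    (edge g i.1.*2.+1 i.2.*2.+1 = false <->
     clique_through s double g i.1.*2.+1 i.2.*2.+1)}.
  have [->|ne] := eqVneq i.1 i.2; first by apply: aeW => g.
  have nodd a b : b.*2 != a.*2.+1.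
    by apply/eqP => /(congr1 odd); rewrite /= !odd_double.
  have pq : i.1.*2.+1 != i.2.*2.+1 by rewrite eqSS (inj_eq double_inj).
  by apply: ae_mono (ae_clique_through s_gt2 inv univ double_inj pq (nodd i.1) (nodd i.2))
    => g h _.
apply: filterS (ae_countable ae_odd) => g gE.
apply: edge_ext_parity => i j.
- by rewrite edge_assemble_even.
- by rewrite edge_assemble_type.
rewrite edge_assemble_odd /=; have [->|ne] := eqVneq i j; first by rewrite edge_irr.
have hE : edge g i.*2.+1 j.*2.+1 = false <->
  clique_between k g (vertex_type g i) (vertex_type g j) := gE (i, j) ne.
rewrite /type_adjacent; case: asboolP => h /=; first exact/esym/hE.
by apply/esym/negPn/negP => /negbTE /hE.
Qed.

(** F restores the odd-odd edges. It maps the half-assembled graph to the sampled graph on one side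
    and, almost surely, to g itself on the other, so the equality of half laws passes to full
    laws. *)
Lemma sampled_graph_law A : measurable A ->
  product_probability mu M (sampled_graph D k true @^-1` A) = mu A.
Proof.
move=> mA; pose F g := assemble k true g (vertex_type g).
have mF : measurable (F @^-1` A).
  by rewrite -[X in measurable X]setTI; exact: measurable_self_assemble.
transitivity (product_probability mu M (sampled_graph D k false @^-1` (F @^-1` A))).
  congr (product_probability mu M _); apply/funext => p; rewrite /preimage /mkset /F.
  by rewrite assemble_assemble.
rewrite sampled_graph_half_law//.
have [N [mN N0 FN]] := ae_self_assemble.
have e g : F (assemble k false g (vertex_type g)) = F g by exact: assemble_assemble.
apply: (@pr_ae_eq _ _ _ mu _ _ N) => //.
  rewrite (_ : _ @^-1` _ = F @^-1` A)//.
  by apply/funext => g; rewrite /preimage /mkset e.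
move=> g nNg; rewrite /preimage /mkset e (_ : F g = g)//.
by apply: contrapT => h; apply: nNg; exact: FN.
Qed.

End sampled_graph_law.

(** * Typical graphs *)

Section sections_of_products.
Context d d' (T : measurableType d) (T' : measurableType d') (R : realType).
Variables (P : probability T R) (Q : probability T' R).

Lemma bm_xsection (B : set (T * T')) : measurable B ->
  bounded_measurable (fun x => pr Q (xsection B x)).
Proof.
move=> mB; split.
  apply/measurable_EFinP.
  rewrite (_ : EFin \o _ = Q \o xsection B); first exact: measurable_fun_xsection.
  by apply/funext => x /=; rewrite prE//; exact: measurable_xsection.
exists 1 => x; rewrite ger0_norm ?pr_ge0// pr_le1//.
exact: measurable_xsection.
Qed.

Lemma mean_xsection (B : set (T * T')) : measurable B ->
  mean P (fun x => pr Q (xsection B x)) = pr (product_probability P Q) B.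
Proof.
move=> mB; rewrite /mean /Rintegral /pr /product_probability /product_measure1.
congr fine; apply: eq_integral => x _ /=; rewrite fineK//.
by apply: fin_num_measure; exact: measurable_xsection.
Qed.

Lemma ae_ae (Z : T * T' -> Prop) : measurable [set p | Z p] ->
  {ae product_probability P Q, forall p, Z p} ->
  {ae P, forall x, {ae Q, forall y, Z (x, y)}}.
Proof.
move=> mZ aeZ.
have mC := measurableC mZ.
have Z0 : product_probability P Q (~` [set p | Z p]) = 0%E.
  by apply: pr0_ae => //; exact: (ae_setP _ mZ).1.
apply: ae_mono (ae_xsection mC Z0) => x x0.
exists (xsection (~` [set p | Z p]) x); split=> //; first exact: measurable_xsection.
by move=> y /= nZ; rewrite /xsection /= inE.
Qed.

End sections_of_products.

Section cons_sequence.
Context d (X : measurableType d) (R : realType).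
Variables (m : probability X R) (M : probability (sequence_space X) R).
Hypothesis mM : bernoulli_measure m M.

(** Isolates the first point, so that a property of almost all sequences becomes one of almost all
    points followed by almost all sequences. *)
Definition cons_sequence (p : X * sequence_space X) : sequence_space X :=
  fun i => if i is i'.+1 then p.2 i' else p.1.

Lemma measurable_cons_sequence : measurable_fun setT cons_sequence.
Proof.
apply: measurable_fun_sequence => -[|i]; first exact: measurable_fst.
exact: (measurableT_comp (measurable_coord i) measurable_snd).
Qed.

Lemma bernoulli_cons A : measurable A ->
  product_probability m M (cons_sequence @^-1` A) = M A.
Proof.
move=> mA.
pose P1 := image_probability (product_probability m M) measurable_cons_sequence.
suff h B : measurable B -> P1 B = M B by exact: h.
move: B; apply: sequence_measure_unique; first exact: fin_num_fun_lty.
move=> [|n] B mB.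
  rewrite boxT.
  exact: etrans (probability_setT P1) (esym (probability_setT M)).
change (product_probability m M (cons_sequence @^-1` box n.+1 B) = M (box n.+1 B)).
have -> : cons_sequence @^-1` box n.+1 B = B 0%N `*` box n (fun i => B i.+1).
  apply/seteqP; split=> -[x v] /=.
    by move=> h; split=> [|i ilt]; [exact: (h 0%N)|exact: (h i.+1)].
  by move=> [h0 h] [|i] ilt //=; exact: h.
change ((m \x M)%E (B 0%N `*` box n (fun i => B i.+1)) = M (box n.+1 B)).
rewrite product_measure1E//; last exact: measurable_box.
have -> : M (box n.+1 B) = (\prod_(i < n.+1) m (B i))%E by exact: bernoulli_box.
rewrite big_ord_recl; congr (_ * _)%E.
by apply: etrans (bernoulli_box mM n (A := fun i => B i.+1) _) _.
Qed.

Lemma bernoulli_pair (E : set (X * X)) : measurable E ->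
  M [set u | E (u 0%N, u 1%N)] = (m \x m)%E E.
Proof.
move=> mE.
have mp : measurable_fun setT (fun u : sequence_space X => (u 0%N, u 1%N)).
  by apply: measurable_fun_pair; exact: measurable_coord.
rewrite (product_measure_unique (m' := image_probability M mp))// => A B mA mB.
change (M [set u | A (u 0%N) /\ B (u 1%N)] = (m A * m B)%E).
rewrite (_ : mkset _ = box 2 (fun i => if i is 0%N then A else B)).
  rewrite (bernoulli_box mM); last by case.
  by rewrite big_ord_recl big_ord_recl big_ord0 /= mule1.
apply/seteqP; split=> u /=; first by move=> [uA uB] [|[|i]].
by move=> h; split; [exact: (h 0%N)|exact: (h 1%N)].
Qed.

Lemma bernoulli_coord i (A : set X) : measurable A ->
  M [set u | A (u i)] = m A.
Proof.
move=> mA; rewrite (_ : mkset _ = box i.+1 (fun j => if j == i then A else setT)).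
  rewrite (bernoulli_box mM); last by move=> j; case: eqP.
  rewrite big_ord_recr /= eqxx big1 ?mul1e// => j _.
  by rewrite ltn_eqF// probability_setT.
apply/seteqP; split=> u /=; first by move=> uA j _; case: eqP => // ->.
by move=> /(_ i (ltnSn i)); rewrite eqxx.
Qed.

End cons_sequence.

Section typical_graph.
Context (R : realType) (mu : probability graph_space R) (s : nat).
Local Notation X := (unit_lebesgue R).
Local Notation m := (@unit_measure R : probability _ R).
Variables (D : graph_space -> seq bool -> R) (M : probability (sequence_space X) R).
Hypotheses (mM : bernoulli_measure m M) (inv : perm_invariant mu) (erg : perm_ergodic mu)
  (wD : is_type_weights mu D).
Hypotheses (s_gt2 : (2 < s)%N) (univ : {ae mu, forall g, universal_K_free (edge g) s}).
Local Notation k := (s - 2)%N.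
Local Notation Psi := (sampled_graph D k true).
Local Notation odd_vertex := (fun j : nat => j.*2.+1).

Let mPsi : measurable_fun setT Psi := measurable_sampled_graph wD k true.

Let odd_inj : injective odd_vertex.
Proof. by move=> i j [] /double_inj. Qed.

Lemma ae_sampled (Z : graph_space -> Prop) : measurable [set g | Z g] ->
  {ae mu, forall g, Z g} -> {ae mu, forall g, {ae M, forall u, Z (Psi (g, u))}}.
Proof.
move=> mZ aeZ.
have mPZ : measurable [set p | Z (Psi p)].
  by rewrite -[X in measurable X]setTI; exact: mPsi.
apply: (ae_ae mPZ); apply: (ae_setP _ mPZ).2.
apply: etrans (sampled_graph_law mM inv wD s_gt2 univ mZ) _.
exact: (ae_setP _ mZ).1.
Qed.

Let odd_part (p : graph_space * sequence_space X) : graph_space :=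
  relabel odd_vertex (Psi p).

Let m_odd_part A : measurable A -> measurable (odd_part @^-1` A).
Proof.
move=> mA; rewrite -[X in measurable X]setTI.
exact: (measurableT_comp (measurable_relabel odd_vertex) mPsi).
Qed.

Let odd_part_law A : measurable A ->
  pr (product_probability mu M) (odd_part @^-1` A) = pr mu A.
Proof.
move=> mA; rewrite /pr; congr fine.
transitivity (mu (relabel odd_vertex @^-1` A)); last exact: perm_invariant_injection.
by apply: sampled_graph_law => //; exact: measurable_relabel_preimage.
Qed.

Let odd_part_edge g u i j : edge (odd_part (g, u)) i j =
  (i != j) && type_adjacent k g (itv_code (D g) (u i)) (itv_code (D g) (u j)).
Proof. by rewrite /odd_part edge_relabel edge_assemble_odd. Qed.

(* By ergodicity the law of the sampled graph given the even vertices is constant: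
   its second moments factor, since disjoint vertex sets are independent. *)
Lemma ae_sampled_law : {ae mu, forall g, forall A, measurable A ->
  M [set u | A (relabel odd_vertex (Psi (g, u)))] = mu A}.
Proof.
(* There are countably many patterns, so one null set of graphs serves all events A. *)
have ae_pat (x : {n & {ffun 'I_n * 'I_n -> bool}}) : {ae mu, forall g,
    pr M (xsection (odd_part @^-1` pattern (tagged x)) g) = pr mu (pattern (tagged x))}.
  case: x => n h /=; set C := pattern h.
  have nC : window n C by exact: window_of_pattern.
  have mC := window_measurable nC; have mOC := m_odd_part mC.
  pose C2 := C `&` relabel (addn n) @^-1` C.
  have mC2 : measurable C2 by apply: measurableI => //; exact: measurable_relabel_preimage.
  have mOC2 := m_odd_part mC2.
  pose L g := pr M (xsection (odd_part @^-1` C) g); pose c := pr mu C.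
  have bL : bounded_measurable L by exact: bm_xsection.
  have mLE : mean mu L = c by rewrite mean_xsection// odd_part_law.
  (* For fixed g an edge depends only on the two points at its ends, so disjoint blocks of points
     give independent graphs. *)
  have L2 g : pr M (xsection (odd_part @^-1` C2) g) = L g * L g.
    have mS := measurable_xsection g mOC.
    apply: EFin_inj; rewrite EFinM -!prE//; last exact: measurable_xsection.
    rewrite -(bernoulli_independent (n := n) mM mS mS).
      congr (M _); apply/seteqP; split=> u; rewrite /xsection /= !inE /C2 /=.
        move=> [uC uC']; split=> //; move: uC'; rewrite /preimage /=.
        congr C; apply: edge_ext => i j.
        by rewrite edge_relabel !odd_part_edge eqn_add2l.
      move=> [uC uC']; split=> //; move: uC'; rewrite /preimage /=.
      congr C; apply: edge_ext => i j.
      by rewrite edge_relabel !odd_part_edge eqn_add2l.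
    move=> u v uv; rewrite /xsection /= !inE /preimage /=; apply: nC => i j ilt jlt.
    by rewrite !odd_part_edge !uv.
  have mL2E : mean mu (fun g => L g * L g) = c * c.
    rewrite -(dissociated inv erg nC nC) -(odd_part_law mC2) -mean_xsection//.
    by congr mean; apply/funext => g; rewrite L2.
  have bLL := bmM bL bL.
  have b1 : bounded_measurable (fun g => L g * L g + (- (2 * c)) * L g).
    by apply: bmD => //; apply: bmM => //; exact: bm_cst.
  have b2 : bounded_measurable (fun g => (L g * L g + (- (2 * c)) * L g) + c * c).
    by apply: bmD => //; exact: bm_cst.
  have : mean mu (fun g => (L g * L g + (- (2 * c)) * L g) + c * c) = 0.
    rewrite meanD//; last exact: bm_cst.
    rewrite meanD//; last by apply: bmM => //; exact: bm_cst.
    by rewrite (meanZ mu (- (2 * c)) bL) mean_cst mL2E mLE; ring.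
  have sq g : (L g * L g + (- (2 * c)) * L g) + c * c = (L g - c) ^+ 2 by ring.
  move=> m0; have := mean_eq0 b2 _ m0 => ae0; apply: ae_mono (ae0 _) => g.
    by rewrite sq => /eqP; rewrite sqrf_eq0 subr_eq0 => /eqP.
  by rewrite sq sqr_ge0.
apply: ae_mono (ae_countable ae_pat) => g gE A mA.
have mOg : measurable_fun setT (fun u => odd_part (g, u)).
  move=> _ B mB; rewrite setTI.
  rewrite (_ : _ @^-1` B = xsection (odd_part @^-1` B) g).
    by apply: measurable_xsection; exact: m_odd_part.
  by apply/seteqP; split=> u; rewrite /xsection /= inE.
suff h B : measurable B -> image_probability M mOg B = mu B by exact: h.
move: B; apply: graph_measure_unique_pattern; first exact: fin_num_fun_lty.
move=> n h; change (M [set u | pattern h (odd_part (g, u))] = mu (pattern h)).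
have mh := window_measurable (@window_of_pattern n h).
have mOh := measurable_xsection g (m_odd_part mh).
have := gE (Tagged (fun n => {ffun 'I_n * 'I_n -> bool}) h) => /= e.
rewrite [RHS]prE// -e -prE//; congr (M _).
by apply/seteqP; split=> u; rewrite /xsection /= inE.
Qed.

Lemma ae_types_distinct : {ae mu, forall g, {ae M, forall u,
  exists i, itv_code (D g) (u 0%N) i != itv_code (D g) (u 1%N) i}}.
Proof.
(* 1 and 3 are the odd vertices with points [u 0] and [u 1]. *)
pose Z (g : graph_space) := exists i, edge g 1 i.*2 != edge g 3 i.*2.
have mZ : measurable [set g | Z g].
  apply: measurable_ex => i.
  rewrite (_ : mkset _ = [set g : graph_space | ~ exists b,
    edge g 1 i.*2 = b /\ edge g 3 i.*2 = b]).
    apply: measurable_not; apply: measurable_ex => b.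
    by apply: measurable_andP; exact: measurable_edge_eq.
  apply/seteqP; split=> g /=; first by move=> ne [b [e1 e2]]; rewrite e1 e2 eqxx in ne.
  by move=> h; apply/eqP => e; apply: h; exists (edge g 3 i.*2).
have nodd a b : b.*2 != a.*2.+1.
  by apply/eqP => /(congr1 odd); rewrite /= !odd_double.
have aeZ : {ae mu, forall g, Z g}.
  exact: (ae_separated_through s_gt2 inv univ double_inj (isT : 1%N != 3%N) (nodd 0%N) (nodd 1%N)).
apply: ae_mono (ae_sampled mZ aeZ) => g; apply: ae_mono => u [i].
rewrite -[1%N]/((0%N).*2.+1) -[3%N]/((1%N).*2.+1) !edge_assemble_type => ne.
by exists i.
Qed.

(* The type of an odd vertex can be read off from its adjacencies to the other odd
   vertices; this is what makes the sampled measurable graph pure. *)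
Definition type_witnessed g (t : nat -> bool) (tau : nat -> sequence_space bool) i :=
  exists c : {ffun 'I_k -> nat},
    (forall a b, a != b -> (c a != c b) && type_adjacent k g (tau (c a)) (tau (c b))) /\
    forall a, type_adjacent k g t (tau (c a)) && tau (c a) i.

(** The clique criterion is applied to the pair of vertex 1 and an even vertex, with the clique
    taken among the remaining odd vertices. Vertex 1 carries the point x and the others carry v, so
    x can be fixed before v is drawn. *)
Lemma ae_type_witnessed : {ae mu, forall g, {ae m, forall x : X, {ae M, forall v, forall i,
  itv_code (D g) x i = false <-> type_witnessed g (itv_code (D g) x) (sampled_types D g v) i}}}.
Proof.
(* The odd vertices from 3 on, vertex 1 being kept for x. *)
pose far (j : nat) := j.*2.+3.
have far_inj : injective far by move=> a b [] /double_inj.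
pose Z (g : graph_space) := forall i, edge g 1 i.*2 = false <-> clique_through s far g 1 i.*2.
have mZ : measurable [set g | Z g].
  apply: measurable_all => i.
  have mcl : measurable [set g | clique_through s far g 1 i.*2].
    apply: measurable_ex => c; apply: measurable_andP.
      apply: measurable_all => a; apply: measurable_all => b.
      by apply: measurable_imp; [exact: measurable_prop|exact: measurable_edge].
    apply: measurable_all => a.
    rewrite (_ : mkset _ = [set g | edge g 1 (far (c a))] `&` [set g | edge g i.*2 (far (c a))]).
      by apply: measurableI; exact: measurable_edge.
    by apply/seteqP; split=> g /= => [/andP|[-> ->]].
  by apply: measurable_andP; apply: measurable_imp => //; exact: measurable_edge_eq.
have aeZ : {ae mu, forall g, Z g}.
  apply: ae_countable => i.
  apply: (ae_clique_through s_gt2 inv univ far_inj) => //.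
  - by apply/eqP => /(congr1 odd); rewrite /= odd_double.
  - by move=> j; apply/eqP => /(congr1 odd); rewrite /= !odd_double.
apply: ae_mono (ae_sampled mZ aeZ) => g gZ.
have mZg : measurable [set u | Z (Psi (g, u))].
  rewrite (_ : mkset _ = xsection (Psi @^-1` [set h | Z h]) g).
    apply: measurable_xsection.
    by rewrite -[X in measurable X]setTI; exact: mPsi.
  by apply/seteqP; split=> u; rewrite /xsection /= inE.
have mZc : measurable [set p : X * sequence_space X | Z (Psi (g, cons_sequence p))].
  by rewrite -[X in measurable X]setTI; exact: (measurable_cons_sequence measurableT mZg).
have aeZc : {ae product_probability m M, forall p, Z (Psi (g, cons_sequence p))}.
  apply: (ae_setP _ mZc).2; apply: etrans (bernoulli_cons mM mZg) _.
  exact: (ae_setP _ mZg).1.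
apply: ae_mono (ae_ae mZc aeZc) => x; apply: ae_mono => v xv i.
pose G := Psi (g, cons_sequence (x, v)).
have x_type : edge G 1 i.*2 = itv_code (D g) x i.
  by rewrite -[1%N]/((0%N).*2.+1) edge_assemble_type.
rewrite -x_type; apply: iff_trans (xv i) _.
have type_edge j i' : edge G j.*2.+3 i'.*2 = itv_code (D g) (v j) i'.
  by rewrite -[j.*2.+3]/(j.+1.*2.+1) edge_assemble_type.
have x_edge j : edge G 1 j.*2.+3 = type_adjacent k g (itv_code (D g) x) (itv_code (D g) (v j)).
  by rewrite -[1%N]/((0%N).*2.+1) -[j.*2.+3]/(j.+1.*2.+1) edge_assemble_odd.
have far_edge a b : edge G a.*2.+3 b.*2.+3 = (a != b) &&
    type_adjacent k g (itv_code (D g) (v a)) (itv_code (D g) (v b)).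
  by rewrite -[a.*2.+3]/(a.+1.*2.+1) -[b.*2.+3]/(b.+1.*2.+1) edge_assemble_odd.
split=> -[c [cc ci]]; exists c; split.
- by move=> a b ab; rewrite -far_edge; exact: cc.
- by move=> a; rewrite /sampled_types -x_edge -type_edge [edge _ _ i.*2]edge_sym; exact: ci.
- by move=> a b ab; rewrite far_edge; exact: cc.
- by move=> a; rewrite x_edge edge_sym type_edge; exact: ci.
Qed.

End typical_graph.

(** * The measurable graph of an ergodic measure *)

Lemma ae_inhabited d (T : measurableType d) (R : realType) (P : probability T R)
    (Q : T -> Prop) : {ae P, forall x, Q x} -> exists x, Q x.
Proof.
move=> [N [mN N0 QN]]; apply: contrapT => nex.
have NT : N = setT.
  apply/seteqP; split=> // x _; apply: QN => /= Qx; apply: nex; by exists x.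
have := probability_setT P; rewrite -NT => /(etrans (esym N0))/eqP.
by rewrite eq_sym onee_eq0.
Qed.

(** If the edge 01 were null, exchangeability would make every edge null, and no vertex could
    separate 0 from 1. *)
Lemma universal_edge_pos (R : realType) (mu : probability graph_space R) s :
  (2 < s)%N -> perm_invariant mu ->
  {ae mu, forall g, universal_K_free (edge g) s} ->
  (0 < mu [set g | edge g 0 1])%E.
Proof.
move=> s_gt2 inv univ; rewrite lt_def measure_ge0 andbT; apply/eqP => e0.
pose C := [set g : graph_space | edge g 0 1].
have wC : window 2 C by move=> g g' gg'; rewrite /C /= gg'.
have ae_no (x : nat * nat) : {ae mu, forall g, x.1 != x.2 -> edge g x.1 x.2 = false}.
  have [->|ne] := eqVneq x.1 x.2; first by apply: aeW => g.
  pose f i := if i is 0%N then x.1 else x.2.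
  exists [set g | edge g x.1 x.2]; split; first exact: measurable_edge.
    apply/eqP; rewrite prE ?eqe; last exact: measurable_edge.
    have -> : [set g | edge g x.1 x.2] = relabel f @^-1` C by [].
    rewrite (relabel_window_pr inv wC) /pr ?e0//.
    by move=> [|[|i]] [|[|j]] //= _ _ e; rewrite e eqxx in ne.
  by move=> g /=; apply: contra_notP => /negP/negbTE.
have sep := ae_separated_through s_gt2 inv univ (e := fun i => i.+2)
  (p := 0%N) (q := 1%N) _ isT _ _.
have sep' : {ae mu, forall g, exists i, edge g 0 i.+2 != edge g 1 i.+2}.
  by apply: sep => // i j [].
have [g [no [i]]] := ae_inhabited (filterI (ae_countable ae_no) sep').
by rewrite (no (0%N, i.+2))// (no (1%N, i.+2)).
Qed.

Section from_ergodic.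
Context (R : realType) (mu : probability graph_space R) (s : nat).
Local Notation X := (unit_lebesgue R).
Local Notation m := (@unit_measure R : probability _ R).
Local Notation k := (s - 2)%N.

Lemma measurable_graph_of_ergodic : (2 < s)%N -> perm_invariant mu -> perm_ergodic mu ->
  {ae mu, forall g, universal_K_free (edge g) s} ->
  exists G : measurable_graph R, K_free_universal G s /\ is_graph_measure G mu.
Proof.
move=> s_gt2 inv erg univ.
have [M mM] := unit_bernoulli R.
have [D wD] := type_weights_exist inv.
have [_ _ wadd _] := wD.
have [g [[[gA law] distinct] witnessed]] := ae_inhabited (filterI (filterI (filterI
  wadd (ae_sampled_law mM inv erg wD s_gt2 univ))
  (ae_types_distinct mM inv wD s_gt2 univ)) (ae_type_witnessed mM inv wD s_gt2 univ)).
pose code (x : X) : sequence_space bool := itv_code (D g) x.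
pose E : set (X * X) := [set p | type_adjacent k g (code p.1) (code p.2)].
have mcode i : measurable_fun setT (fun x : X => code x i).
  exact: (measurableT_comp (@measurable_coord _ bool i) (measurable_code (D g))).
have mE : measurable E.
  apply: (@measurable_type_adjacent k _ _ (fun=> g)) => [i j|i|i].
  - exact: measurable_prop.
  - exact: (measurableT_comp (mcode i) measurable_fst).
  - exact: (measurableT_comp (mcode i) measurable_snd).
have Esym x y : E (x, y) -> E (y, x) by rewrite /E /= type_adjacentC.
have sampleE (u : sequence_space X) i j :
    edge (relabel (fun j : nat => j.*2.+1) (sampled_graph D k true (g, u))) i j =
    (i != j) && ((u i, u j) \in E).
  rewrite edge_relabel edge_assemble_odd; case: (i != j) => //=.
  by apply/idP/idP => h; [exact: mem_set|exact: (set_mem h)].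
have Epos : (0 < (m \x m) E)%E.
  rewrite -(bernoulli_pair mM mE).
  suff -> : [set u : sequence_space X | E (u 0%N, u 1%N)] = [set u |
      [set h : graph_space | edge h 0 1]
        (relabel (fun j : nat => j.*2.+1) (sampled_graph D k true (g, u)))].
    by rewrite (law _ (measurable_edge 0 1)); exact: universal_edge_pos s_gt2 inv univ.
  apply/seteqP; split=> u /= h; first by rewrite sampleE; exact: mem_set.
  by move: h; rewrite sampleE => h; exact: (set_mem h).
pose G : measurable_graph R := MeasurableGraph (unit_measure_lebesgue R) mE Esym Epos.
have sample_law A : measurable A -> mu A = pushforward M (@sample_graph R G) A.
  move=> mA; rewrite -(law A mA) /pushforward; congr (M _).
  apply/funext => u; rewrite /preimage /mkset; congr A.
  by apply: edge_ext => i j; rewrite sampleE.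
exists G; split; last by exists M.
split; last first.
  exists M => //; have mU := measurable_universal s.
  have mSU : measurable (@sample_graph R G @^-1` [set h | universal_K_free (edge h) s]).
    by rewrite -[X in measurable X]setTI; exact: (measurable_sample (G := G)).
  apply: (ae_setP M mSU).2; apply: etrans (esym (sample_law _ mU)) _.
  exact: (ae_setP mu mU).1.
(* Equal codes at x < y would make the code constant on [x, y]; the first two sampled points would
   then share their type with probability at least (y - x)^2, against [distinct]. *)
have code_inj (x y : R) : 0 <= x -> x < y -> y < 1 -> itv_code (D g) x =1 itv_code (D g) y -> False.
  move=> x0 xy y1 cxy.
  pose J : set X := (`[x, y]%classic : set R).
  have mJ : measurable J by apply: unit_measurable_borel; exact: measurable_itv.
  have mB : measurable (box 2 (fun=> J)) by exact: measurable_box.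
  have [N [mN N0 distN]] := distinct.
  have : (M (box 2 (fun=> J)) <= 0)%E.
    rewrite -N0; apply: le_measure; rewrite ?inE//.
    move=> u uJ; apply: distN => /= -[i].
    have u_code j : (j < 2)%N -> itv_code (D g) (u j) =1 itv_code (D g) x.
      move=> j2; have := uJ j j2; rewrite /J /= in_itv /= => uxy.
      exact: (itv_code_convex gA x0 uxy y1 cxy).
    by rewrite !u_code// eqxx.
  rewrite (bernoulli_box mM)// big_ord_recl big_ord_recl big_ord0 mule1.
  have -> : m J = (y - x)%:E.
    change (lebesgue_measure (`[x, y]%classic `&` `[0%R, 1%R]%classic : set R) = (y - x)%:E).
    rewrite setIidl; last first.
      by move=> z; rewrite /= !in_itv /= => /andP[h1 h2]; apply/andP; split; lra.
    by rewrite lebesgue_measure_itv /= lte_fin xy EFinB.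
  by rewrite -EFinM lee_fin leNgt mulr_gt0// subr_gt0.
have [N [mN N0 witN]] := witnessed.
pose I : set X := (`[0%R, 1%R[%classic : set R).
have mI : measurable I by apply: unit_measurable_borel; exact: measurable_itv.
(* The right end 1 is left out because addresses are controlled on [0, 1[ only. *)
exists (~` N `&` I); split.
- by apply: measurableI => //; exact: measurableC.
- have mNI : measurable (N `|` ~` I) by apply: measurableU => //; exact: measurableC.
  have : m (N `|` ~` I) = 0%E.
    by apply: null_set_setU => //; [exact: measurableC|exact: (unit_interval_ae R)].
  rewrite (_ : ~` N `&` I = ~` (N `|` ~` I)); last by rewrite setCU setCK.
  by move=> NI0; rewrite probability_setC// NI0 sube0.
move=> x y [nNx Ix] [nNy Iy] xy0.
have xwit : {ae M, forall v, forall i, itv_code (D g) x i = false <->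
    type_witnessed s g (itv_code (D g) x) (sampled_types D g v) i}.
  by apply: contrapT => h; apply: nNx; exact: witN.
have ywit : {ae M, forall v, forall i, itv_code (D g) y i = false <->
    type_witnessed s g (itv_code (D g) y) (sampled_types D g v) i}.
  by apply: contrapT => h; apply: nNy; exact: witN.
have mxy : measurable (xsection E x `+` xsection E y).
  by apply: measurableY; exact: measurable_xsection.
(* A sampled point almost surely avoids the null set where the neighbourhoods of x and y differ. *)
have same (j : nat) : {ae M, forall v, E (x, v j) <-> E (y, v j)}.
  exists [set v | (xsection E x `+` xsection E y) (v j)]; split.
  - exact: measurable_coord_preimage.
  - exact: etrans (bernoulli_coord mM j mxy) xy0.
  - move=> v /= nE; apply: contrapT => nS; apply: nE.
    have sec z : xsection E z (v j) <-> E (z, v j) by rewrite /xsection /= inE.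
    split=> h; apply: contrapT => h'; apply: nS.
      by left; split; [exact/sec|move=> /sec].
    by right; split; [exact/sec|move=> /sec].
(* A single v witnesses both types and is joined in the same way to x and y, so the same cliques are
   witnesses for both and the codes coincide. *)
have [v [[xv yv] sv]] := ae_inhabited (filterI (filterI xwit ywit) (ae_countable same)).
have codes : itv_code (D g) x =1 itv_code (D g) y.
  have wit_eq i : type_witnessed s g (itv_code (D g) x) (sampled_types D g v) i <->
      type_witnessed s g (itv_code (D g) y) (sampled_types D g v) i.
    split=> -[c [cc ci]]; exists c; split=> // a; have /andP[h1 h2] := ci a.
      by apply/andP; split=> //; exact: (sv (c a)).1 h1.
    by apply/andP; split=> //; exact: (sv (c a)).2 h1.
  move=> i; have h : itv_code (D g) x i = false <-> itv_code (D g) y i = false.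
    by apply: iff_trans (xv i) _; apply: iff_trans (wit_eq i) _; apply: iff_sym.
  by case: (itv_code _ x i) h; case: (itv_code _ y i) => // -[h1 h2];
    [have := h2 erefl|have := h1 erefl].
move: Ix Iy; rewrite /I /= !in_itv /= => /andP[x0 x1] /andP[y0 y1].
have [xy|yx|//] := ltgtP (x : R) y.
- by have := code_inj x y x0 xy y1 codes.
- by have := code_inj y x y0 yx x1 (fsym codes).
Qed.

End from_ergodic.

Theorem theorem10 (R : realType) (s : nat) (s_gt2 : (2 < s)%N)
    (mu : probability graph_space R) :
  [/\ perm_invariant mu, perm_ergodic mu &
      {ae mu, forall g, universal_K_free (edge g) s}] <->
  exists G : measurable_graph R,
    K_free_universal G s /\ is_graph_measure G mu.
Proof.
split=> [[inv erg univ]|[G [Gs Gmu]]]; first exact: measurable_graph_of_ergodic.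
exact: graph_measure_ergodic Gs Gmu.
Qed.
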